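(* Let $n\ge 2$ and let $G\subset\mathbb{R}^n$ be a bounded open set with $\mathcal{L}^n(\partial G)=0$. Then: (i) For every $L\in[0,\mathrm{Per}(G))$ problem $(P)$ admits a solution, i.e. there is a measurable set $E\subset\overline{G}$ with $\mathrm{Per}(E)=L$ and $\mathcal{L}^n(E)\ge\mathcal{L}^n(E')$ for every measurable $E'\subset\overline{G}$ with $\mathrm{Per}(E')=L$. (ii) If $L>\mathrm{Per}(G)$, then problem $(P)$ (for this value of $L$) does not have a solution, i.e. there is no measurable set $E\subset\overline{G}$ with $\mathrm{Per}(E)=L$ that has maximal volume among all measurable subsets of $\overline{G}$ with perimeter $L$.
   Context: $\mathcal{L}^n$ denotes Lebesgue measure on $\mathbb{R}^n$. For an $\mathcal{L}^n$-measurable set $E\subset\mathbb{R}^n$, the perimeter (relative to the whole space $\mathbb{R}^n$) is $$\mathrm{Per}(E):=\sup\left\{\int_E \mathrm{div}\,\varphi\,dx : \varphi\in C^1_0(\mathbb{R}^n,\mathbb{R}^n),\ |\varphi|\le 1\right\}\in[0,\infty],$$ where $C^1_0$ denotes compactly supported $C^1$ fields. $L$ is a finite real number; $\mathrm{Per}(G)$ may be $+\infty$. Problem $(P)$ for $L$: find a (measurable) subset $E\subset\overline{G}$ with $\mathrm{Per}(E)=L$ and such that $\mathcal{L}^n(E)$ is maximal among all such subsets. *)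

(* Defs.v *)
From HB Require Import structures.
From mathcomp Require Import all_boot all_order all_algebra.
From mathcomp Require Import all_classical all_reals all_analysis.

Set Implicit Arguments.
Unset Strict Implicit.
Unset Printing Implicit Defensive.

Import Order.TTheory GRing.Theory Num.Theory.
Import numFieldNormedType.Exports.

Local Open Scope classical_set_scope.
Local Open Scope ring_scope.

(* R^n is 'rV[R]_n. Its library norm is the sup norm, which induces the usual
   topology and the usual bounded sets; the Euclidean norm is eucl_norm below. *)

Section lebesgue.
Context {R : realType} {n : nat}.
Implicit Types (p : 'rV[R]_n * 'rV[R]_n) (A : set 'rV[R]_n).
Implicit Types (B : set ('rV[R]_n * 'rV[R]_n)).

Definition box p : set 'rV[R]_n :=
  [set x | forall i, p.1 0 i < x 0 i <= p.2 0 i].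

(* The maximum accounts for the empty boxes. *)
Definition box_volume p : R := \prod_(i < n) Num.max 0 (p.2 0 i - p.1 0 i).

Definition box_cover A B :=
  countable B /\ A `<=` \bigcup_(p in B) box p.

Definition lebesgue_outer A : \bar R :=
  ereal_inf [set \esum_(p in B) (box_volume p)%:E | B in box_cover A].

Lemma box_volume_ge0 p : 0 <= box_volume p.
Proof. by apply: prodr_ge0 => i _; rewrite le_max lexx. Qed.

Local Open Scope ereal_scope.

Lemma lebesgue_outer_ge0 A : 0 <= lebesgue_outer A.
Proof.
apply: le_ereal_inf_tmp => _ [B _ <-].
by apply: esum_ge0 => p _; rewrite lee_fin box_volume_ge0.
Qed.

Lemma lebesgue_outer0 : lebesgue_outer set0 = 0.
Proof.
apply/eqP; rewrite eq_le lebesgue_outer_ge0 andbT.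
apply: ereal_inf_lbound; exists set0; last by rewrite esum_set0.
by split; [exact: countable0|exact: sub0set].
Qed.

Lemma le_lebesgue_outer : {homo lebesgue_outer : A B / A `<=` B >-> A <= B}.
Proof.
move=> A B AB; apply: ereal_inf_le_tmp => _ [C [cC BC] <-].
by exists C => //; split=> //; exact: subset_trans BC.
Qed.

Lemma lebesgue_outer_sigma_subadditive : sigma_subadditive lebesgue_outer.
Proof.
move=> A; have [[i ioo]|] := pselect (exists i, lebesgue_outer (A i) = +oo).
  rewrite (eseries_pinfty _ _ ioo) ?leey// => k _.
  by rewrite -ltNye (lt_le_trans _ (lebesgue_outer_ge0 _)).
rewrite -forallNE => Aoo.
apply/lee_addgt0Pr => _/posnumP[e].
rewrite (le_trans _ (epsilon_trick _ _ _))//; last first.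
  by move=> k; exact: lebesgue_outer_ge0.
have v0 p : 0 <= (box_volume p)%:E by rewrite lee_fin box_volume_ge0.
pose P k B := box_cover (A k) B /\ \esum_(p in B) (box_volume p)%:E <=
  lebesgue_outer (A k) + (e%:num / (2 ^ k.+1)%:R)%:E.
have [G PG] : {G : nat -> set ('rV[R]_n * 'rV[R]_n) & forall k, P k (G k)}.
  apply: (@choice _ _ P) => k.
  have Afin : lebesgue_outer (A k) \is a fin_num.
    rewrite ge0_fin_numE ?lebesgue_outer_ge0// ltey.
    exact/eqP/Aoo.
  have ek : (0 < e%:num / (2 ^ k.+1)%:R)%R by [].
  have [_ [B AB <-] lB] := lb_ereal_inf_adherent ek Afin.
  by exists B; split=> //; exact: ltW.
apply: (@le_trans _ _ (\esum_(p in \bigcup_k G k) (box_volume p)%:E)).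
  apply: ereal_inf_lbound; exists (\bigcup_k G k) => //; split.
    by apply: bigcup_countable => // k _; exact: (PG k).1.1.
  move=> x [k _ /(PG k).1.2 [p Gp xp]]; exists p => //; by exists k.
rewrite seqDU_bigcup_eq (esum_bigcupT _ _ (@trivIset_seqDU _ _) v0).
rewrite -nneseries_esumT; last by move=> k; exact: esum_ge0.
apply: lee_nneseries => [k _ _|k _]; first exact: esum_ge0.
apply: le_trans (PG k).2.
rewrite esum_mkcond [leRHS]esum_mkcond; apply: le_esum => p _.
case: ifPn => // pG; last by case: ifP.
by rewrite ifT// inE; move: pG; rewrite inE; exact: subset_seqDU.
Qed.

HB.instance Definition _ := isOuterMeasure.Build R 'rV[R]_n lebesgue_outer
  lebesgue_outer0 lebesgue_outer_ge0 le_lebesgue_outer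
  lebesgue_outer_sigma_subadditive.

End lebesgue.

Definition lebesgue_outer_measure (R : realType) (n : nat) :
  {outer_measure set 'rV[R]_n -> \bar R} := @lebesgue_outer R n.

(* R^n with the sigma-algebra of the Lebesgue (i.e. Caratheodory) measurable
   sets; the carrier is convertible to 'rV[R]_n. *)
Notation lebesgueType R n := (caratheodory_type (lebesgue_outer_measure R n)).

Definition lebesgue_measurable {R : realType} {n : nat} (E : set 'rV[R]_n) :=
  measurable (E : set (lebesgueType R n)).

Definition lebesgue_n {R : realType} (n : nat) :
    {measure set (lebesgueType R n) -> \bar R} :=
  (lebesgue_outer_measure R n : set (lebesgueType R n) -> \bar R).

Section perimeter.
Context {R : realType} {n : nat}.
Implicit Types (phi : 'rV[R]_n -> 'rV[R]_n) (E G : set 'rV[R]_n).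

Definition eucl_norm (x : 'rV[R]_n) : R := Num.sqrt (\sum_(i < n) x 0 i ^+ 2).

Definition basis_vec (i : 'I_n) : 'rV[R]_n := delta_mx 0 i.

(* All first-order partial derivatives exist everywhere and are continuous. *)
Definition C1 phi := forall i : 'I_n,
  (forall x, derivable phi x (basis_vec i)) /\
  continuous ('D_(basis_vec i) phi).

Definition compactly_supported phi := compact (closure [set x | phi x != 0]).

Definition divergence phi (x : 'rV[R]_n) : R :=
  \sum_(i < n) 'D_(basis_vec i) (fun y => phi y 0 i) x.

Definition test_field phi :=
  [/\ C1 phi, compactly_supported phi & forall x, eucl_norm (phi x) <= 1].

(* Meaningful for Lebesgue measurable E only; the definitions below use it only
   there. *)
Definition perimeter E : \bar R :=
  ereal_sup [set (\int[lebesgue_n n]_(x in E) (divergence phi x)%:E)%E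
            | phi in test_field].

Definition boundary G : set 'rV[R]_n := closure G `\` interior G.

Definition admissible G (L : R) : set (set 'rV[R]_n) :=
  [set E | [/\ lebesgue_measurable E, E `<=` closure G
             & perimeter E = L%:E]].

Definition solution_P G (L : R) E :=
  admissible G L E /\
  forall E', admissible G L E' -> (lebesgue_n n E' <= lebesgue_n n E)%E.

End perimeter.

(* Main.v *)
(** Existence.  Among the measurable subsets of the closure of G of perimeter at
    most L there is one of maximal volume: volumes are continuous and perimeters
    lower semicontinuous for the measure of the symmetric difference, and sets of
    bounded perimeter in a cube are precompact for it.  If the maximizer had
    perimeter < L < Per(G), it would miss a set of positive measure of G
    (otherwise it would equal G up to a null set), and adding a small cube that it
    does not fill, which costs perimeter O(w^(n-1)), would increase its volume.

    Non-existence.  A solution E for L > Per(G) misses a set of positive measure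
    of G.  Let U be a finely striped open subset of a tiny cell in G, so that
    Per(G \ U) > L.  A set F of minimal volume with G \ U <= F <= G and
    Per(F) <= L has perimeter exactly L: otherwise it would meet U, and removing a
    small cube would decrease its volume.  But |F| >= |G| - |U| > |E|.

    Precompactness.  If every box of a tiling is halved in direction i, with
    halves of width r, then the sum over the boxes of the difference between the
    volumes of E in the two halves is at most r Per(E).  Summing over all dyadic
    scales finer than a given one, E is close to the union of the dyadic cells of
    that scale in which it has density at least 1/2. *)

Require Import Defs.
From mathcomp Require Import all_boot all_order all_algebra.
From mathcomp Require Import all_classical all_reals all_analysis
  measurable_realfun.
From mathcomp Require Import ring lra.
Import Order.TTheory GRing.Theory Num.Theory.
Import numFieldNormedType.Exports.
Set Implicit Arguments.
Unset Strict Implicit.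
Unset Printing Implicit Defensive.
Local Open Scope classical_set_scope.
Local Open Scope ring_scope.

(** * Lebesgue measure of boxes *)

Section lebesgue_theory.
Context {R : realType} {n : nat}.
Implicit Types (p : 'rV[R]_n * 'rV[R]_n) (A : set 'rV[R]_n) (i : 'I_n).
Local Notation mu := (@lebesgue_outer R n).

(** The perimeter is accessible only through its test fields: a lower bound comes from exhibiting
    one, an upper bound from transforming an arbitrary one by a cut-off or a sign change. The
    cut-offs are built from a piecewise quadratic C^1 step with a steepness [k]; sharp indicators
    return as [k] tends to infinity, by dominated convergence. The equation Per(E) = L does not
    survive limits, since the perimeter is only lower semicontinuous. This is why both halves of the
    theorem pass through the constraint Per(E) <= L and recover equality by spending the slack on a
    cube. Such a cube is cheap because w^(n-1) tends to 0, which is where n >= 2 enters. For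
    precompactness the scale must not depend on the set. The quantity [mixing] is, up to a factor 2,
    the distance from E to the unions of cells of a grid. It is small at some scale depending on E,
    because E is nearly open; the halving estimate carries this smallness back to a coarse scale
    fixed in advance, at the price of a geometric series uniform in E. The null boundary allows G to
    be compared with its closure, in which the competitors live. *)

Lemma lebesgue_outer_box p : (mu (box p) <= (box_volume p)%:E)%E.
Proof.
apply: ereal_inf_lbound; exists [set p].
  by split; [exact: countable1|move=> x px; exists p].
by rewrite esum_set1// lee_fin box_volume_ge0.
Qed.

(** An injection [f] of [B] into the natural numbers turns the union into a sequence [C] whose terms
    are single sets [A p] or empty, so subadditivity along sequences applies. *)
Lemma lebesgue_outer_bigcup_esum (I : choiceType) (B : set I)
    (A : I -> set 'rV[R]_n) : countable B ->
  (mu (\bigcup_(k in B) A k) <= \esum_(k in B) mu (A k))%E.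
Proof.
move=> /countable_injP[f finj].
pose C k := \bigcup_(p in B `&` [set p | f p = k]) A p.
have -> : \bigcup_(k in B) A k = \bigcup_k C k.
  apply/seteqP; split => [x [p Bp Ax]|x [k _ [p [Bp _] Ax]]].
    by exists (f p) => //; exists p.
  by exists p.
apply: le_trans (lebesgue_outer_sigma_subadditive _) _.
rewrite nneseries_esumT; last by move=> k; exact: lebesgue_outer_ge0.
have -> : \esum_(k in B) mu (A k) = \esum_(k in f @` B) mu (C k).
  rewrite esum_image//; apply: eq_esum => k Bk; congr lebesgue_outer.
  apply/seteqP; split => [x Ax|x [p [Bp fp] Ax]]; first by exists k.
  by rewrite -(finj p k)// ?inE.
rewrite esum_mkcond [leRHS]esum_mkcond; apply: le_esum => k _.
rewrite ifT ?inE//; case: ifPn => // /negP kB.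
rewrite (_ : C k = set0) ?lebesgue_outer0//; apply/seteqP; split => // x.
by move=> [p [Bp fp]] _; apply: kB; rewrite inE; exists p.
Qed.

Definition cut_below p i (c : R) : 'rV[R]_n * 'rV[R]_n :=
  (p.1, \row_j if j == i then c else p.2 0 j).

Definition cut_above p i (c : R) : 'rV[R]_n * 'rV[R]_n :=
  (\row_j if j == i then c else p.1 0 j, p.2).

Lemma box_volumeD1 p i : box_volume p =
  Num.max 0 (p.2 0 i - p.1 0 i) *
  \prod_(j < n | j != i) Num.max 0 (p.2 0 j - p.1 0 j).
Proof. by rewrite /box_volume (bigD1 i). Qed.

Lemma box_volume_cut_below p i c : box_volume (cut_below p i c) =
  Num.max 0 (c - p.1 0 i) *
  \prod_(j < n | j != i) Num.max 0 (p.2 0 j - p.1 0 j).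
Proof.
rewrite (box_volumeD1 _ i) /= mxE eqxx; congr *%R.
by apply: eq_bigr => j ji; rewrite mxE (negbTE ji).
Qed.

Lemma box_volume_cut_above p i c : box_volume (cut_above p i c) =
  Num.max 0 (p.2 0 i - c) *
  \prod_(j < n | j != i) Num.max 0 (p.2 0 j - p.1 0 j).
Proof.
rewrite (box_volumeD1 _ i) /= mxE eqxx; congr *%R.
by apply: eq_bigr => j ji; rewrite mxE (negbTE ji).
Qed.

Lemma box_cut_below p i c : c <= p.2 0 i ->
  box (cut_below p i c) = box p `&` [set x | x 0 i <= c].
Proof.
move=> cp; apply/seteqP; split => x /=.
  move=> xp; split; last by have := xp i; rewrite /= mxE eqxx => /andP[].
  move=> j; have := xp j; rewrite /= mxE; case: eqP => // -> /andP[-> xc].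
  exact: le_trans cp.
by move=> [xp xc] j /=; have /andP[-> ?] := xp j; rewrite mxE; case: eqP => // ->.
Qed.

Lemma box_cut_above p i c : p.1 0 i <= c ->
  box (cut_above p i c) = box p `&` [set x | c < x 0 i].
Proof.
move=> cp; apply/seteqP; split => x /=.
  move=> xp; split; last by have := xp i; rewrite /= mxE eqxx => /andP[].
  move=> j; have := xp j; rewrite /= mxE; case: eqP => // -> /andP[xc ->].
  by rewrite (le_lt_trans cp).
by move=> [xp xc] j /=; have /andP[? ->] := xp j; rewrite mxE;
  case: eqP => [->|]//=; rewrite ?xc andbT.
Qed.

(** Clamping the cut point keeps lengths additive even when it lies outside the interval or the
    interval is empty. *)
Let max_subr_cut (a b c : R) : Num.max 0 (b - a) =
  Num.max 0 (Num.min c b - a) + Num.max 0 (b - Num.max c a).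
Proof.
by case: (leP c b) => ?; case: (leP c a) => ?; case: (leP 0 (b - a)) => ?;
  do ?[case: leP => ?]; lra.
Qed.

(** The hyperplane cuts each box of a cover of [X] into two boxes of the same total volume, and the
    pieces cover the two parts of [X]; this is the Caratheodory inequality. *)
Lemma measurable_halfspace i c :
  lebesgue_measurable [set x : 'rV[R]_n | x 0 i <= c].
Proof.
apply: le_caratheodory_measurable => X.
apply: le_ereal_inf_tmp => _ [B [cB XB] <-].
pose pl p := cut_below p i (Num.min c (p.2 0 i)).
pose pr p := cut_above p i (Num.max c (p.1 0 i)).
have -> : \esum_(p in B) (box_volume p)%:E =
    (\esum_(p in B) (box_volume (pl p))%:E +
     \esum_(p in B) (box_volume (pr p))%:E)%E.
  rewrite -esumD; try by move=> p _; rewrite lee_fin box_volume_ge0.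
  apply: eq_esum => p _; rewrite -EFinD; congr EFin.
  rewrite box_volume_cut_below box_volume_cut_above (box_volumeD1 _ i).
  by rewrite -mulrDl (max_subr_cut _ _ c).
apply: leeD.
  apply: le_trans (_ : mu (\bigcup_(p in B) box (pl p)) <= _)%E.
    apply: le_lebesgue_outer => x [/XB[p Bp xp] xc]; exists p => //.
    by rewrite box_cut_below ?ge_min ?lexx ?orbT//; split => //=;
      rewrite le_min xc; have /andP[] := xp i.
  apply: le_trans (lebesgue_outer_bigcup_esum _ cB) _.
  by apply: le_esum => p _; exact: lebesgue_outer_box.
apply: le_trans (_ : mu (\bigcup_(p in B) box (pr p)) <= _)%E.
  apply: le_lebesgue_outer => x [/XB[p Bp xp] /negP]; rewrite -ltNge => xc;
    exists p => //.
  by rewrite box_cut_above ?le_max ?lexx ?orbT//; split => //=;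
    rewrite gt_max xc; have /andP[] := xp i.
apply: le_trans (lebesgue_outer_bigcup_esum _ cB) _.
by apply: le_esum => p _; exact: lebesgue_outer_box.
Qed.

Lemma measurable_halfspace_gt i c :
  lebesgue_measurable [set x : 'rV[R]_n | c < x 0 i].
Proof.
rewrite (_ : mkset _ = ~` [set x : 'rV[R]_n | x 0 i <= c]).
  exact: (measurableC (measurable_halfspace i c)).
by apply/seteqP; split => x /=; rewrite ltNge => /negP.
Qed.

Lemma measurable_box p : lebesgue_measurable (box p).
Proof.
rewrite (_ : box p = \bigcap_(i in [set: 'I_n])
  ([set x | p.1 0 i < x 0 i] `&` [set x | x 0 i <= p.2 0 i])); last first.
  apply/seteqP; split => x /= xp i; first by move=> _; have /andP[] := xp i.
  by apply/andP; apply: xp.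
apply: (@fin_bigcap_measurable _ (lebesgueType R n)) => //.
move=> i _; apply: (@measurableI _ (lebesgueType R n)).
  exact: measurable_halfspace_gt.
exact: measurable_halfspace.
Qed.

Lemma lebesgue_outer_shift_le (h : 'rV[R]_n) A :
  (mu [set x | A (x + h)%R] <= mu A)%E.
Proof.
apply: le_ereal_inf_tmp => _ [B [cB AB] <-].
pose s p := (p.1 - h, p.2 - h).
apply: le_trans (_ : mu (\bigcup_(p in B) box (s p)) <= _)%E.
  apply: le_lebesgue_outer => x /AB[p Bp xp]; exists p => // j.
  by have := xp j; rewrite /= !mxE ltrBlDr lerBrDr.
apply: le_trans (lebesgue_outer_bigcup_esum _ cB) _.
apply: le_esum => p _; apply: le_trans (lebesgue_outer_box _) _.
rewrite lee_fin /box_volume le_eqVlt; apply/orP; left; apply/eqP.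
by apply: eq_bigr => j _; rewrite /= !mxE; congr Num.max; ring.
Qed.

Lemma lebesgue_outer_shift (h : 'rV[R]_n) A : mu [set x | A (x + h)] = mu A.
Proof.
apply/le_anti; rewrite lebesgue_outer_shift_le /=.
have := lebesgue_outer_shift_le (- h) [set x | A (x + h)].
by apply: le_trans; apply: le_lebesgue_outer => x /=; rewrite subrK.
Qed.

Lemma measurable_shift (h : 'rV[R]_n) A : lebesgue_measurable A ->
  lebesgue_measurable [set x | A (x + h)].
Proof.
move=> mA; rewrite /lebesgue_measurable /measurable /= => X /=.
rewrite -(lebesgue_outer_shift (-h) X) -[X in (X + _)%E](lebesgue_outer_shift
  (-h)) -[X in (_ + X)%E](lebesgue_outer_shift (-h)).
rewrite [LHS](mA [set x | X (x - h)]).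
by congr (_ + _)%E; congr lebesgue_outer; apply/seteqP; split => x /=;
  rewrite ?subrK.
Qed.

Definition cube (r : R) : 'rV[R]_n * 'rV[R]_n := (const_mx (- r), const_mx r).

Lemma bigcup_cube : \bigcup_j box (cube j.+1%:R) = [set: 'rV[R]_n].
Proof.
apply/seteqP; split => // x _; exists (Num.truncn (\sum_l `|x 0 l|)) => // l.
rewrite !mxE.
have : `|x 0 l| < (Num.truncn (\sum_l `|x 0 l|)).+1%:R.
  by apply: le_lt_trans (truncnS_gt _); rewrite (bigD1 l)//= lerDl sumr_ge0.
by rewrite ltr_norml => /andP[-> /ltW ->].
Qed.

(** Inside a cube the hyperplane lies in slabs of any thickness [t], of volume [t * K] with [K] the
    volume of the section of the cube; countably many cubes exhaust the space. *)
Lemma lebesgue_hyperplane0 i c : mu [set x : 'rV[R]_n | x 0 i = c] = 0%E.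
Proof.
apply/le_anti; rewrite lebesgue_outer_ge0 andbT; set H := (X in mu X).
have bd j : mu (H `&` box (cube j.+1%:R)) = 0%E.
  apply/le_anti; rewrite lebesgue_outer_ge0 andbT.
  have [K HK] : exists K : R, forall t : R, 0 < t ->
      (mu (H `&` box (cube j.+1%:R)) <= (t * K)%:E)%E.
    exists (\prod_(l < n | l != i) Num.max 0 (j.+1%:R - - j.+1%:R)) => t t0.
    apply: le_trans (_ : mu (box (cut_below (cut_above (cube j.+1%:R) i (c -
      t)) i c)) <= _)%E.
      apply: le_lebesgue_outer => x [xc xD] l /=; have := xD l; rewrite !mxE /=.
      by case: eqP => [->|//]; rewrite xc; lra.
    apply: le_trans (lebesgue_outer_box _) _.
    rewrite box_volume_cut_below lee_fin /= mxE eqxx opprB addrC subrK.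
    have -> : Num.max 0 t = t by exact/max_r/ltW.
    rewrite ler_wpM2l ?(ltW t0)//.
    by under eq_bigr => l li do rewrite !mxE (negbTE li).
  apply/lee_addgt0Pr => e e0; rewrite add0e.
  have K0 : 0 <= K.
    by have := HK 1 ltr01; rewrite mul1r => /(le_trans (lebesgue_outer_ge0 _));
      rewrite lee_fin.
  apply: le_trans (HK (e / (K + 1)) _) _; first by rewrite divr_gt0// ltr_wpDl.
  by rewrite lee_fin mulrAC ler_pdivrMr ?ltr_wpDl// ler_wpM2l ?(ltW e0)// lerDl.
rewrite -[H]setIT -bigcup_cube setI_bigcupr.
apply: le_trans (lebesgue_outer_sigma_subadditive _) _.
by rewrite eseries0.
Qed.

End lebesgue_theory.

(** * Dyadic tilings *)

Section tilings.
Context {R : realType} {n : nat}.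
Implicit Types (p q D : 'rV[R]_n * 'rV[R]_n) (A E O : set 'rV[R]_n) (i : 'I_n).
Implicit Types (s : seq ('rV[R]_n * 'rV[R]_n)) (w : 'I_n -> R).
Local Notation mu := (@lebesgue_n R n).
Local Notation T := (lebesgueType R n).

Definition mid p i := (p.1 0 i + p.2 0 i) / 2.
Definition lower_half i p := cut_below p i (mid p i).
Definition upper_half i p := cut_above p i (mid p i).

Definition widths w p := forall i, p.2 0 i - p.1 0 i = w i.
Definition half_width w i : 'I_n -> R := fun j => if j == i then w j / 2 else w j.

Definition halve i s := flatten [seq [:: lower_half i p;
  upper_half i p] | p <- s].
Definition refine (d : seq 'I_n) s := foldl (fun s i => halve i s) s d.

Lemma box_lower_half w i p : (forall i, 0 < w i) -> widths w p ->
  box (lower_half i p) = box p `&` [set x | x 0 i <= mid p i].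
Proof.
by move=> w0 wp; rewrite box_cut_below// /mid; have := w0 i; have := wp i; lra.
Qed.

Lemma box_upper_half w i p : (forall i, 0 < w i) -> widths w p ->
  box (upper_half i p) = box p `&` ~` [set x | x 0 i <= mid p i].
Proof.
move=> w0 wp; rewrite box_cut_above; last by rewrite /mid; have := w0 i;
  have := wp i; lra.
by congr setI; apply/seteqP; split => x /=; rewrite ltNge => /negP.
Qed.

Lemma widths_lower_half w i p : widths w p ->
  widths (half_width w i) (lower_half i p).
Proof.
move=> wp j; rewrite /half_width /= mxE -wp; case: eqP => // ->.
by rewrite /mid; lra.
Qed.

Lemma widths_upper_half w i p : widths w p ->
  widths (half_width w i) (upper_half i p).
Proof.
move=> wp j; rewrite /half_width /= mxE -wp; case: eqP => // ->.
by rewrite /mid; lra.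
Qed.

Lemma half_width_gt0 w i : (forall j, 0 < w j) -> forall j, 0 < half_width w i j.
Proof. by move=> w0 j; rewrite /half_width; case: ifP; rewrite ?divr_gt0. Qed.

(** The identity between indicators encodes covering and disjointness at once, and it can be
    integrated as it stands. *)
Record tiling D w s : Prop := Tiling {
  tiling_w0 : forall i, 0 < w i ;
  tiling_widths : forall p, p \in s -> widths w p ;
  tiling_indic : forall x, \sum_(p <- s) \1_(box p) x = \1_(box D) x :> R }.

Lemma mem_halve i s q : reflect
  (exists2 p, p \in s & q = lower_half i p \/ q = upper_half i p)
  (q \in halve i s).
Proof.
apply: (iffP flattenP) => [[_ /mapP[p ps ->]]|[p ps qp]].
  by rewrite !inE => /orP[] /eqP ->; exists p; auto.
exists [:: lower_half i p; upper_half i p]; first exact/mapP/(ex_intro2 _ _ p).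
by rewrite !inE; case: qp => ->; rewrite eqxx ?orbT.
Qed.

Lemma big_halve (V : nmodType) (F : _ -> V) i s :
  \sum_(q <- halve i s) F q =
  \sum_(p <- s) (F (lower_half i p) + F (upper_half i p)).
Proof.
rewrite big_flatten big_map; apply: eq_bigr => p _.
by rewrite big_cons big_seq1.
Qed.

Lemma tiling1 D w : (forall i, 0 < w i) -> widths w D -> tiling D w [:: D].
Proof.
move=> w0 wD; split => // [p|x]; first by rewrite inE => /eqP ->.
by rewrite big_seq1.
Qed.

Lemma tiling_halve D w s i : tiling D w s ->
  tiling D (half_width w i) (halve i s).
Proof.
move=> [w0 ws Ds]; split; first exact: half_width_gt0.
  move=> _ /mem_halve[p ps [] ->]; first exact/widths_lower_half/ws.
  exact/widths_upper_half/ws.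
move=> x; rewrite -Ds big_halve big_seq [RHS]big_seq.
apply: eq_bigr => p /ws wp.
rewrite (box_lower_half i w0 wp) (box_upper_half i w0 wp) !indicI indicC.
by rewrite /= !indicE; case: (x \in _); case: (x \in _) => /=; lra.
Qed.

Lemma tiling_refine D w s d : tiling D w s ->
  tiling D (fun i => w i / 2 ^+ count_mem i d) (refine d s).
Proof.
elim: d s w => [|i d IH] s w Ds /=.
  by have -> : (fun i => w i / 2 ^+ 0) = w by apply/funext => i; rewrite divr1.
have := IH _ _ (tiling_halve i Ds).
congr tiling; apply/funext => j; rewrite /half_width eq_sym.
by case: eqP => //= _; rewrite add1n exprS invfM mulrA.
Qed.

(** Two distinct boxes through [x] would contribute 2 to a sum of indicators that is at most 1. *)
Lemma tiling_inj D w s p q x : tiling D w s -> p \in s -> q \in s ->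
  box p x -> box q x -> p = q.
Proof.
move=> [_ _ Ds] ps qs px qx; apply/eqP/negP => /negP pq.
have : \sum_(p <- s) \1_(box p) x <= 1 :> R by rewrite Ds indicE; case: (_ \in _).
rewrite (big_rem p)//= (big_rem q) /=; last first.
  by move: qs; rewrite (perm_mem (perm_to_rem ps)) inE eq_sym (negbTE pq).
have -> : \1_(box p) x = 1 :> R by rewrite indicE mem_set.
have -> : \1_(box q) x = 1 :> R by rewrite indicE mem_set.
rewrite leNgt -subr_lt0 => /negP; apply.
have : 0 <= \sum_(y <- rem q (rem p s)) \1_(box y) x :> R.
  by apply: sumr_ge0 => ? _; rewrite indicE.
by lra.
Qed.

Lemma tiling_mem D w s x : tiling D w s -> box D x ->
  exists2 p, p \in s & box p x.
Proof.
move=> [_ _ Ds] Dx; apply: contrapT => H.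
have := Ds x; rewrite [RHS]indicE mem_set// big_seq big1;
  first by move/esym/eqP; rewrite oner_eq0.
by move=> p ps; rewrite indicE memNset// => px; apply: H; exists p.
Qed.

Lemma tiling_sub D w s p : tiling D w s -> p \in s -> box p `<=` box D.
Proof.
move=> [_ _ Ds] ps x px; apply: contrapT => Dx.
have := Ds x; rewrite [RHS]indicE memNset// (big_rem p)//= indicE mem_set//=.
have : 0 <= \sum_(y <- rem p s) \1_(box y) x :> R.
  by apply: sumr_ge0 => ? _; rewrite indicE.
by lra.
Qed.

Definition cells (P : set ('rV[R]_n * 'rV[R]_n)) s : set 'rV[R]_n :=
  \bigcup_(p in [set` s] `&` P) box p.

Lemma measurable_cells P s : lebesgue_measurable (cells P s).
Proof.
apply: (@fin_bigcup_measurable _ T); first exact: finite_setIl.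
by move=> p _; exact: measurable_box.
Qed.

Lemma measure_tiling D w s A : tiling D w s -> lebesgue_measurable A ->
  (\sum_(p <- s) mu (A `&` box p) = mu (A `&` box D))%E.
Proof.
move=> [_ _ Ds] mA.
rewrite setIC -(integral_indic _ (mA : measurable (A : set T)) (measurable_box
  D)).
under eq_integral => x _ do rewrite -Ds -sumEFin.
rewrite ge0_integral_sum; [| exact: mA | |].
- apply: eq_bigr => p _; rewrite (integral_indic _ (mA : measurable (A : set
  T)) (measurable_box p)).
  by congr lebesgue_outer; rewrite setIC.
- move=> p; apply/measurable_EFinP/measurable_funTS.
  exact: (measurable_indic (measurable_box p)).
- by move=> p x _; rewrite lee_fin indicE.
Qed.

Lemma lebesgue_n_shift (h : 'rV[R]_n) A : mu [set x | A (x + h)] = mu A.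
Proof. exact: lebesgue_outer_shift. Qed.

(** Boxes with the same widths are translates of each other. *)
Lemma eq_widths_measure w p q : widths w p -> widths w q ->
  mu (box p) = mu (box q).
Proof.
move=> wp wq; rewrite -(lebesgue_n_shift (p.1 - q.1) (box p)).
congr (mu _); apply/seteqP; split => x xb j.
all: by have := xb j; have := wp j; have := wq j; rewrite !mxE; lra.
Qed.

Lemma measure_bounded_lty D A : A `<=` box D -> (mu A < +oo)%E.
Proof.
move=> AD; apply: (@le_lt_trans _ _ (box_volume D)%:E); last exact: ltry.
by apply: le_trans (lebesgue_outer_box D); exact: le_lebesgue_outer.
Qed.

(** [fine] sends an infinite measure to 0, so this is meaningful only for finite measure; the lemmas
    comparing volumes therefore ask for an enclosing box. *)
Definition volume (A : set 'rV[R]_n) : R := fine (mu A).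

Lemma volume_ge0 A : 0 <= volume A.
Proof. by apply/fine_ge0/lebesgue_outer_ge0. Qed.

Lemma volumeE D A : A `<=` box D -> (volume A)%:E = mu A.
Proof.
move=> /measure_bounded_lty AD; rewrite fineK// ge0_fin_numE//.
Qed.

Lemma le_volume D A B : B `<=` box D -> A `<=` B -> volume A <= volume B.
Proof.
move=> BD AB; rewrite -lee_fin (volumeE BD) (@volumeE D) //;
  last exact: subset_trans BD.
exact: le_lebesgue_outer.
Qed.

Lemma volume_setIDC D A B : A `<=` box D -> lebesgue_measurable A ->
  lebesgue_measurable B -> volume A = volume (A `&` B) + volume (A `\` B).
Proof.
move=> AD mA mB; apply: EFin_inj; rewrite EFinD !(@volumeE D) => //;
  try by move=> x [] /AD.
by rewrite addeC -(measureDI mu mA mB).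
Qed.

Lemma volumeU_le D A B : A `<=` box D -> B `<=` box D ->
  volume (A `|` B) <= volume A + volume B.
Proof.
move=> AD BD; rewrite -lee_fin EFinD !(@volumeE D)//; last by move=> x [/AD|/BD].
exact: (outer_measureU2 (lebesgue_outer_measure R n)).
Qed.

Lemma volume_tiling D w s A : tiling D w s -> lebesgue_measurable A ->
  \sum_(p <- s) volume (A `&` box p) = volume (A `&` box D).
Proof.
move=> Ds mA; apply: EFin_inj; rewrite -sumEFin (@volumeE D); last by move=> x [].
rewrite -(measure_tiling Ds mA); apply: eq_bigr => p _.
by rewrite (@volumeE p) // => x [].
Qed.

Lemma box_subset_open D w O x : (forall i, 0 < w i) -> widths w D -> open O ->
  O x -> exists M, forall m, (M <= m)%N -> forall p,
  widths (fun i => w i / 2 ^+ m) p -> box p x -> box p `<=` O.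
Proof.
move=> w0 wD oO Ox.
have /nbhs_ballP[e /= e0 He] : nbhs x O by exact: open_nbhs_nbhs.
pose W := \sum_i w i.
have W0 : 0 <= W by apply: sumr_ge0 => i _; exact: ltW.
(* [W / e < m < 2 ^ m], so each side [w j / 2 ^ m <= W / 2 ^ m] of [p] is shorter than [e]. *)
exists (Num.truncn (W / e)).+1 => m Mm p wp px y py; apply: He; split => // i j.
rewrite (ord1 i) -ball_normE /=.
have /andP[px1 px2] := px j; have /andP[py1 py2] := py j; have wj := wp j.
apply: (@le_lt_trans _ _ (w j / 2 ^+ m)); first by rewrite -wj ler_norml; lra.
rewrite ltr_pdivrMr ?exprn_gt0// mulrC -ltr_pdivrMr//.
apply: (@le_lt_trans _ _ (W / e)).
  rewrite ler_pM2r ?invr_gt0// /W (bigD1 j)//= lerDl.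
  by apply: sumr_ge0 => l _; exact: ltW.
apply: (lt_le_trans (truncnS_gt _)); apply: (@le_trans _ _ m%:R);
  first by rewrite ler_nat.
by rewrite -natrX ler_nat ltnW// ltn_expl.
Qed.

Definition grid m D := refine (flatten (nseq m (enum 'I_n))) [:: D].

Lemma count_mem_grid m i : count_mem i (flatten (nseq m (enum 'I_n))) = m.
Proof.
rewrite count_flatten map_nseq sumn_nseq -[RHS]mul1n; congr muln.
by rewrite count_uniq_mem ?enum_uniq// mem_enum.
Qed.

Lemma tiling_grid D w m : (forall i, 0 < w i) -> widths w D ->
  tiling D (fun i => w i / 2 ^+ m) (grid m D).
Proof.
move=> w0 wD; have := tiling_refine (flatten (nseq m (enum 'I_n))) (tiling1 w0
  wD).
by congr tiling; apply/funext => i; rewrite count_mem_grid.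
Qed.

Lemma grid_add m k D : grid (m + k) D = refine (flatten (nseq k (enum 'I_n)))
  (grid m D).
Proof. by rewrite /grid nseqD flatten_cat /refine foldl_cat. Qed.

(** The halves of a box inside [O] are inside [O], so the part of [O] filled by cells grows under
    refinement. This monotonicity is what continuity from below of the measure requires. *)
Lemma cells_halve D w s i O : tiling D w s ->
  cells [set p | box p `<=` O] s `<=` cells [set p | box p `<=` O] (halve i s).
Proof.
move=> Ds x [p [/= ps pO] px].
have wp := tiling_widths Ds ps.
have := box_lower_half i (tiling_w0 Ds) wp.
have := box_upper_half i (tiling_w0 Ds) wp.
have [xm|xm] := pselect (x 0 i <= mid p i) => pu pl.
  exists (lower_half i p); last by rewrite pl.
  by split => /=; [apply/mem_halve; exists p; auto|rewrite pl => y [/pO]].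
exists (upper_half i p); last by rewrite pu.
by split => /=; [apply/mem_halve; exists p; auto|rewrite pu => y [/pO]].
Qed.

Lemma cells_refine D w s d O : tiling D w s ->
  cells [set p | box p `<=` O] s `<=` cells [set p | box p `<=` O] (refine d s).
Proof.
elim: d s w => [|i d IH] s w Ds //=.
exact: subset_trans (cells_halve i Ds) (IH _ _ (tiling_halve i Ds)).
Qed.

Lemma cells_grid D w O m m' : (forall i, 0 < w i) -> widths w D -> (m <= m')%N ->
  cells [set p | box p `<=` O] (grid m D) `<=`
  cells [set p | box p `<=` O] (grid m' D).
Proof.
move=> w0 wD /subnKC <-; rewrite grid_add.
exact: cells_refine (tiling_grid _ w0 wD).
Qed.

Lemma bigcup_cells D w O : (forall i, 0 < w i) -> widths w D -> open O ->
  \bigcup_m cells [set p | box p `<=` O] (grid m D) = O `&` box D.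
Proof.
move=> w0 wD oO; apply/seteqP; split => [x [m _ [p [/= ps pO] px]]|x [Ox Dx]].
  split; first exact: pO.
  exact: tiling_sub (tiling_grid m w0 wD) ps _ px.
have [M /(_ _ (leqnn M)) HM] := box_subset_open w0 wD oO Ox.
have [p ps px] := tiling_mem (tiling_grid M w0 wD) Dx.
exists M => //; exists p => //; split => //=.
by apply: HM => //; exact: tiling_widths (tiling_grid M w0 wD) _ ps.
Qed.

Lemma widths_cube r : widths (fun=> 2 * r) (cube r).
Proof. by move=> i; rewrite !mxE; lra. Qed.

(** A countable union of dyadic boxes: this gives measurability of open sets, and later lets a set
    of positive measure be located in a single cell. *)
Lemma open_bigcup_cells O : open O ->
  O = \bigcup_j \bigcup_m cells [set p | box p `<=` O] (grid m (cube j.+1%:R)).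
Proof.
move=> oO; rewrite -[LHS]setIT -bigcup_cube setI_bigcupr.
apply: eq_bigcup => // j _; rewrite (@bigcup_cells _ (fun=> 2 * j.+1%:R))//.
exact: widths_cube.
Qed.

Lemma measurable_open O : open O -> lebesgue_measurable O.
Proof.
move=> /open_bigcup_cells ->.
apply: (@bigcup_measurable _ T) => j _.
apply: (@bigcup_measurable _ T) => m _.
exact: measurable_cells.
Qed.

Lemma measurable_closed (C : set 'rV[R]_n) : closed C -> lebesgue_measurable C.
Proof.
move=> cC; rewrite -[C]setCK; apply: (@measurableC _ T).
by apply: measurable_open; rewrite openC.
Qed.

Lemma continuous_lebesgue_measurable (f : 'rV[R]_n -> R) :
  continuous f -> measurable_fun [set: T] (f : T -> R).
Proof.
move=> cf; apply: (measurability _ (RGenOpens.measurableE R)).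
move=> _ [_ [a [b ->] <-]]; rewrite setTI.
apply: measurable_open; move/continuousP: cf; apply.
exact: interval_open.
Qed.

Definition open_box p : set 'rV[R]_n := [set x | forall i, p.1 0 i < x 0 i <
  p.2 0 i].

Lemma open_open_box p : open (open_box p).
Proof.
have -> : open_box p = ~` (\bigcup_(i in [set: 'I_n])
   ([set x : 'rV[R]_n | x 0 i <= p.1 0 i] `|` [set x : 'rV[R]_n | p.2 0 i <= x
     0 i])).
  apply/seteqP; split => x /=.
    by move=> xp [i _ []] /=; have := xp i; lra.
  move=> H i; apply: contrapT => /negP; rewrite negb_and -!leNgt => /orP[] ?;
    apply: H; exists i => //; [left|right]; done.
rewrite openC; apply: closed_bigcup; first exact: finite_setT || exact:
  finite_finset.
move=> i _; apply: closedU.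
  apply: (@closed_comp _ _ (fun x : 'rV[R]_n => x 0 i) [set y | y <= p.1 0 i]).
    by move=> x _; exact: coord_continuous.
  exact: closed_le.
apply: (@closed_comp _ _ (fun x : 'rV[R]_n => x 0 i) [set y | p.2 0 i <= y]).
  by move=> x _; exact: coord_continuous.
exact: closed_ge.
Qed.

Lemma negligible_faces p : mu (box p `\` open_box p) = 0%E.
Proof.
apply/le_anti; rewrite measure_ge0 andbT.
apply: (@le_trans _ _ (mu (\bigcup_(i in [set: 'I_n]) [set x : 'rV[R]_n | x 0 i
  = p.2 0 i]))).
  (* Only the upper faces matter: the half-open box already omits the lower ones. *)
  apply: (@le_lebesgue_outer R n) => x [px /existsNP[i npx]]; exists i => //=.
  by have := px i; move/negP: npx; lra.
apply: le_trans (lebesgue_outer_bigcup_esum _ (finite_set_countable _)) _;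
  first exact: finite_finset.
rewrite esum1// => i _; exact: lebesgue_hyperplane0.
Qed.
End tilings.

(** * Total boundedness *)

Section approximation.
Context {R : realType} {n : nat}.
Implicit Types (p q D : 'rV[R]_n * 'rV[R]_n) (A B E O : set 'rV[R]_n) (i : 'I_n).
Implicit Types (s : seq ('rV[R]_n * 'rV[R]_n)) (w : 'I_n -> R).
Local Notation mu := (@lebesgue_n R n).
Local Notation T := (lebesgueType R n).

Definition symdiff A B := (A `\` B) `|` (B `\` A).

Lemma symdiffC A B : symdiff A B = symdiff B A.
Proof. exact: setUC. Qed.

Lemma measurable_symdiff A B : lebesgue_measurable A -> lebesgue_measurable B ->
  lebesgue_measurable (symdiff A B).
Proof.
move=> mA mB; apply: (@measurableU _ T); exact: (@measurableD _ T).
Qed.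

Lemma symdiff_triangle B A C :
  (mu (symdiff A C) <= mu (symdiff A B) + mu (symdiff B C))%E.
Proof.
apply: le_trans (outer_measureU2 (lebesgue_outer_measure R n) _ _).
apply: (@le_lebesgue_outer R n) => x [[Ax Cx]|[Cx Ax]].
  by have [Bx|Bx] := pselect (B x); [right; left|left; left].
by have [Bx|Bx] := pselect (B x); [left; right|right; right].
Qed.

(** Take a cover of [E] by half-open boxes of total volume below [mu E + e]. Its union [U] exceeds
    [E] by at most [e], and replacing the boxes by their interiors loses only faces, which are
    null. *)
Lemma open_approximation D E (e : R) : E `<=` box D -> lebesgue_measurable E ->
  0 < e -> exists2 O, open O & (mu (symdiff E (O `&` box D)) <= e%:E)%E.
Proof.
move=> ED mE e0.
have Efin : mu E \is a fin_num by rewrite ge0_fin_numE ?(measure_bounded_lty ED).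
have [_ [B [cB EB] <-] ltB] := lb_ereal_inf_adherent e0 Efin.
pose U := \bigcup_(p in B) box p.
have mU : lebesgue_measurable U.
  rewrite /U bigcup_set_type; apply: (@countable_bigcupT_measurable _ T).
    by rewrite (eq_countable (card_setT B)).
  by move=> p; exact: measurable_box.
have muU : (mu U <= mu E + e%:E)%E.
  apply: le_trans (ltW ltB); apply: le_trans (lebesgue_outer_bigcup_esum _ cB) _.
  by apply: le_esum => p _; exact: lebesgue_outer_box.
exists (\bigcup_(p in B) open_box p); first by apply: bigcup_open => p _;
  exact: open_open_box.
set O := \bigcup_(p in B) open_box p.
have OU : O `<=` U by move=> x [p Bp xp]; exists p => // i; have := xp i; lra.
apply: (@le_trans _ _ (mu (U `\` O) + mu (U `\` E))%E).
  apply: le_trans (outer_measureU2 (lebesgue_outer_measure R n) _ _).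
  apply: (@le_lebesgue_outer R n) => x [[Ex Ox]|[[Ox Dx] Ex]].
    by left; split; [exact: EB|move=> Ox'; apply: Ox; split => //; exact: ED].
  by right; split => //; exact: OU.
have -> : mu (U `\` O) = 0%E.
  apply/le_anti; rewrite measure_ge0 andbT.
  apply: (@le_trans _ _ (mu (\bigcup_(p in B) (box p `\` open_box p)))).
    apply: (@le_lebesgue_outer R n) => x [[p Bp xp] Ox]; exists p => //;
      split => // xp'.
    by apply: Ox; exists p.
  apply: le_trans (lebesgue_outer_bigcup_esum _ cB) _.
  by rewrite esum1// => p _; exact: negligible_faces.
rewrite add0e (measureD mU mE) ?(le_lt_trans muU) //; last first.
  by rewrite lte_add_pinfty ?ltry// -ge0_fin_numE.
rewrite (setIidr EB) leeBlDl//.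
Qed.

(** Half of [e] pays for an open set close to [E], half for the cells of one fine grid inside that
    open set; [m0] lets the caller demand a fine grid. *)
Lemma cells_approximation D w E (e : R) m0 : (forall i, 0 < w i) -> widths w D ->
  E `<=` box D -> lebesgue_measurable E -> 0 < e ->
  exists2 m, (m0 <= m)%N & exists P : pred _,
  (mu (symdiff E (cells [set` P] (grid m D))) <= e%:E)%E.
Proof.
move=> w0 wD ED mE e0.
have [V oV VE] := open_approximation ED mE (divr_gt0 e0 (ltr0Sn _ 1)).
pose F m := cells [set p | box p `<=` V] (grid m D).
have FO : \bigcup_m F m = V `&` box D by exact: bigcup_cells w0 wD oV.
have ODD : V `&` box D `<=` box D by move=> x [].
have mOD : lebesgue_measurable (V `&` box D).
  by apply: (@measurableI _ T); [exact: measurable_open|exact: measurable_box].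
have : mu \o F @ \oo --> mu (V `&` box D).
  rewrite -FO; apply: nondecreasing_cvg_mu.
  - by move=> m; exact: measurable_cells.
  - by rewrite FO.
  - by move=> k l kl; apply/subsetPset; exact: (cells_grid w0 wD kl).
have ODfin : mu (V `&` box D) \is a fin_num by rewrite ge0_fin_numE
  ?(measure_bounded_lty ODD).
move=> cF; have : \forall m \near \oo, (mu (V `&` box D) - (e / 2)%:E < mu (F
  m))%E.
  apply: (cF [set x | (_ < x)%E]); apply: open_nbhs_nbhs; split;
    first exact: open_ereal_gt_ereal.
  by rewrite /mkset lteBlDr// lteDl// lte_fin divr_gt0.
case=> m1 _ /(_ (m0 + m1)%N (leq_addl _ _)) /= Hm; set m := (m0 + m1)%N in Hm.
exists m; first exact: leq_addr.
exists (fun p => `[< box p `<=` V >]).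
have -> : [set` (fun p => `[< box p `<=` V >])] = [set p | box p `<=` V].
  by apply/seteqP; split => p /asboolP.
apply: le_trans (symdiff_triangle (V `&` box D) _ _) _.
rewrite [in leRHS](splitr e) EFinD leeD// symdiffC.
have FOD : F m `<=` V `&` box D by rewrite -FO; exact: bigcup_sup.
have -> : symdiff (cells [set p | box p `<=` V] (grid m D)) (V `&` box D) = (V
  `&` box D) `\` F m.
  by rewrite /symdiff -/(F m) (_ : F m `\` _ = set0) ?set0U//; apply/seteqP;
    split => // x [/FOD].
rewrite (measureD mOD (measurable_cells _ _)) ?(measure_bounded_lty ODD)//.
rewrite (setIidr FOD) leeBlDl//; last first.
  by rewrite ge0_fin_numE ?(measure_bounded_lty (subset_trans FOD ODD)).
by rewrite -leeBlDr// ltW.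
Qed.

Lemma volume_symdiff_cells D w s (P : pred _) E : tiling D w s -> E `<=` box D ->
  lebesgue_measurable E ->
  volume (symdiff E (cells [set` P] s)) =
  \sum_(p <- s) if P p then volume (box p `\` E) else volume (E `&` box p).
Proof.
move=> Ds ED mE.
have cD : cells [set` P] s `<=` box D.
  by move=> x [p [ps _]]; exact: tiling_sub Ds ps _.
have SD : symdiff E (cells [set` P] s) `<=` box D by move=> x [[/ED]|[/cD]].
rewrite -{1}(setIidl SD) -(volume_tiling Ds);
  last exact/measurable_symdiff/measurable_cells.
rewrite big_seq [RHS]big_seq; apply: eq_bigr => p ps; case: ifPn => Pp;
  congr volume.
  apply/seteqP; split => [x [[[Ex cx]|[cx Ex]] px]|x [px Ex]]; last 1 first.
  - by split => //; right; split => //; exists p.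
  - by exfalso; apply: cx; exists p.
  - by [].
apply/seteqP; split => [x [[[Ex cx]|[[q [/= qs Pq] qx] Ex]] px]|x [Ex px]] => //.
  by move: Pp; rewrite (tiling_inj Ds ps qs px qx) => /negP.
split => //; left; split => // -[q [/= qs Pq] qx].
by move: Pp; rewrite (tiling_inj Ds ps qs px qx) => /negP.
Qed.

(* For the cell averages a of the indicator of E, this is the sum of
   a (1 - a) |p|: half the L^1 distance from the indicator to its conditional
   expectation on the tiling. *)
Definition mixing E s : R := \sum_(p <- s)
  volume (E `&` box p) * volume (box p `\` E) / volume (box p).

Lemma volume_box_split E p : lebesgue_measurable E ->
  volume (box p) = volume (E `&` box p) + volume (box p `\` E).
Proof.
by move=> mE; rewrite setIC -(@volume_setIDC _ _ p)//; exact: measurable_box.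
Qed.

(** Boxwise, [a * b / (a + b)] is at most [a] and at most [b], whichever of the two the choice [P]
    pays. *)
Lemma mixing_le D w s (P : pred _) E : tiling D w s -> E `<=` box D ->
  lebesgue_measurable E -> mixing E s <= volume (symdiff E (cells [set` P] s)).
Proof.
move=> Ds ED mE; rewrite (volume_symdiff_cells _ Ds)//; apply: ler_sum => p _.
have := volume_box_split p mE.
have := volume_ge0 (E `&` box p); have := volume_ge0 (box p `\` E).
set a := volume (E `&` _); set b := volume (_ `\` _) => b0 a0 ->.
(* A box of measure zero: the quotient is 0 because [0^-1 = 0]. *)
have [ab0|ab0] := eqVneq (a + b) 0.
  by rewrite ab0 invr0 mulr0; case: ifP.
have abp : 0 < a + b by rewrite lt_def ab0 addr_ge0.
by case: ifP => _; rewrite ler_pdivrMr//; nra.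
Qed.

(** The majority choice pays the smaller of [a] and [b]; as the larger is at least [(a + b) / 2],
    this is at most [2 * (a * b / (a + b))]. With [mixing_le], [mixing] is the distance to the
    unions of cells up to a factor 2. *)
Lemma majority_le D w s E : tiling D w s -> E `<=` box D ->
  lebesgue_measurable E -> volume (symdiff E (cells [set` (fun p =>
    volume (box p `\` E) <= volume (E `&` box p))] s)) <= 2 * mixing E s.
Proof.
move=> Ds ED mE; rewrite (volume_symdiff_cells _ Ds)// mulr_sumr;
  apply: ler_sum => p _.
have := volume_box_split p mE.
have := volume_ge0 (E `&` box p); have := volume_ge0 (box p `\` E).
set a := volume (E `&` _); set b := volume (_ `\` _) => b0 a0 ->.
have [ab0|ab0] := eqVneq (a + b) 0.
  by rewrite ab0 invr0 !mulr0; case: ifP => _; lra.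
have abp : 0 < a + b by rewrite lt_def ab0 addr_ge0.
by case: ifPn => [|/negP]; [|move/negP; rewrite -ltNge];
  rewrite mulrA ler_pdivlMr//; nra.
Qed.

(** Here [a], [c] are the volumes inside E, and [b], [d] those outside, in two halves of equal
    volume. When that volume is positive, the left side exceeds the first two terms by exactly the
    variance between the halves, [(a - c) ^+ 2 / (2 * (a + b))], and [|a - c| <= a + b]. *)
Let mixing_split (a b c d : R) : 0 <= a -> 0 <= b -> 0 <= c -> 0 <= d ->
  a + b = c + d -> (a + c) * (b + d) / (a + c + (b + d)) <=
  a * b / (a + b) + c * d / (c + d) + 2^-1 * `|a - c|.
Proof.
move=> a0 b0 c0 d0 abcd.
have [ab0|ab0] := eqVneq (a + b) 0.
  have [-> -> -> ->] : [/\ a = 0, b = 0, c = 0 & d = 0] by split; lra.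
  by rewrite !(addr0, mul0r, subr0, normr0, mulr0).
have abp : 0 < a + b by rewrite lt_def ab0 addr_ge0.
rewrite -abcd -mulrDl (_ : a + c + (b + d) = 2 * (a + b)); last by lra.
rewrite ler_pdivrMr ?mulr_gt0//.
have -> : ((a * b + c * d) / (a + b) + 2^-1 * `|a - c|) * (2 * (a + b)) =
  2 * (a * b + c * d) + `|a - c| * (a + b) by field.
have : `|a - c| * `|a - c| <= `|a - c| * (a + b).
  by rewrite ler_wpM2l// ler_norml; lra.
rewrite -normrM ger0_norm -?expr2 ?sqr_ge0//.
have -> : d = a + b - c by lra.
set h := `|a - c|; nra.
Qed.

Lemma mixing_halve D w s E i : tiling D w s -> lebesgue_measurable E ->
  mixing E s <= mixing E (halve i s) + 2^-1 *
   \sum_(p <- s) `|volume (E `&` box (lower_half i p)) - volume (E `&` box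
     (upper_half i p))|.
Proof.
move=> Ds mE; rewrite /mixing big_halve mulr_sumr -big_split/= big_seq
  [leRHS]big_seq.
apply: ler_sum => p ps.
have wp := tiling_widths Ds ps; have w0 := tiling_w0 Ds.
have mH := measurable_halfspace i (mid p i).
have eq1 : volume (E `&` box p) = volume (E `&` box (lower_half i p)) + volume
  (E `&` box (upper_half i p)).
  rewrite (box_lower_half i w0 wp) (box_upper_half i w0 wp) !setIA
    -[RHS](@volume_setIDC _ _ p)//.
    by apply: (@measurableI _ T) => //; exact: measurable_box.
have eq2 : volume (box p `\` E) = volume (box (lower_half i p) `\` E) + volume
  (box (upper_half i p) `\` E).
  rewrite (box_lower_half i w0 wp) (box_upper_half i w0 wp) !setDE.
  rewrite -!(setIAC _ (~` E)) -[RHS](@volume_setIDC _ _ p)//.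
  by apply: (@measurableD _ T) => //; exact: measurable_box.
have eq3 : volume (box (lower_half i p)) = volume (box (upper_half i p)).
  congr fine; exact: (eq_widths_measure (widths_lower_half i wp)
    (widths_upper_half i wp)).
have := volume_box_split p mE.
move: eq3; rewrite (volume_box_split (lower_half i p) mE) (volume_box_split
  (upper_half i p) mE).
rewrite eq1 eq2 => + ->.
by move=> ?; apply: mixing_split => //; exact: volume_ge0.
Qed.

(** All that total boundedness uses of a perimeter bound; [perimeter_halving_bound] supplies it with
    [c = L / 2]. *)
Definition halving_bound (c : R) D E := forall w s i, tiling D w s ->
  \sum_(p <- s) `|volume (E `&` box (lower_half i p)) -
                  volume (E `&` box (upper_half i p))| <= w i * c.

Lemma mixing_refine D w s E d (c : R) : 0 <= c -> tiling D w s ->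
  lebesgue_measurable E -> halving_bound c D E ->
  mixing E s <= mixing E (refine d s) + 2^-1 * (\sum_(i <- d) w i) * c.
Proof.
move=> c0 + mE hE; elim: d s w => [|i d IH] s w Ds.
  by rewrite big_nil mulr0 mul0r addr0.
apply: le_trans (mixing_halve i Ds mE) _.
have := IH _ _ (tiling_halve i Ds); have := hE _ _ i Ds.
(* Halving only shrinks widths, so the initial ones bound every later step. *)
have : \sum_(j <- d) half_width w i j <= \sum_(j <- d) w j.
  apply: ler_sum => j _; have := tiling_w0 Ds j.
  by rewrite /half_width; case: ifP => _; lra.
rewrite big_cons /=; set x := \sum_(_ <- d) half_width _ _ _.
move=> xw h1 h2; apply: le_trans (lerD h2 (ler_wpM2l _ h1)) _; first by [].
by rewrite -addrA lerD2l; nra.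
Qed.

(** One round of halvings at scale [w / 2 ^ m] costs [n * c * (w / 2 ^ m) / 2]. The costs form a
    geometric series, hence a bound independent of [k]. *)
Lemma mixing_grid D (w : R) E (c : R) m k : 0 <= c -> 0 < w ->
  widths (fun=> w) D ->
  lebesgue_measurable E -> halving_bound c D E ->
  mixing E (grid m D) <= mixing E (grid (m + k) D) + n%:R * c * (w / 2 ^+ m).
Proof.
move=> c0 w0 wD mE hE; elim: k m => [|k IH] m.
  by rewrite addn0 lerDl !mulr_ge0// ?invr_ge0 ?exprn_ge0// ltW.
have := mixing_refine (enum 'I_n) c0 (tiling_grid m (fun=> w0) wD) mE hE.
rewrite -[refine _ _](_ : grid (m + 1) D = _); last by rewrite grid_add /= cats0.
rewrite addn1 => /le_trans; apply.
have := IH m.+1; rewrite addSnnS => /(lerD) /(_ (lexx _)) /le_trans; apply.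
rewrite -addrA lerD2l big_enum /= sumr_const card_ord -[_ *+ n]mulr_natl exprS
  invfM.
set x := w / 2 ^+ m; rewrite (_ : w * (2^-1 / 2 ^+ m) = x / 2);
  last by rewrite /x; lra.
by rewrite le_eqVlt; apply/orP; left; apply/eqP; field.
Qed.

(** The order of quantifiers is the point: [m] is chosen before [E]. A finer scale [k], depending on
    [E], has mixing at most [e / 4]; returning to scale [m] adds at most [e / 4], and the majority
    cells double the sum. *)
Lemma grid_dense D (w : R) (c e : R) : 0 <= c -> 0 < w -> widths (fun=> w) D ->
  0 < e -> exists m, forall E, E `<=` box D -> lebesgue_measurable E ->
    halving_bound c D E -> exists P : pred _,
    (mu (symdiff E (cells [set` P] (grid m D))) <= e%:E)%E.
Proof.
move=> c0 w0 wD e0.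
have [m Hm] : exists m, n%:R * c * (w / 2 ^+ m) <= e / 4.
  pose m := (Num.truncn (n%:R * c * w / (e / 4))).+1; exists m.
  rewrite mulrA ler_pdivrMr ?exprn_gt0// [leRHS]mulrC -ler_pdivrMr ?divr_gt0//.
  apply/ltW/(lt_trans (truncnS_gt _)); rewrite -/m -natrX ltr_nat;
    exact: ltn_expl.
exists m => E ED mE hE.
exists (fun p => volume (box p `\` E) <= volume (E `&` box p)).
have tm k := tiling_grid k (fun=> w0) wD.
have cD P k : cells P (grid k D) `<=` box D.
  by move=> x [p [ps _]]; exact: (tiling_sub (tm k) ps).
have sD P k : symdiff E (cells P (grid k D)) `<=` box D.
  by move=> x [[/ED]|[/cD]].
rewrite -(volumeE (sD _ _)) lee_fin.
apply: le_trans (majority_le (tm m) ED mE) _.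
have [k mk [P HP]] := cells_approximation m (fun=> w0) wD ED mE (divr_gt0 e0
  (ltr0Sn R 3)).
have := mixing_grid m (k - m) c0 w0 wD mE hE; rewrite subnKC//.
have := mixing_le P (tm k) ED mE.
move: HP; rewrite -(volumeE (sD _ _)) lee_fin; lra.
Qed.

Lemma grid_totally_bounded D (w : R) (c e : R) : 0 <= c -> 0 < w ->
  widths (fun=> w) D -> 0 < e ->
  exists (I : finType) (F : I -> set 'rV[R]_n),
  (forall j, lebesgue_measurable (F j)) /\
  forall E, E `<=` box D -> lebesgue_measurable E -> halving_bound c D E ->
    exists j, (mu (symdiff E (F j)) <= e%:E)%E.
Proof.
move=> c0 w0 wD e0; have [m Hm] := grid_dense c0 w0 wD e0.
pose s := grid m D.
(* Bit vectors along the list of cells enumerate the finitely many unions of cells of this grid. *)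
exists ((size s).-tuple bool : finType), (fun b : (size s).-tuple bool => cells
  setT (mask b s)); split.
  by move=> b; exact: measurable_cells.
move=> E ED mE hE; have [P HP] := Hm E ED mE hE.
exists (map_tuple P (in_tuple s)); move: HP; congr (mu (symdiff _ _) <= _)%E.
rewrite /= -filter_mask; apply: eq_bigcupl; split => p.
  by case=> ps Pp; split => //=; rewrite mem_filter ps andbT.
by case; rewrite /= mem_filter => /andP[].
Qed.
End approximation.

(** * Derivatives and cut-off functions *)

Section ramp.
Context {R : realType}.
Implicit Types (u x y h d k r : R).

(** A quadratic remainder treats the kink of [pos2] at 0 like any other point. *)
Lemma is_derive_quadratic (g : R -> R) u d C :
  (forall h, `|g (h + u) - g u - h * d| <= C * h ^+ 2) -> is_derive u 1 g d.
Proof.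
move=> H.
have C0 : 0 <= C.
  by have := H 1; rewrite expr1n mulr1; apply: le_trans.
have cd : h^-1 *: (g (h *: 1 + u) - g u) @[h --> 0^'] --> d.
  apply/cvgrPdist_le => /= e e0.
  near=> h.
  have h0 : h != 0 by near: h; exact: nbhs_dnbhs_neq.
  rewrite [h *: 1]mulr1 distrC.
  have -> : h^-1 *: (g (h + u) - g u) - d = h^-1 * (g (h + u) - g u - h * d).
    by rewrite mulrBr mulKf.
  rewrite normrM normfV ler_pdivrMl ?normr_gt0//.
  apply: (le_trans (H h)); rewrite -(ger0_norm (sqr_ge0 h)) normrX expr2 mulrCA
    ler_wpM2l//.
  rewrite mulrC -ler_pdivlMl ?normr_gt0//; near: h.
  exists (e / (C + 1)) => /=; first by rewrite divr_gt0// ltr_wpDl.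
  move=> h /=; rewrite sub0r normrN => he h0.
  rewrite mulrC ler_pdivlMr ?normr_gt0//.
  have : `|h| * (C + 1) < e by rewrite -ltr_pdivlMr// ltr_wpDl.
  have := normr_ge0 h; nra.
apply: DeriveDef; first by apply/cvg_ex; exists d.
exact/cvg_lim.
Unshelve. all: by end_near.
Qed.

Definition pos2 u := Num.max u 0 ^+ 2.

Lemma is_derive_pos2 u : is_derive u 1 pos2 (2 * Num.max u 0).
Proof.
apply: (@is_derive_quadratic _ _ _ 1) => h; rewrite /pos2 mul1r.
by rewrite ler_norml; case: (leP u 0) => ?; case: (leP (h + u) 0) => ?;
  apply/andP; split; nra.
Qed.

(* A C^1 step from 0 to 1 on [0, 1], whose second derivative is 4 and then -4. *)
Definition ramp u := 2 * (pos2 u - 2 * pos2 (u - 2^-1) + pos2 (u - 1)).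
Definition dramp u := 4 * (Num.max u 0 - 2 * Num.max (u - 2^-1) 0 + Num.max (u
  - 1) 0).

Lemma is_derive_comp_aff (g : R -> R) a b u d : is_derive (a * u + b) 1 g d ->
  is_derive u 1 (fun x => g (a * x + b)) (a * d).
Proof.
move=> gd; apply: is_derive_eq.
by rewrite addr0 [a%:A]mulr1 mulrC.
Qed.

Lemma is_derive_ramp u : is_derive u 1 ramp (dramp u).
Proof.
have pos2B c : is_derive u 1 (fun x => pos2 (x - c)) (2 * Num.max (u - c) 0).
  have := @is_derive_comp_aff pos2 1 (- c) u _ (is_derive_pos2 _).
  by rewrite !mul1r; under eq_fun do rewrite mul1r.
have := pos2B 0; rewrite subr0; under eq_fun do rewrite subr0.
move=> h0; have h1 := pos2B 2^-1; have h2 := pos2B 1.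
have H1 := @is_deriveZ _ _ _ _ 2 _ _ _ h1.
have H2 := @is_deriveB _ _ _ _ _ _ _ _ _ h0 H1.
have H3 := @is_deriveD _ _ _ _ _ _ _ _ _ H2 h2.
have [dH vH] := @is_deriveZ _ _ _ _ 2 _ _ _ H3.
apply: DeriveDef; first exact: dH.
rewrite [LHS]vH /dramp /GRing.scale /=; lra.
Qed.

Lemma continuous_dramp : continuous dramp.
Proof.
move=> u; rewrite /dramp.
apply: cvgM; first exact: cvg_cst.
have cm (c : R) : Num.max (x - c) 0 @[x --> u] --> Num.max (u - c) 0.
  apply: (@continuous_max _ _ (fun x => x - c) (fun=> 0)); last exact: cvg_cst.
  by apply: cvgB; [exact: cvg_id|exact: cvg_cst].
apply: cvgD; last exact: cm.
apply: cvgB; first by have := cm 0; rewrite subr0; under eq_fun do rewrite subr0.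
by apply: cvgM; [exact: cvg_cst|exact: cm].
Qed.

Lemma ramp_ge0 u : 0 <= ramp u.
Proof.
rewrite /ramp /pos2; case: (leP u 0) => ?; case: (leP (u - 2^-1) 0) => ?;
  case: (leP (u - 1) 0) => ?; nra.
Qed.

Lemma ramp_le1 u : ramp u <= 1.
Proof.
rewrite /ramp /pos2; case: (leP u 0) => ?; case: (leP (u - 2^-1) 0) => ?;
  case: (leP (u - 1) 0) => ?; nra.
Qed.

Lemma ramp_le0 u : u <= 0 -> ramp u = 0.
Proof.
rewrite /ramp /pos2; case: (leP u 0) => ?; case: (leP (u - 2^-1) 0) => ?;
  case: (leP (u - 1) 0) => ?; nra.
Qed.

Lemma ramp_ge1 u : 1 <= u -> ramp u = 1.
Proof.
rewrite /ramp /pos2; case: (leP u 0) => ?; case: (leP (u - 2^-1) 0) => ?;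
  case: (leP (u - 1) 0) => ?; nra.
Qed.

Lemma dramp_ge0 u : 0 <= dramp u.
Proof.
rewrite /dramp; case: (leP u 0) => ?; case: (leP (u - 2^-1) 0) => ?;
  case: (leP (u - 1) 0) => ?; lra.
Qed.

Lemma dramp_le2 u : dramp u <= 2.
Proof.
rewrite /dramp; case: (leP u 0) => ?; case: (leP (u - 2^-1) 0) => ?;
  case: (leP (u - 1) 0) => ?; lra.
Qed.

Lemma dramp_le0 u : u <= 0 -> dramp u = 0.
Proof.
rewrite /dramp; case: (leP u 0) => ?; case: (leP (u - 2^-1) 0) => ?;
  case: (leP (u - 1) 0) => ?; lra.
Qed.

Lemma dramp_ge1 u : 1 <= u -> dramp u = 0.
Proof.
rewrite /dramp; case: (leP u 0) => ?; case: (leP (u - 2^-1) 0) => ?;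
  case: (leP (u - 1) 0) => ?; lra.
Qed.

End ramp.

(** * Directional derivatives as one-variable derivatives along lines *)

Section directional.
Context {R : realType} {V : normedModType R}.
Implicit Types (f : V -> R) (x v : V).

Lemma derive_line f x v : 'D_v f x = 'D_1 (fun h : R => f (h *: v + x)) 0.
Proof.
pose g (h : R) := f (h *: v + x).
have -> : 'D_1 g 0 = lim ((fun h => h^-1 *: (g (h *: (1 : R^o) + 0) - g 0)) @
  (0 : R)^') by [].
have -> : (fun h => h^-1 *: (g (h *: (1 : R^o) + 0) - g 0)) = (fun h => h^-1 *:
  (f (h *: v + x) - f x)).
  by apply/funext => h; rewrite [h *: _]mulr1 addr0 /g scale0r add0r.
by [].
Qed.

Lemma is_derive_lineP f x v d :
  is_derive x v f d <-> is_derive (0 : R) 1 (fun h : R => f (h *: v + x)) d.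
Proof.
split=> -[fd <-].
  by apply: DeriveDef; [exact: (derivable1P f x v).1|rewrite -derive_line].
by apply: DeriveDef; [exact: (derivable1P f x v).2|rewrite derive_line].
Qed.

End directional.

Section directional.
Context {R : realType} {V : normedModType R}.
Implicit Types (f : V -> R) (x v : V).

Lemma is_derive_line f x v (t : R) : derivable f (t *: v + x) v ->
  is_derive t 1 (fun h : R => f (h *: v + x)) ('D_v f (t *: v + x)).
Proof.
move=> fd; apply/(is_derive_lineP (V := R^o)).
have -> : (fun h : R => f ((h *: (1 : R^o) + t) *: v + x)) = (fun h => f (h *:
  v + (t *: v + x))).
  by apply/funext => h; rewrite [h *: (1 : R^o)]mulr1 scalerDl addrA.
exact: (is_derive_lineP f (t *: v + x) v _).1 (DeriveDef fd erefl).
Qed.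

Lemma line_mvt f x v (t : R) : (forall y, derivable f y v) ->
  exists2 c : R, `|c| <= `|t| & f (t *: v + x) - f x = t * 'D_v f (c *: v + x).
Proof.
move=> df.
pose g (h : R) := f (h *: v + x).
have dg (h : R) : is_derive h 1 g ('D_v f (h *: v + x)) by exact: is_derive_line.
have cg : continuous g.
  by move=> z; apply: differentiable_continuous; apply/derivable1_diffP.
have g0 : g 0 = f x by rewrite /g scale0r add0r.
have [t0|t0] := leP 0 t.
  have [] := @MVT_segment _ g (fun h => 'D_v f (h *: v + x)) 0 t t0.
  - exact: continuous_subspaceT.
  move=> c; rewrite in_itv /= => /andP[c0 ct]; rewrite g0 subr0 mulrC => e.
  by exists c => //; rewrite !ger0_norm.
have [] := @MVT_segment _ g (fun h => 'D_v f (h *: v + x)) t 0 (ltW t0).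
- exact: continuous_subspaceT.
move=> c; rewrite in_itv /= => /andP[c0 ct]; rewrite g0 => e.
exists c; first by rewrite !ler0_norm ?lerN2// ltW.
by move: e; rewrite /g; lra.
Qed.

End directional.

(** * Real-valued C^1 functions and their products *)

Section scalar_C1.
Context {R : realType} {n : nat}.
Implicit Types (f : 'rV[R]_n -> R) (phi : 'rV[R]_n -> 'rV[R]_n) (x y : 'rV[R]_n).

Lemma normr_coord_le x (i : 'I_n) : `|x 0 i| <= `|x|.
Proof.
rewrite [leRHS]/Num.Def.normr/= mx_normrE.
exact: (le_bigmax _ (fun ij => `|x ij.1 ij.2|) (0, i)).
Qed.

Definition closed_cube (r : R) : set 'rV[R]_n :=
  [set v | forall i, `[- r, r]%classic (v 0 i)].

Lemma compact_closed_cube r : compact (closed_cube r).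
Proof.
by apply: (@rV_compact _ _ (fun=> `[- r, r]%classic)) => i;
  exact: segment_compact.
Qed.

Lemma closure_sub_closed_cube r (A : set 'rV[R]_n) :
  A `<=` closed_cube r -> closure A `<=` closed_cube r.
Proof.
have := compact_closed (@norm_hausdorff _ _) (@compact_closed_cube r).
by rewrite closure_id => {2}-> /closure_subset.
Qed.

Lemma box_cube_sub_closed_cube r : box (cube r) `<=` closed_cube r.
Proof. by move=> x xr i; have := xr i; rewrite /= !mxE in_itv /=; lra. Qed.

Lemma closed_cube_sub_box_cube r : closed_cube r `<=` box (cube (r + 1)).
Proof. by move=> x xr i; have := xr i; rewrite /= !mxE in_itv /=; lra. Qed.

Definition scalar_C1 f := forall i : 'I_n,
  (forall x, derivable f x (basis_vec i)) /\ continuous ('D_(basis_vec i) f).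

Lemma continuous_row (T : topologicalType) (M : T -> 'rV[R]_n) :
  (forall j, continuous (fun t : T => M t 0 j)) -> continuous M.
Proof.
move=> cM t; apply/cvg_ballP => e e0.
have : \forall y \near t, forall j : 'I_n, ball (M t 0 j) e (M y 0 j).
  apply: filter_forall => j.
  by have /cvg_ballP/(_ e e0) := cM j t.
by apply: filterS => y yt; split => // i j; rewrite (ord1 i).
Qed.

Lemma C1_coord phi : C1 phi -> forall j, scalar_C1 (fun x => phi x 0 j).
Proof.
move=> C1phi j i; have [dphi cphi] := C1phi i.
split; first by move=> x; exact: (derivable_mxP phi x _).1.
have -> : 'D_(basis_vec i) (fun x => phi x 0 j) = (fun x => 'D_(basis_vec i)
  phi x 0 j).
  by apply/funext => x; rewrite derive_mx// mxE.
move=> x.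
exact: (@continuous_comp _ _ _ ('D_(basis_vec i) phi) (fun M : 'rV[R]_n => M 0
  j) x (cphi x) (@coord_continuous _ _ _ _ _ _)).
Qed.

Lemma coord_C1 phi : (forall j, scalar_C1 (fun x => phi x 0 j)) -> C1 phi.
Proof.
move=> C1phi i.
have dphi x : derivable phi x (basis_vec i).
  by apply/derivable_mxP => k j; rewrite (ord1 k); exact: (C1phi j i).1.
split => //; apply: continuous_row => j.
have -> : (fun x => 'D_(basis_vec i) phi x 0 j) = 'D_(basis_vec i) (fun x =>
  phi x 0 j).
  by apply/funext => x; rewrite derive_mx// mxE.
exact: (C1phi j i).2.
Qed.

(** Pass from [x] to [y] one coordinate at a time and apply the mean value theorem on each segment.
    The points used stay in the ball because balls of the sup norm are products of intervals. *)
Lemma row_mvt f x y (C e : R) : scalar_C1 f ->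
  (forall i z, ball x e z -> `|'D_(basis_vec i) f z| <= C) -> ball x e y ->
  `|f y - f x| <= C * \sum_i `|y 0 i - x 0 i|.
Proof.
move=> C1f HC xy.
pose z k : 'rV[R]_n := \row_j if (j < k)%N then y 0 j else x 0 j.
have z0 : z 0%N = x by apply/rowP => j; rewrite mxE.
have zn : z n = y by apply/rowP => j; rewrite mxE ltn_ord.
have zS (i : 'I_n) : z i.+1 = (y 0 i - x 0 i) *: basis_vec i + z i.
  apply/rowP => j; rewrite !mxE eqxx ltnS.
  case: ltngtP => [ji|ij|/val_inj ->].
  - by rewrite -val_eqE /= ltn_eqF// mulr0 add0r.
  - by rewrite -val_eqE /= gtn_eqF// mulr0 add0r.
  - by rewrite eqxx mulr1 subrK.
rewrite -[in X in X - _]zn -[in X in _ - X]z0 -(telescope_sumr (fun k => f (z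
  k)))//.
rewrite big_mkord; apply: le_trans (ler_norm_sum _ _ _) _; rewrite mulr_sumr.
apply: ler_sum => i _; rewrite zS.
have [c ci ->] := line_mvt (z i) (y 0 i - x 0 i) (C1f i).1.
rewrite normrM mulrC ler_wpM2r//; apply: HC.
split; first by case: xy.
move=> k j; rewrite (ord1 k) -ball_normE /= !mxE eqxx.
have /(_ 0 j) := xy.2; rewrite -ball_normE /= => xyj.
case: ltngtP => [ji|ij|/val_inj ij].
- by rewrite -val_eqE /= ltn_eqF// mulr0 add0r.
- by rewrite -val_eqE /= gtn_eqF// mulr0 add0r subrr normr0; case: xy.
- rewrite ij eqxx mulr1 opprD addrCA subrr addr0 normrN.
  by apply: le_lt_trans ci _; rewrite distrC -ij.
Qed.

(** Existence of partial derivatives alone would not give continuity. Their continuity bounds them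
    near [x], and [row_mvt] then gives a local Lipschitz estimate at [x]. *)
Lemma scalar_C1_continuous f : scalar_C1 f -> continuous f.
Proof.
move=> C1f x.
pose C := 1 + \sum_j `|'D_(basis_vec j) f x|.
have C0 : 0 < C by rewrite ltr_wpDr// sumr_ge0.
have [e e0 HC] : exists2 e : R, 0 < e & forall i z, ball x e z ->
  `|'D_(basis_vec i) f z| <= C.
  have : \forall z \near x, forall i : 'I_n, `|'D_(basis_vec i) f z| <= C.
    apply: (@filter_forall _ _ _ _ (nbhs_filter x)) => i.
    have /cvgrPdist_le/(_ 1 ltr01) := (C1f i).2 x.
    apply: (@filterS _ _ (nbhs_filter x)) => z zx.
    rewrite /C (bigD1 i)//= addrA.
    apply: (@le_trans _ _ (1 + `|'D_(basis_vec i) f x|));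
      last by rewrite lerDl sumr_ge0.
    have := ler_normB ('D_(basis_vec i) f x) ('D_(basis_vec i) f x -
      'D_(basis_vec i) f z).
    by rewrite opprB addrC subrK; lra.
  by move=> /nbhs_ballP[e /= e0 He]; exists e => // i z /He.
apply/(@cvgrPdist_le _ _ _ _ (nbhs_filter x)) => /= d d0.
(* [n.+1] rather than [n] keeps the denominator positive in dimension 0. *)
pose r := Num.min e (d / (C * n.+1%:R)).
have r0 : 0 < r by rewrite lt_min e0 divr_gt0// mulr_gt0.
apply/nbhs_ballP; exists r => //= y xy.
have xye : ball x e y by apply: le_ball xy; rewrite ge_min lexx.
rewrite distrC; apply: (le_trans (row_mvt C1f HC xye)).
apply: (@le_trans _ _ (C * \sum_(i < n) r)).
  rewrite ler_pM2l//; apply: ler_sum => i _; apply: ltW.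
  by have /(_ 0 i) := xy.2; rewrite -ball_normE /= distrC.
rewrite sumr_const card_ord -[_ *+ n]mulr_natr mulrCA.
apply: (@le_trans _ _ (d / (C * n.+1%:R) * (C * n%:R))).
  by apply: ler_wpM2r; [rewrite mulr_ge0// ltW|rewrite ge_min lexx orbT].
rewrite -mulrA ler_piMr//; first exact: ltW.
by rewrite ler_pdivrMl ?mulr_gt0// mulr1 ler_pM2l// ler_nat.
Qed.

Lemma scalar_C1_is_derive f df : 
  (forall i x, is_derive x (basis_vec i) f (df i x)) ->
  (forall i, continuous (df i)) -> scalar_C1 f.
Proof.
move=> fdf cdf i; split=> [x|]; first by have [] := fdf i x.
have -> : 'D_(basis_vec i) f = df i by apply/funext => x; have [] := fdf i x.
exact: cdf.
Qed.

Lemma scalar_C1P f i x : scalar_C1 f -> is_derive x (basis_vec i) f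
  ('D_(basis_vec i) f x).
Proof. by move=> C1f; apply: DeriveDef => //; exact: (C1f i).1. Qed.

Lemma scalar_C1_cst (c : R) : scalar_C1 (fun=> c).
Proof.
move=> i; split=> [x|]; first exact: (@derivable_cst _ _ _ c).
have -> : 'D_(basis_vec i) (fun=> c) = (fun=> 0) :> ('rV[R]_n -> R).
  by apply/funext => x; exact: (@derive_cst _ _ _ c).
exact: cst_continuous.
Qed.

Lemma scalar_C1D f g : scalar_C1 f -> scalar_C1 g ->
  scalar_C1 (fun x => f x + g x).
Proof.
move=> C1f C1g; apply: (@scalar_C1_is_derive _ (fun i x => 'D_(basis_vec i) f x
  + 'D_(basis_vec i) g x)) => [i x|i x].
  by apply: is_deriveD; exact: scalar_C1P.
exact: (@continuousD _ _ _ _ _ x ((C1f i).2 x) ((C1g i).2 x)).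
Qed.

Lemma is_derive_scalarM f g i x : scalar_C1 f -> scalar_C1 g ->
  is_derive x (basis_vec i) (fun x => f x * g x)
   (f x * 'D_(basis_vec i) g x + g x * 'D_(basis_vec i) f x).
Proof.
move=> C1f C1g.
exact: (@is_deriveM _ _ _ _ _ _ _ _ (scalar_C1P i x C1f) (scalar_C1P i x C1g)).
Qed.

Lemma scalar_C1M f g : scalar_C1 f -> scalar_C1 g ->
  scalar_C1 (fun x => f x * g x).
Proof.
move=> C1f C1g; apply: (@scalar_C1_is_derive _ (fun i x =>
  f x * 'D_(basis_vec i) g x + g x * 'D_(basis_vec i) f x)) => [i x|i x].
  exact: is_derive_scalarM.
have cf := scalar_C1_continuous C1f; have cg := scalar_C1_continuous C1g.
exact: (@continuousD _ _ _ _ _ x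
  (@continuousM _ _ _ _ x (cf x) ((C1g i).2 x)) (@continuousM _ _ _ _ x (cg x)
    ((C1f i).2 x))).
Qed.

Lemma scalar_C1N f : scalar_C1 f -> scalar_C1 (fun x => - f x).
Proof.
move=> C1f; apply: (@scalar_C1_is_derive _ (fun i x => - 'D_(basis_vec i) f x))
  => i x.
  by apply: is_deriveN; exact: scalar_C1P.
exact: (@continuousN _ _ _ _ x ((C1f i).2 x)).
Qed.

Lemma scalar_C1_sum (I : Type) (s : seq I) (f : I -> 'rV[R]_n -> R) :
  (forall k, scalar_C1 (f k)) -> scalar_C1 (fun x => \sum_(k <- s) f k x).
Proof.
move=> C1f; elim: s => [|k s IH].
  by under eq_fun do rewrite big_nil; exact: scalar_C1_cst.
by under eq_fun do rewrite big_cons; exact: scalar_C1D.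
Qed.

Lemma derive_sum_seq (I : Type) (s : seq I) (f : I -> 'rV[R]_n -> R) i x :
  (forall k, scalar_C1 (f k)) ->
  'D_(basis_vec i) (fun x => \sum_(k <- s) f k x) x = \sum_(k <- s)
    'D_(basis_vec i) (f k) x.
Proof.
move=> C1f; elim: s => [|k s IH].
  by under eq_fun do rewrite big_nil; rewrite big_nil derive_cst.
under eq_fun do rewrite big_cons.
rewrite big_cons -IH; apply: (@deriveD _ _ _ (f k) (fun x => \sum_(k <- s) f k
  x)).
  exact: (C1f k i).1.
exact: (scalar_C1_sum s C1f i).1.
Qed.

(** The cut-offs and cell fields are products of one-variable profiles, so that a partial derivative
    touches a single factor. *)
Definition prodf (g : 'I_n -> R -> R) x := \prod_i g i (x 0 i).
Definition dprodf (g dg : 'I_n -> R -> R) i x :=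
  dg i (x 0 i) * \prod_(j | j != i) g j (x 0 j).

Lemma is_derive_prodf g dg i x : (forall j (u : R), is_derive u 1 (g j) (dg j
  u)) ->
  is_derive x (basis_vec i) (prodf g) (dprodf g dg i x).
Proof.
move=> gdg; apply/is_derive_lineP.
pose K := \prod_(j | j != i) g j (x 0 j).
have -> : (fun h : R => prodf g (h *: basis_vec i + x)) = (fun h => K * g i (1
  * h + x 0 i)).
  apply/funext => h; rewrite /prodf (bigD1 i)//= !mxE !eqxx /= mulr1 mul1r
    mulrC; congr *%R.
  by apply: eq_bigr => j ji; rewrite !mxE (negbTE ji) andbF mulr0 add0r.
have := @is_derive_comp_aff _ (g i) 1 (x 0 i) 0 _ (gdg i _);
  rewrite mul1r mul1r add0r.
move=> /(@is_deriveZ _ _ _ _ K _ _ _).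
by rewrite /dprodf mulrC.
Qed.

Lemma continuous_prod_coord (P : pred 'I_n) (g : 'I_n -> R -> R) :
  (forall j, continuous (g j)) -> continuous (fun x : 'rV[R]_n => \prod_(j | P
    j) g j (x 0 j)).
Proof.
move=> cg x; apply: (cvg_big _ (nbhs_filter x)) => [u|j _];
  first exact: mul_continuous.
exact: (@continuous_comp _ _ _ (fun M : 'rV[R]_n => M 0 j) (g j) x
  (@coord_continuous _ _ _ _ _ _) (cg j _)).
Qed.

Lemma scalar_C1_prodf g dg : (forall j (u : R), is_derive u 1 (g j) (dg j u)) ->
  (forall j, continuous (dg j)) -> scalar_C1 (prodf g).
Proof.
move=> gdg cdg; apply: (@scalar_C1_is_derive _ (dprodf g dg)) => [i x|i x];
  first exact: is_derive_prodf.
have cg j : continuous (g j).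
  move=> u; apply: differentiable_continuous; apply/derivable1_diffP.
  by have [] := gdg j u.
have cd : {for x, continuous (fun M : 'rV[R]_n => dg i (M 0 i))}.
  exact: (@continuous_comp _ _ _ (fun M : 'rV[R]_n => M 0 i) (dg i) x
    (@coord_continuous _ _ _ _ _ _) (cdg i _)).
exact: (@continuousM _ _ _ _ x cd (@continuous_prod_coord (fun j => j != i) g
  cg x)).
Qed.

End scalar_C1.

(** * Integration by parts *)

Section integration.
Context {R : realType} {n : nat}.
Implicit Types (p q D : 'rV[R]_n * 'rV[R]_n) (A B E : set 'rV[R]_n).
Implicit Types (f g : 'rV[R]_n -> R) (x y h : 'rV[R]_n).
Local Notation mu := (@lebesgue_n R n).
Local Notation T := (lebesgueType R n).

(** One condition serving twice: with measurability it gives integrability, and it provides the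
    majorant for dominated convergence. *)
Definition dominated (M : R) D g := forall x, `|g x| <= M * \1_(box D) x.

Lemma integrable_indic_box D E : lebesgue_measurable E ->
  mu.-integrable E (fun x : T => (\1_(box D) x)%:E).
Proof.
move=> mE; apply/integrableP; split.
  apply/measurable_EFinP; apply: measurable_funTS.
  exact: (measurable_indic (measurable_box D)).
have -> : (\int[mu]_(x in E) `|(\1_(box D) x)%:E| = \int[mu]_(x in E) (\1_(box
  D) x)%:E)%E.
  by apply: eq_integral => x _; rewrite gee0_abs // lee_fin indicE.
rewrite [ltLHS](_ : _ = mu (box D `&` E));
  last exact: (integral_indic _ (mE : measurable (E : set T)) (measurable_box D)).
by apply: (@measure_bounded_lty _ _ D) => x [].
Qed.

Lemma integrable_dominated M D g E : lebesgue_measurable E ->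
  measurable_fun [set: T] (g : T -> R) -> dominated M D g ->
  mu.-integrable E (EFin \o g : T -> \bar R).
Proof.
move=> mE mg gMD.
apply: (@le_integrable _ _ _ mu E mE _ (fun x => (M%:E * (\1_(box D) x)%:E)%E)).
- exact/measurable_EFinP/measurable_funTS.
- move=> x _; rewrite -EFinM !abse_EFin lee_fin; apply: (le_trans (gMD x)).
  exact: ler_norm.
- exact: (integrableZl mE M (integrable_indic_box D mE)).
Qed.

Lemma measurable_null A : mu A = 0%E -> lebesgue_measurable A.
Proof.
move=> A0; apply: le_caratheodory_measurable => X.
have -> : lebesgue_outer_measure R n (X `&` A) = 0%E.
  by apply/le_anti; rewrite lebesgue_outer_ge0 andbT -A0;
    apply: le_lebesgue_outer => x [].
by rewrite add0e; apply: le_lebesgue_outer => x [].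
Qed.

Lemma dominated_cvg M D (g_ : nat -> 'rV[R]_n -> R) g N E :
  lebesgue_measurable E ->
  (forall k, measurable_fun [set: T] (g_ k : T -> R)) ->
  measurable_fun [set: T] (g : T -> R) ->
  (forall k, dominated M D (g_ k)) ->
  mu N = 0%E -> (forall x, ~ N x -> g_ k x @[k --> \oo] --> g x) ->
  (\int[mu]_(x in E) (g_ k x)%:E)%E @[k --> \oo] -->
    (\int[mu]_(x in E) (g x)%:E)%E.
Proof.
move=> mE mg_ mg gMD N0 cg.
have [] := @dominated_convergence _ T R mu E mE (fun k x => (g_ k x)%:E)
  (fun x => (g x)%:E) (fun x => (M * \1_(box D) x)%:E).
- by move=> k; exact/measurable_EFinP/measurable_funTS.
- exact/measurable_EFinP/measurable_funTS.
- exists N; split => //; first exact: measurable_null.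
  move=> x /= /not_implyP[_]; apply: contra_notP => Nx.
  by apply: cvg_EFin; [exact: nearW|exact: cg].
- under eq_fun do rewrite EFinM.
  exact: (integrableZl mE M (integrable_indic_box D mE)).
- by apply: (@nearW _ _ _ (ae_filter_ringOfSetsType mu)) => x k _;
  rewrite abse_EFin lee_fin; exact: gMD.
- by move=> _ _.
Qed.

Lemma dominated_shift M D g h : dominated M D g ->
  dominated M (D.1 - h, D.2 - h) (fun x => g (x + h)).
Proof.
move=> gMD x; apply: le_trans (gMD _) _; rewrite le_eqVlt; apply/orP; left;
  apply/eqP.
congr (_ * _); rewrite !indicE; congr ((_ : bool)%:R).
by apply/idP/idP; rewrite !inE => H j; have := H j;
  rewrite /= !mxE ltrBlDr lerBrDr.
Qed.

Lemma integral_shift M D g h : measurable_fun [set: T] (g : T -> R) ->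
  dominated M D g ->
  (\int[mu]_x (g (x + h)%R)%:E = \int[mu]_x (g x)%:E)%E.
Proof.
move=> mg gMD.
have mh : measurable_fun [set: T] (fun x : T => (x + h : T)).
  by move=> _ B mB; rewrite setTI; exact: measurable_shift.
have := @integral_pushforward _ _ T T R _ mh mu setT (EFin \o g) _ _ measurableT.
rewrite preimage_setT => <-.
- apply: eq_measure_integral => A mA _.
  exact: lebesgue_n_shift.
- exact/measurable_EFinP.
- apply: (integrable_dominated _ _ (dominated_shift h gMD));
  first exact: measurableT.
  exact: (measurableT_comp mg mh).
Qed.

Lemma continuous_bounded_supp f r : 0 < r -> continuous f ->
  (forall x, ~ box (cube r) x -> f x = 0) ->
  exists M, dominated M (cube r) f.
Proof.
move=> r0 cf f0.
have [M [Mreal HM]] : bounded_set (f @` closed_cube r).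
  apply: compact_bounded; apply: continuous_compact;
    first exact: continuous_subspaceT.
  exact: compact_closed_cube.
exists (M + 1) => x; rewrite indicE.
have [xr|xr] := pselect (box (cube r) x).
  rewrite mem_set// mulr1; apply: HM; first by rewrite ltrDl.
  by exists x => //; exact: box_cube_sub_closed_cube.
by rewrite memNset// f0// normr0 mulr0.
Qed.

Lemma scalar_C1_derive_supp f r i : scalar_C1 f ->
  (forall x, ~ box (cube r) x -> f x = 0) ->
  forall x, ~ box (cube (r + 1)) x -> 'D_(basis_vec i) f x = 0.
Proof.
move=> C1f f0 x xr.
(* The enlargement by 1 makes the unit ball around [x] miss the support cube. *)
have : \forall y \near x, f y = cst 0 y.
  apply/nbhs_ballP; exists 1 => //= y [_ xy]; apply: f0 => yr; apply: xr => j.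
  have := yr j; have := xy 0 j; rewrite -ball_normE /= !mxE ltr_norml; lra.
by move/(near_eq_derive (basis_vec i)) => ->; rewrite derive_cst.
Qed.

Lemma row_mvt_dir f i x t M : scalar_C1 f -> 
  (forall y, `|'D_(basis_vec i) f y| <= M) ->
  `|f (t *: basis_vec i + x) - f x| <= `|t| * M.
Proof.
move=> C1f HM; have [c _ ->] := line_mvt x t (C1f i).1.
by rewrite normrM ler_wpM2l.
Qed.

(** Difference quotients in direction [i] have integral 0 by translation invariance. The mean value
    theorem bounds them by the supremum of the derivative, so the limit passes under the
    integral. *)
Lemma integral_partial0 f r i : 0 < r -> scalar_C1 f ->
  (forall x, ~ box (cube r) x -> f x = 0) ->
  (\int[mu]_x ('D_(basis_vec i) f x)%:E = 0)%E.
Proof.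
move=> r0 C1f f0.
have r10 : 0 < r + 1 by rewrite addr_gt0.
have [M HM] := continuous_bounded_supp r10 (C1f i).2 (scalar_C1_derive_supp i
  C1f f0).
have [M' HM'] := continuous_bounded_supp r0 (scalar_C1_continuous C1f) f0.
have M0 x : `|'D_(basis_vec i) f x| <= M.
  apply: (le_trans (HM x)); rewrite indicE; case: (_ \in _);
    rewrite ?mulr1 ?mulr0//.
  by have := HM 0; rewrite indicE mem_set ?mulr1 => [/(le_trans _)->//|j];
    rewrite !mxE; lra.
(* Steps at most 1 keep the supports of all quotients in the cube of radius [r + 1]. *)
pose h (k : nat) : R := k.+1%:R^-1.
pose g_ k x := (h k)^-1 * (f (h k *: basis_vec i + x) - f x).
have h0 k : 0 < h k by rewrite invr_gt0.
have mf : measurable_fun [set: T] (f : T -> R).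
  exact: continuous_lebesgue_measurable (scalar_C1_continuous C1f).
have mfh k : measurable_fun [set: T] ((fun x => f (h k *: basis_vec i + x)) : T
  -> R).
  have mh : measurable_fun [set: T] (fun x : T => (h k *: basis_vec i + x : T)).
    move=> _ B mB; rewrite setTI; have := measurable_shift (h k *: basis_vec i)
      mB.
    by congr lebesgue_measurable; apply/seteqP; split => x /=; rewrite addrC.
  exact: (measurableT_comp mf mh).
have mg_ k : measurable_fun [set: T] (g_ k : T -> R).
  exact: (measurable_funM (measurable_cst (h k)^-1) (measurable_funB (mfh k) mf)).
have gM k : dominated M (cube (r + 1)) (g_ k).
  move=> x; rewrite indicE; have [xr|xr] := pselect (box (cube (r + 1)) x).
    rewrite mem_set// mulr1 /g_ normrM normfV (gtr0_norm (h0 k)) ler_pdivrMl//.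
    by apply: le_trans (row_mvt_dir _ _ C1f M0) _; rewrite gtr0_norm.
  rewrite memNset// mulr0 /g_ !f0 ?subrr ?mulr0 ?normr0// => xr'; apply: xr => j.
    by have := xr' j; rewrite !mxE; lra.
  have hk1 : h k <= 1 by rewrite invf_le1 ?ler1n.
  have := xr' j; rewrite !mxE eqxx /=; have := h0 k; case: (j == i) => /=; lra.
have := @dominated_cvg M (cube (r + 1)) g_ ('D_(basis_vec i) f) set0 setT
  measurableT mg_
  (continuous_lebesgue_measurable (C1f i).2) gM (measure0 _).
have -> : (fun k => \int[mu]_x (g_ k x)%:E)%E = cst 0%E.
  apply/funext => k; rewrite /g_.
  have gMh : dominated M' ((cube r).1 - h k *: basis_vec i, (cube r).2 - h k *:
    basis_vec i) (fun x => f (h k *: basis_vec i + x)).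
    by move=> x; have := dominated_shift (h k *: basis_vec i) HM' x;
      rewrite addrC.
  have i1 := integrable_dominated measurableT (mfh k) gMh.
  have i2 := integrable_dominated measurableT mf HM'.
  under eq_integral do rewrite EFinM.
  rewrite integralZl; [|exact: measurableT|exact: (integrableB _ i1 i2)].
  rewrite integralB_EFin; [|exact: measurableT|exact: i1|exact: i2].
  have -> : (\int[mu]_x (f (h k *: basis_vec i + x)%R)%:E = \int[mu]_x (f (x +
    h k *: basis_vec i)%R)%:E)%E.
    by apply: eq_integral => x _; rewrite addrC.
  rewrite (integral_shift _ mf HM') subee ?mule0//.
  by apply: integrable_fin_num i2.
move=> /(_ _)/cvg_lim => <-//; first by rewrite lim_cst.
move=> x _.
have := (C1f i).1 x => /cvg_ex[l Hl].
have -> : 'D_(basis_vec i) f x = l by exact: cvg_lim.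
move/cvgr_dnbhsP : Hl => /(_ h); apply; split.
  by move=> k; rewrite gt_eqF.
exact: cvg_harmonic.
Qed.

End integration.

(** * Perimeter *)

Section perimeter_theory.
Context {R : realType} {n : nat}.
Implicit Types (D : 'rV[R]_n * 'rV[R]_n) (A B E F : set 'rV[R]_n).
Implicit Types (f g : 'rV[R]_n -> R) (x : 'rV[R]_n) (phi : 'rV[R]_n -> 'rV[R]_n).
Local Notation mu := (@lebesgue_n R n).
Local Notation T := (lebesgueType R n).

Lemma compact_support_cube phi : compactly_supported phi ->
  exists2 r : R, 0 < r & forall x, ~ box (cube r) x -> phi x = 0.
Proof.
move=> /compact_bounded [M [_ HM]].
pose r := Num.max M 0 + 1.
have Mr : M < r by rewrite ltr_pwDr// le_max lexx.
have r0 : 0 < r by rewrite ltr_wpDl// le_max lexx orbT.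
exists (r + 1); first by rewrite addr_gt0.
move=> x xr; apply: contrapT => /eqP phix; apply: xr.
apply: closed_cube_sub_box_cube => i; rewrite /= in_itv /= -ler_norml.
apply: le_trans (normr_coord_le x i) _; apply: (HM r Mr).
exact: (@subset_closure _ [set y | phi y != 0]).
Qed.

Lemma cube_compactly_supported phi r :
  (forall x, ~ box (cube r) x -> phi x = 0) -> compactly_supported phi.
Proof.
move=> phi0.
apply: (subclosed_compact (@closed_closure _ _) (@compact_closed_cube _ _ r)).
apply: closure_sub_closed_cube => x phix; apply: box_cube_sub_closed_cube.
by apply: contrapT => xr; move/eqP: phix; apply; exact: phi0.
Qed.

Lemma test_field_divergence phi : test_field phi -> exists r M, [/\ 0 < r,
  (forall x, ~ box (cube r) x -> phi x = 0), continuous (divergence phi) &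
  dominated M (cube r) (divergence phi)].
Proof.
move=> [/C1_coord C1phi /compact_support_cube[r r0 phi0] _].
have r10 : 0 < r + 1 by rewrite addr_gt0.
have phi0' x : ~ box (cube (r + 1)) x -> phi x = 0.
  move=> xr; apply: phi0 => xr'; apply: xr => i; have := xr' i; rewrite !mxE; lra.
have cdiv : continuous (divergence phi).
  move=> x; apply: (cvg_big _ (nbhs_filter x)) => [u|j _];
    first exact: add_continuous.
  exact: (C1phi j j).2.
have [M HM] : exists M, dominated M (cube (r + 1)) (divergence phi).
  apply: continuous_bounded_supp => // x xr; rewrite /divergence big1// => i _.
  by apply: (scalar_C1_derive_supp i (C1phi i) _ xr) => y yr; rewrite phi0// mxE.
by exists (r + 1), M.
Qed.

Lemma perimeter_ub E phi : test_field phi ->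
  (\int[mu]_(x in E) (divergence phi x)%:E <= perimeter E)%E.
Proof. by move=> tphi; apply: ereal_sup_ubound; exists phi. Qed.

Lemma scalar_C1_coordN phi j : scalar_C1 (fun x => phi x 0 j) ->
  scalar_C1 (fun x => (- phi x) 0 j).
Proof.
by move=> /scalar_C1N; congr scalar_C1; apply/funext => x; rewrite mxE.
Qed.

Lemma test_fieldN phi : test_field phi -> test_field (fun x => - phi x).
Proof.
move=> [C1phi cphi phi1]; split.
- by apply: coord_C1 => j; apply: scalar_C1_coordN; exact: C1_coord.
- rewrite /compactly_supported (_ : [set x | _] = [set x | phi x != 0])//.
  by apply/seteqP; split => x /=; rewrite oppr_eq0.
- move=> x; have := phi1 x; rewrite /eucl_norm.
  by under [in X in _ -> X]eq_bigr do rewrite mxE sqrrN.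
Qed.

Lemma divergenceN phi x : C1 phi -> divergence (fun x => - phi x) x = -
  divergence phi x.
Proof.
move=> /C1_coord C1phi; rewrite /divergence -sumrN; apply: eq_bigr => i _.
rewrite (_ : (fun y => (- phi y) 0 i) = - (fun y => phi y 0 i));
  last by apply/funext => y; rewrite mxE.
by apply: deriveN; exact: (C1phi i i).1.
Qed.

Lemma integral_divergence0 phi : test_field phi ->
  (\int[mu]_x (divergence phi x)%:E = 0)%E.
Proof.
move=> tphi; have [/C1_coord C1phi /compact_support_cube[r r0 phi0] _] := tphi.
rewrite /divergence; under eq_integral do rewrite -sumEFin.
have r10 : 0 < r + 1 by rewrite addr_gt0.
have phi0j j x : ~ box (cube r) x -> phi x 0 j = 0 by move=> /phi0 ->;
  rewrite mxE.
rewrite integral_sum; [|exact: measurableT|].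
  by rewrite big1// => i _; exact: integral_partial0 r0 (C1phi i) (phi0j i).
move=> i; have [M HM] := continuous_bounded_supp r10 (C1phi i i).2
  (scalar_C1_derive_supp i (C1phi i) (phi0j i)).
apply: (integrable_dominated measurableT _ HM).
exact: (continuous_lebesgue_measurable (C1phi i i).2).
Qed.

Lemma integrable_divergence phi E : test_field phi -> lebesgue_measurable E ->
  mu.-integrable E (EFin \o divergence phi : T -> \bar R).
Proof.
move=> /test_field_divergence[r [M [_ _ cdiv HM]]] mE.
exact: (integrable_dominated mE (continuous_lebesgue_measurable cdiv) HM).
Qed.

Lemma integral_setU_dominated M D g A B : continuous g -> dominated M D g ->
  lebesgue_measurable A -> lebesgue_measurable B -> A `&` B = set0 ->
  (\int[mu]_(x in A `|` B) (g x)%:E =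
   \int[mu]_(x in A) (g x)%:E + \int[mu]_(x in B) (g x)%:E)%E.
Proof.
move=> cg gMD mA mB AB.
apply: (integral_setU mu (mA : measurable (A : set T)) (mB : measurable (B :
  set T))).
  exact/measurable_EFinP/measurable_funTS/continuous_lebesgue_measurable.
by apply/disj_setPS; rewrite AB.
Qed.

Lemma integral_fin_num M D g A : continuous g -> dominated M D g ->
  lebesgue_measurable A -> (\int[mu]_(x in A) (g x)%:E)%E \is a fin_num.
Proof.
move=> cg gMD mA.
exact: (integrable_fin_num mA (integrable_dominated mA
  (continuous_lebesgue_measurable cg) gMD)).
Qed.

Lemma abse_integral_le M D g A : 0 <= M -> continuous g -> dominated M D g ->
  lebesgue_measurable A -> (`|\int[mu]_(x in A) (g x)%:E| <= M%:E * mu A)%E.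
Proof.
move=> M0 cg gMD mA.
have mg := continuous_lebesgue_measurable cg.
apply: (le_trans (le_abse_integral mu (mA : measurable (A : set T)) _)).
  exact/measurable_EFinP/measurable_funTS.
rewrite -(integral_cst mu (mA : measurable (A : set T))).
apply: ge0_le_integral; [exact: mA|by []| |exact: measurable_cst|].
  by apply: measurableT_comp; [exact:
    abse_measurable|exact/measurable_EFinP/measurable_funTS].
move=> x _; rewrite lee_fin; apply: (le_trans (gMD x)); rewrite indicE.
by case: (_ \in _); rewrite ?mulr1 ?mulr0.
Qed.

Lemma integral_divergenceN phi E : test_field phi -> lebesgue_measurable E ->
  (\int[mu]_(x in E) (divergence (fun y => - phi y)%R x)%:E =
   - \int[mu]_(x in E) (divergence phi x)%:E)%E.
Proof.
move=> tphi mE; have [C1phi _ _] := tphi.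
rewrite -(integralN (integrable_add_def mE (integrable_divergence tphi mE))).
by apply: eq_integral => x _; rewrite divergenceN.
Qed.

(** A divergence has integral 0 over the whole space, so [phi] on the complement gives the same
    value as [- phi] on [E]. Adding a cube thereby reduces to removing one from the complement. *)
Lemma perimeter_setC_le E : lebesgue_measurable E ->
  (perimeter (~` E) <= perimeter E)%E.
Proof.
move=> mE; apply: ge_ereal_sup => _ [phi tphi <-].
have [r [M [r0 _ cdiv HM]]] := test_field_divergence tphi.
have mC : lebesgue_measurable (~` E) by exact: (measurableC (mE : measurable (E
  : set T))).
have := integral_setU_dominated cdiv HM mE mC (setICr E).
rewrite setUv (integral_divergence0 tphi).
have fE := integral_fin_num cdiv HM mE; have fC := integral_fin_num cdiv HM mC.
move=> H; apply: le_trans (perimeter_ub E (test_fieldN tphi)).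
rewrite (integral_divergenceN tphi mE) -(fineK fE) -(fineK fC).
move: H; rewrite -(fineK fE) -(fineK fC) -EFinD => -[H].
by rewrite -EFinN lee_fin; lra.
Qed.

Lemma perimeter_setC E : lebesgue_measurable E -> perimeter (~` E) = perimeter E.
Proof.
move=> mE; apply/le_anti; rewrite perimeter_setC_le//=.
rewrite -[X in (perimeter X <= _)%E](setCK E) perimeter_setC_le//.
exact: (measurableC (mE : measurable (E : set T))).
Qed.

Lemma integral_symdiff_le M D g E F : 0 <= M -> continuous g -> dominated M D g ->
  lebesgue_measurable E -> lebesgue_measurable F ->
  (\int[mu]_(x in E) (g x)%:E <=
   \int[mu]_(x in F) (g x)%:E + M%:E * mu (symdiff E F))%E.
Proof.
move=> M0 cg gMD mE mF.
have mI : lebesgue_measurable (E `&` F) by exact: (@measurableI _ T).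
have m1 : lebesgue_measurable (E `\` F) by exact: (@measurableD _ T).
have m2 : lebesgue_measurable (F `\` E) by exact: (@measurableD _ T).
have d1 : (E `&` F) `&` (E `\` F) = set0 by apply/seteqP;
  split => // x [[_ Fx] [_ /(_ Fx)]].
have d2 : (E `&` F) `&` (F `\` E) = set0 by apply/seteqP;
  split => // x [[Ex _] [_ /(_ Ex)]].
have -> : (\int[mu]_(x in E) (g x)%:E = \int[mu]_(x in E `&` F) (g x)%:E +
  \int[mu]_(x in E `\` F) (g x)%:E)%E.
  by rewrite -(integral_setU_dominated cg gMD)// setUIDK.
have -> : (\int[mu]_(x in F) (g x)%:E = \int[mu]_(x in E `&` F) (g x)%:E +
  \int[mu]_(x in F `\` E) (g x)%:E)%E.
  by rewrite -(integral_setU_dominated cg gMD)// setIC setUIDK.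
rewrite /symdiff measureU//; last by apply/seteqP; split => // x [[Ex Fx] []].
rewrite muleDr//; last by rewrite ge0_adde_def// inE measure_ge0.
rewrite -addeA leeD2l// addeA.
have h1 := abse_integral_le M0 cg gMD m1;
  have h2 := abse_integral_le M0 cg gMD m2.
apply: (le_trans (lee_abs _)); apply: (le_trans h1).
rewrite -[leLHS]add0e [leRHS]addeAC.
apply: leeD => //; rewrite -leeBlDl ?sub0e;
  last exact: (integral_fin_num cg gMD m2).
by apply: (le_trans _ h2); rewrite -abseN; exact: lee_abs.
Qed.

(** For a fixed test field the integral is Lipschitz for the measure of the symmetric difference,
    and the perimeter is a supremum of such integrals. *)
Lemma perimeter_lsc E (L : \bar R) : lebesgue_measurable E ->
  (forall e : R, 0 < e -> exists F, [/\ lebesgue_measurable F, (perimeter F <=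
    L)%E &
    (mu (symdiff E F) <= e%:E)%E]) -> (perimeter E <= L)%E.
Proof.
move=> mE HE; apply: ge_ereal_sup => _ [phi tphi <-].
have [r [M [r0 _ cdiv HM]]] := test_field_divergence tphi.
have M0 : 0 <= M.
  have := HM 0; rewrite indicE mem_set ?mulr1; first exact: le_trans.
  by move=> j; rewrite !mxE; lra.
apply/lee_addgt0Pr => e e0.
have [F [mF FL EF]] := HE (e / (M + 1)) (divr_gt0 e0 (ltr_wpDl M0 ltr01)).
apply: (le_trans (integral_symdiff_le M0 cdiv HM mE mF)); apply: leeD.
  exact: le_trans (perimeter_ub F tphi) FL.
apply: (@le_trans _ _ (M%:E * (e / (M + 1))%:E)%E).
  by apply: lee_wpmul2l => //; rewrite lee_fin.
rewrite -EFinM lee_fin mulrCA ler_piMr ?(ltW e0)//.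
by rewrite ler_pdivrMr ?ltr_wpDl// mul1r lerDl.
Qed.

Lemma perimeter_eq0 E F : lebesgue_measurable E -> lebesgue_measurable F ->
  mu (symdiff E F) = 0%E -> perimeter E = perimeter F.
Proof.
move=> mE mF EF; apply/le_anti/andP; split; apply: perimeter_lsc => // e e0.
  by exists F; split => //; rewrite EF lee_fin ltW.
by exists E; split => //; rewrite symdiffC EF lee_fin ltW.
Qed.

Lemma test_field0 : test_field (fun _ : 'rV[R]_n => 0 : 'rV[R]_n).
Proof.
split.
- apply: coord_C1 => j; rewrite (_ : (fun x => _) = (fun=> 0 : R));
  first exact: scalar_C1_cst.
  by apply/funext => x; rewrite mxE.
- rewrite /compactly_supported (_ : [set x | _] = set0) ?closure0;
  first exact: compact0.
  by apply/seteqP; split => x //=; rewrite eqxx.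
- move=> x; rewrite /eucl_norm big1 ?sqrtr0// => i _.
  by rewrite mxE expr0n.
Qed.

Lemma perimeter_ge0 E : (0 <= perimeter E)%E.
Proof.
apply: le_trans (perimeter_ub E test_field0).
rewrite integral0_eq// => x _; rewrite /divergence big1// => i _.
rewrite (_ : (fun y => _) = (fun=> 0 : R));
  first exact: (@derive_cst _ _ _ (0 : R)).
by apply/funext => y; rewrite mxE.
Qed.

Lemma perimeter_set0 : perimeter (set0 : set 'rV[R]_n) = 0%E.
Proof.
apply/le_anti; rewrite perimeter_ge0 andbT.
by apply: ge_ereal_sup => _ [phi tphi <-]; rewrite integral_set0.
Qed.

Lemma test_field_axis f i r : scalar_C1 f -> (forall x, ~ box (cube r) x ->
  f x = 0) ->
  (forall x, `|f x| <= 1) -> test_field (fun x => f x *: basis_vec i).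
Proof.
move=> C1f f0 f1.
have coordE j : (fun x => (f x *: basis_vec i) 0 j) = (fun x => f x * (j ==
  i)%:R).
  by apply/funext => x; rewrite !mxE eqxx.
split.
- by apply: coord_C1 => j; rewrite coordE; apply: scalar_C1M => //;
  exact: scalar_C1_cst.
- by apply: (@cube_compactly_supported _ r) => x /f0 ->; rewrite scale0r.
- move=> x; rewrite /eucl_norm (bigD1 i)//= big1 => [|j ji].
    by rewrite addr0 !mxE !eqxx mulr1 sqrtr_sqr.
  by rewrite !mxE (negbTE ji) andbF mulr0 expr0n.
Qed.

Lemma divergence_axis f i x : scalar_C1 f ->
  divergence (fun x => f x *: basis_vec i) x = 'D_(basis_vec i) f x.
Proof.
move=> C1f; rewrite /divergence (bigD1 i)//= big1 => [|j ji].
  rewrite addr0; congr ('D_ _ _ x); apply/funext => y.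
  by rewrite !mxE !eqxx mulr1.
rewrite (_ : (fun y => _) = (fun=> 0 : R));
  first exact: (@derive_cst _ _ _ (0 : R)).
by apply/funext => y; rewrite !mxE (negbTE ji) andbF mulr0.
Qed.

End perimeter_theory.

(** * One-variable profiles: bumps, smoothed positive parts and tents *)

Section bumps.
Context {R : realType}.
Implicit Types (k a b c r u x : R).

Lemma continuous_is_derive (g dg : R -> R) : (forall x, is_derive x 1 g (dg x))
  -> continuous g.
Proof.
move=> gdg x; apply: differentiable_continuous; apply/derivable1_diffP.
by have [] := gdg x.
Qed.

Lemma continuous_comp_aff (g : R -> R) a b : continuous g ->
  continuous (fun y => g (a * y + b)).
Proof.
move=> cg x; apply: (@continuous_comp _ _ _ (fun x => a * x + b) g);
  last exact: cg.
by apply: cvgD; [apply: cvgM; [exact: cvg_cst|exact: cvg_id]|exact: cvg_cst].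
Qed.

Lemma continuous_scale (g : R -> R) a : continuous g ->
  continuous (fun y => a * g y).
Proof. by move=> cg x; apply: cvgM; [exact: cvg_cst|exact: cg]. Qed.

Lemma continuous_ramp : continuous (@ramp R).
Proof. exact: (continuous_is_derive (@is_derive_ramp R)). Qed.

(** For [k > 0]: 0 outside []a, b[], and 1 at distance at least [1 / k] inside both ends. The affine
    arguments have the shape expected by [is_derive_comp_aff]. *)
Definition bump k a b x := ramp (k * x + - (k * a)) * ramp (- k * x + k * b).
Definition dbump k a b x :=
  ramp (k * x + - (k * a)) * (- k * dramp (- k * x + k * b)) +
  ramp (- k * x + k * b) * (k * dramp (k * x + - (k * a))).

Lemma is_derive_bump k a b x : is_derive x 1 (bump k a b) (dbump k a b x).
Proof.
have h1 := is_derive_comp_aff (is_derive_ramp (k * x + - (k * a))).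
have h2 := is_derive_comp_aff (is_derive_ramp (- k * x + k * b)).
exact: (@is_deriveM _ _ _ _ _ _ _ _ h1 h2).
Qed.

Lemma continuous_dbump k a b : continuous (dbump k a b).
Proof.
have cr := continuous_ramp; have cd := @continuous_dramp R.
have c1 := @continuous_comp_aff _ k (- (k * a)) cr.
have c2 := @continuous_comp_aff _ (- k) (k * b) cr.
have c3 := @continuous_scale _ k (@continuous_comp_aff _ k (- (k * a)) cd).
have c4 := @continuous_scale _ (- k) (@continuous_comp_aff _ (- k) (k * b) cd).
move=> x.
exact: (continuousD (continuousM (c1 x) (c4 x)) (continuousM (c2 x) (c3 x))).
Qed.

Lemma bump_ge0 k a b x : 0 <= bump k a b x.
Proof. by rewrite mulr_ge0// ramp_ge0. Qed.

Lemma bump_le1 k a b x : bump k a b x <= 1.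
Proof. by rewrite mulr_ile1// ?ramp_ge0// ramp_le1. Qed.

Lemma bump_out k a b x : 0 <= k -> ~~ (a < x < b) -> bump k a b x = 0.
Proof.
move=> k0; rewrite negb_and -!leNgt /bump => /orP[xa|bx].
  by rewrite (@ramp_le0 _ (k * x + _)) ?mul0r//; nra.
by rewrite (@ramp_le0 _ (- k * x + _)) ?mulr0//; nra.
Qed.

Lemma bump_in k a b x : 1 <= k * (x - a) -> 1 <= k * (b - x) -> bump k a b x = 1.
Proof. by move=> xa bx; rewrite /bump !ramp_ge1 ?mulr1//; lra. Qed.

Lemma dbump_out k a b x : 0 <= k -> ~~ (a < x < b) -> dbump k a b x = 0.
Proof.
move=> k0; rewrite negb_and -!leNgt /dbump => /orP[xa|bx].
  have h : k * x - k * a <= 0 by nra.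
  by rewrite (ramp_le0 h) (dramp_le0 h) mul0r mulr0 mulr0 addr0.
have h : - k * x + k * b <= 0 by nra.
by rewrite (ramp_le0 h) (dramp_le0 h) !mulr0 mul0r addr0.
Qed.

Lemma dbump_in k a b x : 1 <= k * (x - a) -> 1 <= k * (b - x) ->
  dbump k a b x = 0.
Proof.
move=> xa bx; rewrite /dbump (@dramp_ge1 _ (k * x + _)) ?(@dramp_ge1 _ (- k * x
  + _)); try lra.
Qed.

(** The rising and the falling term have opposite signs, hence [2 * k] and not [4 * k]. *)
Lemma normr_dbump k a b x : 0 <= k -> `|dbump k a b x| <= 2 * k.
Proof.
move=> k0; rewrite /dbump.
move: (ramp_ge0 (k * x + - (k * a))) (ramp_le1 (k * x + - (k * a))).
move: (ramp_ge0 (- k * x + k * b)) (ramp_le1 (- k * x + k * b)).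
move: (dramp_ge0 (k * x + - (k * a))) (dramp_le2 (k * x + - (k * a))).
move: (dramp_ge0 (- k * x + k * b)) (dramp_le2 (- k * x + k * b)).
move: (ramp _) (ramp _) (dramp _) (dramp _) => p q s t *.
have h1 : 0 <= p * t <= 2 by apply/andP; split; nra.
have h2 : 0 <= q * s <= 2 by apply/andP; split; nra.
rewrite ler_norml; apply/andP; split; nra.
Qed.

(* A C^1 approximation of the positive part, equal to it where k u >= 1. *)
Definition soft k u := u * ramp (k * u + 0).
Definition dsoft k u := u * (k * dramp (k * u + 0)) + ramp (k * u + 0) * 1.

Lemma is_derive_soft k u : is_derive u 1 (soft k) (dsoft k u).
Proof.
have h1 := is_derive_comp_aff (is_derive_ramp (k * u + 0)).
exact: (@is_deriveM _ _ _ _ _ _ _ _ (is_derive_id u 1) h1).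
Qed.

Lemma continuous_dsoft k : continuous (dsoft k).
Proof.
have cr := continuous_ramp; have cd := @continuous_dramp R.
have c1 := @continuous_comp_aff _ k 0 cr.
have c2 := @continuous_scale _ k (@continuous_comp_aff _ k 0 cd).
move=> x.
have ci : {for x, continuous (fun y : R => y)} by exact: cvg_id.
have c0 : {for x, continuous (fun=> 1 : R)} by exact: cvg_cst.
exact: (continuousD (continuousM ci (c2 x)) (continuousM (c1 x) c0)).
Qed.

Lemma soft_le0 k u : 0 <= k -> u <= 0 -> soft k u = 0.
Proof. by move=> k0 u0; rewrite /soft ramp_le0 ?mulr0//; nra. Qed.

Lemma dsoft_le0 k u : 0 <= k -> u <= 0 -> dsoft k u = 0.
Proof. by move=> k0 u0; rewrite /dsoft ramp_le0 ?dramp_le0; try nra; lra. Qed.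

Lemma soft_ge1 k u : 1 <= k * u -> soft k u = u.
Proof. by move=> ku; rewrite /soft ramp_ge1 ?mulr1//; lra. Qed.

Lemma dsoft_ge1 k u : 1 <= k * u -> dsoft k u = 1.
Proof. by move=> ku; rewrite /dsoft ramp_ge1 ?dramp_ge1; lra. Qed.

Lemma soft_ge0 k u : 0 <= k -> 0 <= soft k u.
Proof.
move=> k0; case: (leP u 0) => [u0|u0]; first by rewrite soft_le0.
by rewrite /soft mulr_ge0 ?ramp_ge0// ltW.
Qed.

Lemma soft_le k u : 0 <= u -> soft k u <= u.
Proof. by move=> u0; rewrite /soft ler_piMr// ramp_le1. Qed.

Lemma soft_ge k u : 0 < k -> u - k^-1 <= soft k u.
Proof.
move=> k0; have [ku|ku] := leP 1 (k * u).
  by rewrite soft_ge1// lerBlDr lerDl invr_ge0 ltW.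
apply: (@le_trans _ _ 0); last by rewrite soft_ge0// ltW.
by rewrite subr_le0 -[k^-1]mul1r ler_pdivlMr// mulrC ltW.
Qed.

Lemma dsoft_ge0 k u : 0 <= k -> 0 <= dsoft k u.
Proof.
move=> k0; case: (leP u 0) => [u0|u0]; first by rewrite dsoft_le0.
rewrite /dsoft mulr1; apply: addr_ge0; last exact: ramp_ge0.
by apply: mulr_ge0; [exact: ltW|apply: mulr_ge0 => //; exact: dramp_ge0].
Qed.

Lemma dsoft_le3 k u : 0 <= k -> dsoft k u <= 3.
Proof.
move=> k0; case: (leP u 0) => [u0|u0]; first by rewrite dsoft_le0.
have [ku|ku] := leP 1 (k * u); first by rewrite dsoft_ge1//; lra.
rewrite /dsoft; have := ramp_le1 (k * u + 0); have := dramp_le2 (k * u + 0).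
have := dramp_ge0 (k * u + 0); move: (ramp _) (dramp _) => p q *.
have : u * (k * q) <= 2 by rewrite mulrA [u * k]mulrC; nra.
lra.
Qed.

(* tent k r c approximates the positive part of r - |x - c|; the shift by 1 / k
   keeps it supported where |x - c| <= r. *)
Definition tent_arg k r c x := r - k^-1 - soft k (1 * x + - c) - soft k (- 1 *
  x + c).
Definition tent k r c x := soft k (tent_arg k r c x).
Definition dtent k r c x := dsoft k (tent_arg k r c x) *
  (0 - 1 * dsoft k (1 * x + - c) - - 1 * dsoft k (- 1 * x + c)).

Lemma is_derive_tent k r c x : is_derive x 1 (tent k r c) (dtent k r c x).
Proof.
have h1 := is_derive_comp_aff (is_derive_soft k (1 * x + - c)).
have h2 := is_derive_comp_aff (is_derive_soft k (- 1 * x + c)).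
have h0 : is_derive x 1 (fun=> r - k^-1) (0 : R) by exact: is_derive_cst.
have h3 := @is_deriveB _ _ _ _ _ _ _ _ _ (@is_deriveB _ _ _ _ _ _ _ _ _ h0 h1) h2.
have := @is_derive1_comp _ (soft k) (tent_arg k r c) x _ _ (is_derive_soft _ _)
  h3.
by [].
Qed.

Lemma continuous_tent_arg k r c : continuous (tent_arg k r c).
Proof.
have cs := continuous_is_derive (is_derive_soft k).
have c1 := @continuous_comp_aff _ 1 (- c) cs.
have c2 := @continuous_comp_aff _ (- 1) c cs.
move=> x.
have c0 : {for x, continuous (fun=> r - k^-1 : R)} by exact: cvg_cst.
exact: (continuousB (continuousB c0 (c1 x)) (c2 x)).
Qed.

Lemma continuous_dtent k r c : continuous (dtent k r c).
Proof.
have cd : continuous (dsoft k) by exact: continuous_dsoft.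
have c1 := @continuous_scale _ 1 (@continuous_comp_aff _ 1 (- c) cd).
have c2 := @continuous_scale _ (- 1) (@continuous_comp_aff _ (- 1) c cd).
move=> x.
have c0 : {for x, continuous (fun=> 0 : R)} by exact: cvg_cst.
have c3 : {for x, continuous (fun x => dsoft k (tent_arg k r c x))}.
  by apply: (@continuous_comp _ _ _ (tent_arg k r c) (dsoft k));
    [exact: continuous_tent_arg|exact: cd].
exact: (continuousM c3 (continuousB (continuousB c0 (c1 x)) (c2 x))).
Qed.

Lemma tent_arg_le k r c x : 0 < k -> tent_arg k r c x <= r - `|x - c|.
Proof.
move=> k0; rewrite /tent_arg.
have := soft_ge (1 * x + - c) k0; have := soft_ge (- 1 * x + c) k0.
have := soft_ge0 (1 * x + - c) (ltW k0); have := soft_ge0 (- 1 * x + c) (ltW k0).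
by case: (ger0P (x - c)) => ?; lra.
Qed.

Lemma tent_ge0 k r c x : 0 < k -> 0 <= tent k r c x.
Proof. by move=> k0; apply: soft_ge0; exact: ltW. Qed.

Lemma tent_le k r c x : 0 < k -> 0 <= r -> tent k r c x <= r.
Proof.
move=> k0 r0; have := tent_arg_le r c x k0; rewrite /tent => h.
have [u0|u0] := leP (tent_arg k r c x) 0; first by rewrite soft_le0// ltW.
by apply: (le_trans (soft_le _ (ltW u0))); apply: (le_trans h);
  rewrite lerBlDr lerDl.
Qed.

Lemma tent_out k r c x : 0 < k -> r <= `|x - c| -> tent k r c x = 0.
Proof.
by move=> k0 rx; apply: soft_le0; [exact: ltW|have := tent_arg_le r c x k0; lra].
Qed.

Lemma dtent_out k r c x : 0 < k -> r <= `|x - c| -> dtent k r c x = 0.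
Proof.
move=> k0 rx; rewrite /dtent dsoft_le0 ?mul0r//; first exact: ltW.
by have := tent_arg_le r c x k0; lra.
Qed.

(** A crude constant suffices, as it serves only for domination; each 3 comes from [dsoft_le3]. *)
Lemma normr_dtent k r c x : 0 < k -> `|dtent k r c x| <= 9.
Proof.
move=> /ltW k0; rewrite /dtent normrM.
have -> : 9 = 3 * 3 :> R by lra.
apply: ler_pM => //.
  by rewrite ger0_norm ?dsoft_ge0// dsoft_le3.
have := dsoft_ge0 (1 * x + - c) k0; have := dsoft_ge0 (- 1 * x + c) k0.
have := dsoft_le3 (1 * x + - c) k0; have := dsoft_le3 (- 1 * x + c) k0.
by rewrite ler_norml => *; lra.
Qed.

(** The 2 pays [1 / k] for the shift in [tent_arg] and [1 / k] for the outer [soft] to reach its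
    linear range. *)
Lemma dtent_left k r c x : 0 < k -> 1 <= k * (c - x) -> 2 <= k * (r - (c - x)) ->
  dtent k r c x = 1.
Proof.
move=> k0 h1 h2; have xc : x < c by rewrite -subr_gt0 -(pmulr_rgt0 _ k0); lra.
rewrite /dtent /tent_arg (@soft_le0 k (1 * x + - c)) ?(ltW k0)//; last lra.
rewrite (@dsoft_le0 k (1 * x + - c)) ?(ltW k0)//; last lra.
rewrite (@soft_ge1 k (- 1 * x + c)); last lra.
rewrite (@dsoft_ge1 k (- 1 * x + c)); last lra.
rewrite dsoft_ge1; first lra.
have : k * k^-1 = 1 by rewrite divff// gt_eqF.
by move: k^-1 => *; lra.
Qed.

Lemma dtent_right k r c x : 0 < k -> 1 <= k * (x - c) -> 2 <= k * (r - (x - c)) ->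
  dtent k r c x = -1.
Proof.
move=> k0 h1 h2; have xc : c < x by rewrite -subr_gt0 -(pmulr_rgt0 _ k0); lra.
rewrite /dtent /tent_arg (@soft_le0 k (- 1 * x + c)) ?(ltW k0)//; last lra.
rewrite (@dsoft_le0 k (- 1 * x + c)) ?(ltW k0)//; last lra.
rewrite (@soft_ge1 k (1 * x + - c)); last lra.
rewrite (@dsoft_ge1 k (1 * x + - c)); last lra.
rewrite dsoft_ge1; first lra.
have : k * k^-1 = 1 by rewrite divff// gt_eqF.
by move: k^-1 => *; lra.
Qed.

End bumps.

(** * Test fields supported in a box *)

Section cell_fields.
Context {R : realType} {n : nat}.
Implicit Types (p D : 'rV[R]_n * 'rV[R]_n) (E : set 'rV[R]_n).
Implicit Types (s : seq ('rV[R]_n * 'rV[R]_n)) (w : 'I_n ->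
  R) (k : R) (x : 'rV[R]_n).
Implicit Types (i j : 'I_n).
Local Notation mu := (@lebesgue_n R n).
Local Notation T := (lebesgueType R n).

Lemma near_mulSn_ge (t c : R) : 0 < t -> \forall m \near \oo, c <= m.+1%:R * t.
Proof.
move=> t0; exists (Num.truncn (c / t)) => // m /= cm.
rewrite -ler_pdivrMr//; apply: ltW; apply: (lt_le_trans (truncnS_gt _)).
by rewrite ler_nat ltnS.
Qed.

Definition box_bump k p := prodf (fun j => bump k (p.1 0 j) (p.2 0 j)).

Definition tent_or_bump k i p j : R -> R :=
  if j == i then tent k ((p.2 0 j - p.1 0 j) / 2) (mid p j) else bump k (p.1 0
    j) (p.2 0 j).

Definition dtent_or_bump k i p j : R -> R :=
  if j == i then dtent k ((p.2 0 j - p.1 0 j) / 2) (mid p j) else dbump k (p.1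
    0 j) (p.2 0 j).

Definition cell_field k i p := prodf (tent_or_bump k i p).

Lemma is_derive_tent_or_bump k i p j (u : R) :
  is_derive u 1 (tent_or_bump k i p j) (dtent_or_bump k i p j u).
Proof.
rewrite /tent_or_bump /dtent_or_bump; case: ifP => _; first exact: is_derive_tent.
exact: is_derive_bump.
Qed.

Lemma scalar_C1_cell_field k i p : scalar_C1 (cell_field k i p).
Proof.
apply: (scalar_C1_prodf (dg := dtent_or_bump k i p)).
  by move=> j u; exact: is_derive_tent_or_bump.
move=> j; rewrite /dtent_or_bump; case: ifP => _; first exact: continuous_dtent.
exact: continuous_dbump.
Qed.

Lemma scalar_C1_box_bump k p : scalar_C1 (box_bump k p).
Proof.
apply: (scalar_C1_prodf (dg := fun j => dbump k (p.1 0 j) (p.2 0 j))).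
  by move=> j u; exact: is_derive_bump.
by move=> j; exact: continuous_dbump.
Qed.

Lemma derive_cell_field k i p x : 'D_(basis_vec i) (cell_field k i p) x =
  dtent k ((p.2 0 i - p.1 0 i) / 2) (mid p i) (x 0 i) *
  \prod_(j | j != i) bump k (p.1 0 j) (p.2 0 j) (x 0 j).
Proof.
have [_ ->] := is_derive_prodf i x (fun j (u : R) => is_derive_tent_or_bump k i
  p j u).
rewrite /dprodf /dtent_or_bump eqxx; congr *%R; apply: eq_bigr => j ji.
by rewrite /tent_or_bump (negbTE ji).
Qed.

Lemma derive_box_bump k i p x : 'D_(basis_vec i) (box_bump k p) x =
  dbump k (p.1 0 i) (p.2 0 i) (x 0 i) *
  \prod_(j | j != i) bump k (p.1 0 j) (p.2 0 j) (x 0 j).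
Proof.
by have [_ ->] := is_derive_prodf i x (fun j (u : R) => is_derive_bump k (p.1 0
  j) (p.2 0 j) u).
Qed.

Let prod_bump_ge0 k p (P : pred 'I_n) x :
  0 <= \prod_(j | P j) bump k (p.1 0 j) (p.2 0 j) (x 0 j).
Proof. by apply: prodr_ge0 => j _; exact: bump_ge0. Qed.

Let prod_bump_le1 k p (P : pred 'I_n) x :
  \prod_(j | P j) bump k (p.1 0 j) (p.2 0 j) (x 0 j) <= 1.
Proof. by apply: prodr_ile1 => j _; rewrite bump_ge0 bump_le1. Qed.

Lemma open_boxPn p x : ~ open_box p x -> exists j, ~~ (p.1 0 j < x 0 j < p.2 0 j).
Proof. by move=> /existsNP[j /negP]; exists j. Qed.

Let tent_rad (a b y : R) : ~~ (a < y < b) -> (b - a) / 2 <= `|y - (a + b) / 2|.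
Proof.
rewrite negb_and -!leNgt => /orP[h|h].
  by rewrite ler_normr; apply/orP; right; lra.
by rewrite ler_normr; apply/orP; left; lra.
Qed.

Lemma cell_field_out k i p x : 0 < k -> ~ open_box p x -> cell_field k i p x = 0.
Proof.
move=> k0 /open_boxPn[j xj]; rewrite /cell_field /prodf (bigD1 j)//=.
rewrite {1}/tent_or_bump; case: ifP => _.
  by rewrite tent_out ?mul0r//; exact: tent_rad.
by rewrite bump_out ?mul0r// ltW.
Qed.

Lemma derive_cell_field_out k i p x : 0 < k -> ~ open_box p x ->
  'D_(basis_vec i) (cell_field k i p) x = 0.
Proof.
move=> k0 /open_boxPn[j xj]; rewrite derive_cell_field.
have [ji|ji] := eqVneq j i.
  by rewrite dtent_out ?mul0r// -ji; exact: tent_rad.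
by rewrite (bigD1 j)//= bump_out ?mul0r ?mulr0// ltW.
Qed.

Lemma box_bump_out k p x : 0 < k -> ~ open_box p x -> box_bump k p x = 0.
Proof.
move=> k0 /open_boxPn[j xj]; rewrite /box_bump /prodf (bigD1 j)//=.
by rewrite bump_out ?mul0r// ltW.
Qed.

Lemma derive_box_bump_out k i p x : 0 < k -> ~ open_box p x ->
  'D_(basis_vec i) (box_bump k p) x = 0.
Proof.
move=> k0 /open_boxPn[j xj]; rewrite derive_box_bump.
have [ji|ji] := eqVneq j i.
  by rewrite dbump_out ?mul0r ?(ltW k0)// -ji.
by rewrite (bigD1 j)//= bump_out ?mul0r ?mulr0// ltW.
Qed.

Lemma open_box_sub p : open_box p `<=` box p.
Proof. by move=> x xp j; have /andP[-> /ltW ->] := xp j. Qed.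

(** Here the constant has to be the exact half width: it is what the field is divided by to have
    norm at most 1. *)
Lemma normr_cell_field k i p x : 0 < k -> p.1 0 i <= p.2 0 i ->
  `|cell_field k i p x| <= (p.2 0 i - p.1 0 i) / 2 * \1_(box p) x.
Proof.
move=> k0 pi; have r0 : 0 <= (p.2 0 i - p.1 0 i) / 2 by lra.
have [xp|xp] := pselect (open_box p x); last first.
  by rewrite cell_field_out// normr0 mulr_ge0// indicE.
rewrite indicE mem_set ?mulr1; last exact: open_box_sub.
rewrite /cell_field /prodf (bigD1 i)//= {1}/tent_or_bump eqxx.
under eq_bigr => j ji do rewrite /tent_or_bump (negbTE ji).
rewrite ger0_norm; last by apply: mulr_ge0;
  [exact: tent_ge0|exact: prod_bump_ge0].
by apply: (le_trans (ler_piMr (tent_ge0 _ _ _ k0) (prod_bump_le1 _ _ _ _)));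
  exact: tent_le.
Qed.

Lemma normr_derive_cell_field k i p x : 0 < k ->
  `|'D_(basis_vec i) (cell_field k i p) x| <= 9 * \1_(box p) x.
Proof.
move=> k0; have [xp|xp] := pselect (open_box p x); last first.
  by rewrite derive_cell_field_out// normr0 mulr_ge0// indicE.
rewrite indicE mem_set ?mulr1; last exact: open_box_sub.
rewrite derive_cell_field normrM -[leRHS]mulr1; apply: ler_pM => //.
  exact: normr_dtent.
by rewrite ger0_norm.
Qed.

Lemma box_bump_ge0 k p x : 0 <= box_bump k p x.
Proof. exact: prod_bump_ge0. Qed.

Lemma box_bump_le1 k p x : box_bump k p x <= 1.
Proof. exact: prod_bump_le1. Qed.

Let near_bump_in p x : open_box p x -> \forall m \near \oo, forall j,
  1 <= m.+1%:R * (x 0 j - p.1 0 j) /\ 1 <= m.+1%:R * (p.2 0 j - x 0 j).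
Proof.
move=> xp; apply: filter_forall => j; apply: filterI.
  by apply: near_mulSn_ge; have := xp j; lra.
by apply: near_mulSn_ge; have := xp j; lra.
Qed.

Lemma cvg_box_bump p x : ~ (box p `\` open_box p) x ->
  box_bump m.+1%:R p x @[m --> \oo] --> (\1_(box p) x : R).
Proof.
move=> xp; have [xb|xb] := pselect (box p x); last first.
  rewrite indicE memNset// (_ : (fun m => _) = (fun=> 0)); first exact: cvg_cst.
  by apply/funext => m; rewrite box_bump_out// => /open_box_sub.
have xo : open_box p x by apply: contrapT => xo; exact: xp.
rewrite indicE mem_set//.
apply: cvg_near_cst; apply: filterS (near_bump_in xo) => m Hm.
by rewrite /box_bump /prodf big1// => j _; have [? ?] := Hm j; exact: bump_in.
Qed.

(** Off the faces and the middle hyperplane the sequence is eventually constant: the bumps equal 1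
    and the tent has slope 1 below the middle and -1 above it. *)
Lemma cvg_derive_cell_field p i x : p.1 0 i < p.2 0 i ->
  ~ (box p `\` open_box p) x -> x 0 i <> mid p i ->
  'D_(basis_vec i) (cell_field m.+1%:R i p) x @[m --> \oo] -->
  (\1_(box (lower_half i p)) x - \1_(box (upper_half i p)) x : R).
Proof.
move=> pi xp xi.
rewrite (box_cut_below (p := p) (i := i) (c := mid p i)); last by rewrite /mid;
  lra.
rewrite (box_cut_above (p := p) (i := i) (c := mid p i)); last by rewrite /mid;
  lra.
have [xb|xb] := pselect (box p x); last first.
  rewrite !indicE memNset ?memNset => [||[]]//; last by case.
  rewrite subrr (_ : (fun m => _) = (fun=> 0)); first exact: cvg_cst.
  by apply/funext => m; rewrite derive_cell_field_out// => /open_box_sub.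
have xo : open_box p x by apply: contrapT => xo; exact: xp.
have [xlt|xgt] := ltP (x 0 i) (mid p i).
  rewrite !indicE mem_set; last by split => //=; exact: ltW.
  rewrite memNset; last by move=> [_] /=; lra.
  rewrite subr0; apply: cvg_near_cst.
  apply: filterS3 (near_bump_in xo) (near_mulSn_ge 1 (_ : 0 < mid p i - x 0 i))
    (near_mulSn_ge 2 (_ : 0 < (p.2 0 i - p.1 0 i) / 2 - (mid p i - x 0 i))).
  - move=> m Hm h1 h2; rewrite derive_cell_field dtent_left// mul1r big1// => j _.
    by have [? ?] := Hm j; exact: bump_in.
  - by rewrite subr_gt0.
  - by have := xo i; rewrite /mid; lra.
have {}xgt : mid p i < x 0 i by rewrite lt_def xgt andbT; exact/eqP.
rewrite !indicE memNset; last by move=> [_] /=; lra.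
rewrite mem_set//.
rewrite sub0r; apply: cvg_near_cst.
apply: filterS3 (near_bump_in xo) (near_mulSn_ge 1 (_ : 0 < x 0 i - mid p i))
  (near_mulSn_ge 2 (_ : 0 < (p.2 0 i - p.1 0 i) / 2 - (x 0 i - mid p i))).
- move=> m Hm h1 h2; rewrite derive_cell_field dtent_right// big1 ?mulr1// => j _.
  by have [? ?] := Hm j; exact: bump_in.
- by rewrite subr_gt0.
- by have := xo i; rewrite /mid; lra.
Qed.

Lemma box_sub_cube p : exists2 r : R, 0 < r & box p `<=` box (cube r).
Proof.
pose r := 1 + \sum_j (`|p.1 0 j| + `|p.2 0 j|).
exists r; first by rewrite ltr_wpDr// sumr_ge0// => j _; rewrite addr_ge0.
move=> x xp j; have := xp j; rewrite !mxE.
have : `|p.1 0 j| + `|p.2 0 j| < r.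
  rewrite /r (bigD1 j)//= addrCA ltrDl ltr_wpDr// sumr_ge0// => l _;
    exact: addr_ge0.
have := ler_norm (p.2 0 j); have := lerNnormlW (lexx `|p.1 0 j|).
have := normr_ge0 (p.1 0 j); have := normr_ge0 (p.2 0 j).
by move: (`|_|) (`|_|) => *; lra.
Qed.

End cell_fields.

(** * Perimeter bounds: the halving estimate and the cost of a cube *)

Section perimeter_estimates.
Context {R : realType} {n : nat}.
Implicit Types (p D : 'rV[R]_n * 'rV[R]_n) (E : set 'rV[R]_n).
Implicit Types (s : seq ('rV[R]_n * 'rV[R]_n)) (w : 'I_n ->
  R) (k : R) (x : 'rV[R]_n).
Implicit Types (i j : 'I_n).
Local Notation mu := (@lebesgue_n R n).
Local Notation T := (lebesgueType R n).

Definition half_diff E i p : R :=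
  volume (E `&` box (lower_half i p)) - volume (E `&` box (upper_half i p)).

Lemma integral_half_diff E i p (a : R) : lebesgue_measurable E ->
  (\int[mu]_(x in E) (a * (\1_(box (lower_half i p)) x - \1_(box (upper_half i
    p)) x))%:E
   = (a * half_diff E i p)%:E)%E.
Proof.
move=> mE.
have i1 := integrable_indic_box (lower_half i p) mE.
have i2 := integrable_indic_box (upper_half i p) mE.
under eq_integral do rewrite EFinM.
rewrite integralZl; [|exact: mE|exact: (integrableB _ i1 i2)].
rewrite integralB_EFin; [|exact: mE|exact: i1|exact: i2].
have e q : (\int[mu]_(x in E) (\1_(box q) x)%:E = (volume (E `&` box q))%:E)%E.
  rewrite (integral_indic _ (mE : measurable (E : set T)) (measurable_box q)).
  by rewrite (@volumeE _ _ q) => [|x []//]; rewrite setIC.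
by rewrite [X in (X - _)%E]e [X in (_ - X)%E]e -EFinB -EFinM.
Qed.

(* Test field: on each box, a signed tent in direction i, cut off in the other
   directions.  The boxes being disjoint, it is bounded by the half width w i / 2
   of the tent, and its divergence tends to the signed difference of the
   indicators of the two halves. *)
Lemma half_diff_le_perimeter D w s i E : tiling D w s -> lebesgue_measurable E ->
  ((\sum_(p <- s) `|half_diff E i p|)%:E <= (w i / 2)%:E * perimeter E)%E.
Proof.
move=> Ds mE; pose r := w i / 2.
have w0 := tiling_w0 Ds; have r0 : 0 < r by rewrite divr_gt0.
pose c p := Num.sg (half_diff E i p) / r.
pose f m x := \sum_(p <- s) c p * cell_field m.+1%:R i p x.
have C1c m p : scalar_C1 (fun x => c p * cell_field m.+1%:R i p x).
  by apply: scalar_C1M; [exact: scalar_C1_cst|exact: scalar_C1_cell_field].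
have C1f m : scalar_C1 (f m) by apply: scalar_C1_sum.
have c1 p : `|c p| <= r^-1.
  rewrite /c normrM normrV ?unitfE ?gt_eqF// (gtr0_norm r0) ler_piMl ?invr_ge0
    ?(ltW r0)//.
  by rewrite normr_sg; case: (_ != _).
have fD m x : `|f m x| <= \1_(box D) x.
  rewrite -(tiling_indic Ds); apply: (le_trans (ler_norm_sum _ _ _)).
  rewrite big_seq [leRHS]big_seq; apply: ler_sum => p ps.
  have wp := tiling_widths Ds ps.
  have pi : p.1 0 i <= p.2 0 i by rewrite -subr_ge0 wp ltW.
  have := @normr_cell_field _ _ m.+1%:R i p x (ltr0Sn _ _) pi;
    rewrite wp -/r => h.
  rewrite normrM; apply: (le_trans (ler_pM _ _ (c1 p) h)) => //.
  by rewrite mulrA mulVf ?mul1r// gt_eqF.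
have [q q0 Dq] := box_sub_cube D.
have tf m : test_field (fun x => f m x *: basis_vec i).
  apply: (@test_field_axis _ _ _ _ q (C1f m)) => [x xq|x].
    apply/eqP; rewrite -normr_le0; apply: le_trans (fD m x) _.
    by rewrite indicE memNset// => /Dq.
  by apply: (le_trans (fD m x)); rewrite indicE; case: (_ \in _).
pose g x : R := \sum_(p <- s) c p * (\1_(box (lower_half i p)) x - \1_(box
  (upper_half i p)) x).
have df m x : 'D_(basis_vec i) (f m) x = \sum_(p <- s) c p * 'D_(basis_vec i)
  (cell_field m.+1%:R i p) x.
  rewrite derive_sum_seq//; apply: eq_bigr => p _.
  have [_ ->] := is_derive_scalarM i x (scalar_C1_cst (c p))
    (scalar_C1_cell_field m.+1%:R i p).
  by rewrite (@derive_cst _ _ _ (c p)) mulr0 addr0.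
have dfD m : dominated (r^-1 * 9) D ('D_(basis_vec i) (f m)).
  move=> x; rewrite df -(tiling_indic Ds) mulr_sumr;
    apply: (le_trans (ler_norm_sum _ _ _)).
  apply: ler_sum => p _; rewrite normrM -mulrA; apply: ler_pM => //.
  exact: normr_derive_cell_field.
have mg : measurable_fun [set: T] (g : T -> R).
  apply: measurable_sum => p; apply: measurable_funM; first exact: measurable_cst.
  by apply: measurable_funB; exact: (measurable_indic (measurable_box _)).
pose N := \bigcup_(p in [set` s]) ((box p `\` open_box p) `|` [set x : 'rV[R]_n
  | x 0 i = mid p i]).
have N0 : mu N = 0%E.
  apply/le_anti; rewrite measure_ge0 andbT.
  apply: (le_trans (lebesgue_outer_bigcup_esum _ (finite_set_countable
    (finite_seq s)))).
  rewrite esum1// => p _; apply/le_anti; rewrite lebesgue_outer_ge0 andbT.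
  apply: (le_trans (outer_measureU2 (lebesgue_outer_measure R n) _ _)).
  by rewrite [X in (X + _)%E](negligible_faces p) [X in (_ +
    X)%E](lebesgue_hyperplane0 i (mid p i)) adde0.
have cg x : ~ N x -> 'D_(basis_vec i) (f m) x @[m --> \oo] --> g x.
  move=> xN; rewrite (_ : (fun m => _) = (fun m => \sum_(p <- s | p \in s)
    c p * 'D_(basis_vec i) (cell_field m.+1%:R i p) x)); last first.
    by apply/funext => m; rewrite df big_seq.
  rewrite /g big_seq.
  apply: cvg_big => [|p ps]; first exact: add_continuous.
  apply: cvgM; first exact: cvg_cst.
  have wp := tiling_widths Ds ps.
  apply: cvg_derive_cell_field; first by rewrite -subr_gt0 wp.
    by move=> xp; apply: xN; exists p => //; left.
  by move=> xp; apply: xN; exists p => //; right.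
have := @dominated_cvg _ _ _ D _ g N E mE
  (fun m => continuous_lebesgue_measurable (C1f m i).2) mg dfD N0 cg.
have -> : (\int[mu]_(x in E) (g x)%:E = (r^-1 * \sum_(p <- s) `|half_diff E i
  p|)%:E)%E.
  rewrite /g; under eq_integral do rewrite -sumEFin.
  rewrite integral_sum; [|exact: mE|].
    rewrite mulr_sumr -sumEFin; apply: eq_bigr => p _;
      rewrite integral_half_diff//.
    by rewrite /c [Num.sg _ / r]mulrC -mulrA -normrEsg.
  move=> p; have i1 := integrable_indic_box (lower_half i p) mE.
  have i2 := integrable_indic_box (upper_half i p) mE.
  exact: (integrableZl mE (c p) (integrableB _ i1 i2)).
move=> cvgg.
have : ((r^-1 * \sum_(p <- s) `|half_diff E i p|)%:E <= perimeter E)%E.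
  rewrite -(cvg_lim _ cvgg)//; apply: lime_le; first by apply/cvg_ex; eexists;
    exact: cvgg.
  apply: nearW => m; apply: (le_trans _ (perimeter_ub E (tf m))).
  by under [leRHS]eq_integral do rewrite divergence_axis//.
move=> /(lee_wpmul2l (_ : 0 <= r%:E)%E) h; have := h (ltW r0 : (0 <= r%:E)%E).
by rewrite -EFinM mulrA divff ?mul1r// gt_eqF.
Qed.

Lemma eucl_normZ (a : R) x : eucl_norm (a *: x) = `|a| * eucl_norm x.
Proof.
rewrite /eucl_norm -sqrtr_sqr -sqrtrM ?sqr_ge0//; congr Num.sqrt.
by rewrite mulr_sumr; apply: eq_bigr => j _; rewrite mxE exprMn.
Qed.

Lemma normr_coord_le_eucl_norm x i : `|x 0 i| <= eucl_norm x.
Proof.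
rewrite /eucl_norm -sqrtr_sqr ler_wsqrtr// (bigD1 i)//= lerDl.
by apply: sumr_ge0 => j _; exact: sqr_ge0.
Qed.

Lemma test_field_cutoff (eta : 'rV[R]_n -> R) phi : scalar_C1 eta ->
  (forall x, 0 <= eta x <= 1) -> test_field phi ->
    test_field (fun x => eta x *: phi x).
Proof.
move=> C1e e01 [C1phi cphi phi1]; split.
- apply: coord_C1 => j; rewrite (_ : (fun x => _) = (fun x => eta x * phi x 0
  j)); last first.
    by apply/funext => x; rewrite mxE.
  by apply: scalar_C1M => //; exact: C1_coord.
- have [r r0 phi0] := compact_support_cube cphi.
  by apply: (@cube_compactly_supported _ _ _ r) => x /phi0 ->; rewrite scaler0.
- move=> x; rewrite eucl_normZ; have /andP[e0 e1] := e01 x.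
  by rewrite mulr_ile1 ?sqrtr_ge0// ger0_norm.
Qed.

Lemma divergence_scalarM (eta : 'rV[R]_n -> R) phi x : scalar_C1 eta -> C1 phi ->
  divergence (fun x => eta x *: phi x) x =
  eta x * divergence phi x + \sum_i phi x 0 i * 'D_(basis_vec i) eta x.
Proof.
move=> C1e /C1_coord C1phi; rewrite /divergence mulr_sumr -big_split /=.
apply: eq_bigr => i _.
have [_ <-] := is_derive_scalarM i x C1e (C1phi i).
by congr ('D_ _ _ x); apply/funext => y; rewrite mxE.
Qed.

Lemma dominated_derive_box_bump (m : nat) p i :
  dominated (2 * m.+1%:R) p ('D_(basis_vec i) (box_bump m.+1%:R p)).
Proof.
move=> x; set k := m.+1%:R; have k0 : 0 < k by rewrite ltr0Sn.
have [xp|xp] := pselect (open_box p x); last first.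
  by rewrite derive_box_bump_out// normr0 mulr_ge0 ?indicE// mulr_ge0// ltW.
rewrite indicE mem_set ?mulr1; last exact: open_box_sub.
rewrite derive_box_bump normrM; apply: le_trans (normr_dbump (p.1 0 i) (p.2 0
  i) (x 0 i) (ltW k0)).
by rewrite ler_piMr// ger0_norm ?prodr_ile1 ?prodr_ge0// => j _;
  rewrite ?bump_ge0 ?bump_le1.
Qed.

(** The derivative lives in two slabs of thickness [1 / k] along the faces orthogonal to direction
    [i], and its size there is at most [2 * k]: the product of thickness and size does not grow with
    [k]. *)
Lemma normr_derive_box_bump (m : nat) p i x :
  `|'D_(basis_vec i) (box_bump m.+1%:R p) x| <= 2 * m.+1%:R *
   (\1_(box (cut_below p i (p.1 0 i + m.+1%:R^-1))) x +
    \1_(box (cut_above p i (p.2 0 i - m.+1%:R^-1))) x).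
Proof.
set k := m.+1%:R; have k0 : 0 < k by rewrite ltr0Sn.
have ind0 q : 0 <= \1_(box q) x :> R by rewrite indicE.
have [xp|xp] := pselect (open_box p x); last first.
  by rewrite derive_box_bump_out// normr0 mulr_ge0 ?addr_ge0// mulr_ge0// ltW.
have Dk : `|'D_(basis_vec i) (box_bump k p) x| <= 2 * k.
  have := @dominated_derive_box_bump m p i x.
  by rewrite indicE mem_set ?mulr1//; exact: open_box_sub.
have [x1|x1] := leP (x 0 i) (p.1 0 i + k^-1).
  apply: (le_trans Dk); rewrite ler_peMr ?mulr_ge0 ?(ltW k0)//.
  rewrite [X in _ <= X + _]indicE mem_set ?lerDl// => j; have := xp j.
  by rewrite /= mxE; case: eqP => [->|_] /andP[h1 h2]; rewrite h1 ?x1 ?ltW.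
have [x2|x2] := ltP (p.2 0 i - k^-1) (x 0 i).
  apply: (le_trans Dk); rewrite ler_peMr ?mulr_ge0 ?(ltW k0)//.
  rewrite [X in _ <= _ + X]indicE mem_set ?lerDr// => j; have := xp j.
  by rewrite /= mxE; case: eqP => [->|_] /andP[h1 h2]; rewrite ?x2 ?h1 ltW.
rewrite derive_box_bump dbump_in ?mul0r ?normr0.
- by rewrite mulr_ge0 ?addr_ge0// mulr_ge0// ltW.
- by rewrite mulrC -ler_pdivrMr// mul1r lerBrDr addrC ltW.
- by rewrite mulrC -ler_pdivrMr// mul1r lerBrDr addrC -lerBrDr.
Qed.

Lemma dominatedM (M : R) D (g h : 'rV[R]_n -> R) : dominated M D h ->
  (forall x, `|g x| <= 1) -> dominated M D (fun x => g x * h x).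
Proof.
move=> hM g1 x; rewrite normrM; apply: le_trans (hM x).
by rewrite ler_piMl.
Qed.

(** Two slabs, each of volume [k^-1 * w ^+ n.-1], on which the integrand is at most [2 * k]; the
    bound is uniform in [m]. *)
Lemma integral_flux_box_bump_le (m : nat) p i (w : R) phi E : 0 < w ->
  widths (fun=> w) p ->
  test_field phi -> lebesgue_measurable E ->
  (\int[mu]_(x in E) (phi x 0 i * 'D_(basis_vec i) (box_bump m.+1%:R p) x)%:E
   <= (4 * w ^+ n.-1)%:E)%E.
Proof.
move=> w0 wp [C1phi cphi phi1] mE; set k := m.+1%:R;
  have k0 : 0 < k by rewrite ltr0Sn.
pose A := cut_below p i (p.1 0 i + k^-1);
  pose B := cut_above p i (p.2 0 i - k^-1).
have phi1' x : `|phi x 0 i| <= 1 by exact: le_trans (normr_coord_le_eucl_norm _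
  _) (phi1 x).
have cphi' := scalar_C1_continuous (C1_coord C1phi i).
have i1 : mu.-integrable E (EFin \o (fun x => phi x 0 i * 'D_(basis_vec i)
  (box_bump k p) x) : T -> \bar R).
  apply: (integrable_dominated mE _ (dominatedM (@dominated_derive_box_bump m p
    i) phi1')).
  apply: measurable_funM; first exact: (continuous_lebesgue_measurable cphi').
  exact: (continuous_lebesgue_measurable (scalar_C1_box_bump k p i).2).
have iA := integrable_indic_box A mE; have iB := integrable_indic_box B mE.
have i2 := integrableZl mE (2 * k) (integrableD mE iA iB).
have e q : (\int[mu]_(x in E) (\1_(box q) x)%:E <= (box_volume q)%:E)%E.
  rewrite (integral_indic _ (mE : measurable (E : set T)) (measurable_box q)).
  apply: le_trans (lebesgue_outer_box q); apply: le_lebesgue_outer.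
  exact: subIsetl.
apply: (@le_trans _ _ (\int[mu]_(x in E) ((2 * k)%:E * ((\1_(box A) x)%:E +
  (\1_(box B) x)%:E)))%E).
  apply: le_integral; [exact: mE|exact: i1|exact: i2|].
  move=> x _; rewrite -EFinD -EFinM lee_fin; apply: (le_trans (ler_norm _)).
  rewrite normrM; apply: le_trans (normr_derive_box_bump m p i x).
  by rewrite ler_piMl.
rewrite integralZl; [|exact: mE|exact: (integrableD mE iA iB)].
rewrite integralD; [|exact: mE|exact: iA|exact: iB].
have pw (P : pred 'I_n) : \prod_(j < n | P j) Num.max 0 (p.2 0 j - p.1 0 j) =
  \prod_(j < n | P j) w.
  by apply: eq_bigr => j _; rewrite wp max_r// ltW.
have vA : box_volume A = k^-1 * w ^+ n.-1.
  rewrite box_volume_cut_below addrC addKr max_r ?invr_ge0 ?(ltW k0)// pw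
    prodr_const; congr (_ * _ ^+ _).
  by rewrite cardC1 card_ord.
have vB : box_volume B = k^-1 * w ^+ n.-1.
  rewrite box_volume_cut_above opprB addrC subrK max_r ?invr_ge0 ?(ltW k0)// pw
    prodr_const; congr (_ * _ ^+ _).
  by rewrite cardC1 card_ord.
apply: (@le_trans _ _ ((2 * k)%:E * ((box_volume A)%:E + (box_volume B)%:E))%E).
  by apply: lee_wpmul2l; [rewrite lee_fin mulr_ge0// ltW|apply: leeD; exact: e].
rewrite -EFinD -EFinM lee_fin vA vB le_eqVlt; apply/orP; left; apply/eqP.
by field; rewrite gt_eqF.
Qed.

(** Multiply [phi] by [zeta = 1 - box_bump]. By the product rule, [zeta * div phi] is the divergence
    of the test field [zeta *: phi], whose integral over [E] is at most its perimeter, plus [n] flux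
    terms bounded uniformly in [m]. As [m] grows, [zeta] tends to the indicator of the complement of
    the box. *)
Lemma perimeter_setD_box E p (w : R) : 0 < w -> widths (fun=> w) p ->
  lebesgue_measurable E ->
  (perimeter (E `\` box p) <= perimeter E + (n%:R * (4 * w ^+ n.-1))%:E)%E.
Proof.
move=> w0 wp mE; apply: ge_ereal_sup => _ [phi tphi <-].
have [C1phi cphi phi1] := tphi.
have [r [M [r0 _ cdiv HM]]] := test_field_divergence tphi.
pose zeta (m : nat) x := 1 + - box_bump m.+1%:R p x.
have C1z m : scalar_C1 (zeta m).
  by apply: scalar_C1D; [exact:
    scalar_C1_cst|exact/scalar_C1N/scalar_C1_box_bump].
have z01 m x : 0 <= zeta m x <= 1.
  by have := box_bump_ge0 m.+1%:R p x; have := box_bump_le1 m.+1%:R p x;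
    rewrite /zeta; lra.
have z1 m x : `|zeta m x| <= 1 by have /andP[? ?] := z01 m x; rewrite ger0_norm.
have tz m := test_field_cutoff (C1z m) (z01 m) tphi.
have Dz m i x : 'D_(basis_vec i) (zeta m) x = - 'D_(basis_vec i) (box_bump
  m.+1%:R p) x.
  have [_ H] := is_deriveB (is_derive_cst (1 : R) x (basis_vec i)) (scalar_C1P
    i x (scalar_C1_box_bump m.+1%:R p)).
  by rewrite -[LHS]/('D_(basis_vec i) (cst 1 - box_bump m.+1%:R p) x) H sub0r.
have zE m x : zeta m x * divergence phi x = divergence (fun x => zeta m x *:
  phi x) x +
    \sum_i phi x 0 i * 'D_(basis_vec i) (box_bump m.+1%:R p) x.
  rewrite divergence_scalarM// -addrA -big_split /= big1 ?addr0// => i _.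
  by rewrite Dz mulrN addNr.
have mz m : measurable_fun [set: T] ((fun x => zeta m x * divergence phi x) : T
  -> R).
  apply: measurable_funM; last exact: (continuous_lebesgue_measurable cdiv).
  exact: (continuous_lebesgue_measurable (scalar_C1_continuous (C1z m))).
have mg : measurable_fun [set: T] ((fun x => (\1_(~` box p) x) * divergence phi
  x) : T -> R).
  apply: measurable_funM; last exact: (continuous_lebesgue_measurable cdiv).
  exact: (measurable_indic (measurableC (measurable_box p))).
have cz x : ~ (box p `\` open_box p) x ->
    zeta m x * divergence phi x @[m --> \oo] -->
      \1_(~` box p) x * divergence phi x.
  move=> xp; apply: cvgM; last exact: cvg_cst.
  rewrite indicC /= (_ : (x \notin box p)%:R = 1 - \1_(box p) x); last first.
    by rewrite indicE; case: (_ \in _) => /=; rewrite ?subrr ?subr0.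
  by apply: cvgB; [exact: cvg_cst|exact: cvg_box_bump].
have := @dominated_cvg _ _ M (cube r) _ _ (box p `\` open_box p) E mE mz mg
  (fun m => dominatedM HM (z1 m)) (negligible_faces p) cz.
have -> : (\int[mu]_(x in E) (\1_(~` box p) x * divergence phi x)%:E =
    \int[mu]_(x in E `\` box p) (divergence phi x)%:E)%E.
  rewrite setDE integral_mkcondr; apply: eq_integral => x _.
  by rewrite patchE indicE; case: (_ \in _); rewrite ?mul1r ?mul0r.
move=> cvgg; rewrite -(cvg_lim _ cvgg)//; apply: lime_le;
  first by apply/cvg_ex; eexists; exact: cvgg.
apply: nearW => m.
have iphi i : mu.-integrable E (fun x : T => (phi x 0 i * 'D_(basis_vec i)
  (box_bump m.+1%:R p) x)%:E).
  have phi1' x : `|phi x 0 i| <= 1 by exact: le_trans (normr_coord_le_eucl_norm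
    _ _) (phi1 x).
  apply: (integrable_dominated mE _ (dominatedM (@dominated_derive_box_bump m p
    i) phi1')).
  apply: measurable_funM; first exact: (continuous_lebesgue_measurable
    (scalar_C1_continuous (C1_coord C1phi i))).
  exact: (continuous_lebesgue_measurable (scalar_C1_box_bump m.+1%:R p i).2).
have -> : (\int[mu]_(x in E) (zeta m x * divergence phi x)%:E =
    \int[mu]_(x in E) ((divergence (fun x => zeta m x *: phi x) x)%:E +
      \sum_(i < n) (phi x 0 i * 'D_(basis_vec i) (box_bump m.+1%:R p) x)%:E))%E.
  by apply: eq_integral => x _; rewrite zE EFinD sumEFin.
rewrite integralD; [|exact: mE|exact: (integrable_divergence (tz m) mE)|].
  apply: leeD; first exact: perimeter_ub (tz m).
  rewrite integral_sum; [|exact: mE|exact: iphi].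
  apply: (@le_trans _ _ (\sum_(i < n) (4 * w ^+ n.-1)%:E)%E).
    by apply: lee_sum => i _; exact: integral_flux_box_bump_le.
  by rewrite sumEFin lee_fin sumr_const card_ord -[_ *+ n]mulr_natl.
exact: (integrable_sum mE).
Qed.

End perimeter_estimates.

(** * Compactness *)

Section compactness.
Context {R : realType} {n : nat}.
Implicit Types (p D : 'rV[R]_n * 'rV[R]_n) (A B E F O : set 'rV[R]_n).
Local Notation mu := (@lebesgue_n R n).
Local Notation T := (lebesgueType R n).

Lemma perimeter_halving_bound D E (L : R) : lebesgue_measurable E ->
  (perimeter E <= L%:E)%E -> halving_bound (L / 2) D E.
Proof.
move=> mE EL w s i Ds.
have w0 := tiling_w0 Ds i.
have := half_diff_le_perimeter i Ds mE.
have : ((w i / 2)%:E * perimeter E <= (w i / 2)%:E * L%:E)%E.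
  by apply: lee_wpmul2l => //; rewrite lee_fin divr_ge0// ltW.
rewrite -EFinM => h1 h2; have := le_trans h2 h1; rewrite lee_fin.
by rewrite mulrAC -mulrA.
Qed.

(** At a point of the symmetric difference, membership changes between some consecutive [F (m + k)]
    and [F (m + k).+1]. Such a change has measure at most [3/2 * 2^-1 ^+ (m + k)], which is below
    [4 * 2^-1 ^+ m / 2 ^ k.+1], the form that [epsilon_trick0] sums. *)
Lemma symdiff_limsup_le (F : nat -> set 'rV[R]_n) :
  (forall i j, mu (symdiff (F i) (F j)) <= (2^-1 ^+ i + 2^-1 ^+ j)%:E)%E ->
  forall m, (mu (symdiff (\bigcap_k \bigcup_(j in [set j | (k <= j)%N]) F j) (F
    m)) <= (4 * 2^-1 ^+ m)%:E)%E.
Proof.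
move=> HF m; set E := \bigcap_k _.
have sub : symdiff E (F m) `<=` \bigcup_k symdiff (F (m + k)%N) (F (m + k).+1).
  move=> x H; have [j [mj Hj]] : exists j, (m <= j)%N /\ ~ (F m x <-> F j x).
    case: H => -[].
      move=> Ex Fx; have [j /= mj Fj] := Ex m I.
      by exists j; split => // -[_ /(_ Fj)].
    move=> Fx Ex; have [k Hk] : exists k, ~ (\bigcup_(j in [set j | (k <=
      j)%N]) F j) x.
      by apply: contrapT => H; apply: Ex => k _; apply: contrapT => Hk;
        apply: H; exists k.
    exists (maxn m k); split; first exact: leq_maxl.
    by move=> [/(_ Fx) H _]; apply: Hk; exists (maxn m k) => //=; exact: leq_maxr.
  have [d dj] : exists d, j = (m + d)%N by exists (j - m)%N; rewrite subnKC.
  move: Hj; rewrite dj => {dj mj H}; elim: d => [|d IH] Hd; first by exfalso;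
    apply: Hd; rewrite addn0.
  have [h|/IH//] := pselect (F m x <-> F (m + d)%N x).
  exists d => //; rewrite -addnS; apply: contrapT => H; apply: Hd.
  by rewrite h; split => Fx; apply: contrapT => Fx'; apply: H; [left|right].
apply: le_trans (le_lebesgue_outer sub) _.
apply: le_trans (lebesgue_outer_sigma_subadditive _) _.
apply: le_trans (epsilon_trick0 xpredT _).
  apply: lee_nneseries => [k _ _|k _]; first exact: lebesgue_outer_ge0.
  apply: le_trans (HF _ _) _; rewrite lee_fin natrX exprS exprD.
  rewrite -exprVn exprS.
  have : 0 < 2^-1 ^+ m * 2^-1 ^+ k :> R by rewrite mulr_gt0// exprn_gt0.
  by move: (2^-1 ^+ m) (2^-1 ^+ k) => a b ab; nra.
by rewrite mulr_ge0// exprn_ge0.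
Qed.

(** The pigeonhole principle for an ultrafilter; it stands in for successive extraction of
    subsequences. *)
Lemma ultra_finite (I : finType) (U : set_system nat) (S : I ->
  set nat) : UltraFilter U ->
  (forall k, exists i, S i k) -> exists i, U (S i).
Proof.
move=> UU HS; apply: contrapT => H.
have : U [set k | forall i, ~ S i k].
  apply: filter_forall => i.
  by have [US|] := in_ultra_setVsetC (S i) UU; [exfalso; apply: H; exists i|].
by move/filter_ex => [k Hk]; have [i /Hk] := HS k.
Qed.

(** An inequality on the perimeter, because only that passes to limits. The bounds [A] and [B] let
    one notion serve both problems: subsets of the closure of G, and sets between [G \ U] and
    [G]. *)
Definition constrained A B (L : R) : set (set 'rV[R]_n) :=
  [set E | [/\ lebesgue_measurable E, A `<=` E, E `<=` B & (perimeter E <=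
    L%:E)%E]].

Lemma constrained_compact D (w : R) A B (L : R) (F : nat -> set 'rV[R]_n) :
  0 < w -> widths (fun=> w) D -> 0 <= L ->
  lebesgue_measurable A -> lebesgue_measurable B -> A `<=` B -> B `<=` box D ->
  (forall k, constrained A B L (F k)) ->
  exists2 E, constrained A B L E & forall e N, 0 < e -> exists2 k, (N <= k)%N &
    (mu (symdiff E (F k)) <= e%:E)%E.
Proof.
move=> w0 wD L0 mA mB AB BD HF.
(* An ultrafilter U chooses, at each scale, one ball of the finite covering which
   contains F k for U-many k; the centres C form a Cauchy sequence. *)
have [U [UU UF]] := ultraFilterLemma (F := eventually) _.
have tb j : exists2 C, lebesgue_measurable C & U [set k | (mu (symdiff (F k) C)
  <= (2^-1 ^+ j)%:E)%E].
  have h0 : 0 < 2^-1 ^+ j :> R by rewrite exprn_gt0.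
  have [I [C [mC HC]]] := grid_totally_bounded (divr_ge0 L0 (ler0n _ 2)) w0 wD h0.
  have [i Ui] : exists i, U [set k | (mu (symdiff (F k) (C i)) <= (2^-1 ^+
    j)%:E)%E].
    apply: ultra_finite => k; have [mF _ FB FL] := HF k.
    by apply: HC => //; [exact: subset_trans FB BD|exact:
      perimeter_halving_bound].
  by exists (C i).
have {tb} /choice[C HC] : forall j, exists C, lebesgue_measurable C /\
    U [set k | (mu (symdiff (F k) C) <= (2^-1 ^+ j)%:E)%E].
  by move=> j; have [C] := tb j; exists C.
have UP : ProperFilter U := @ultra_proper _ _ UU.
have CC i j : (mu (symdiff (C i) (C j)) <= (2^-1 ^+ i + 2^-1 ^+ j)%:E)%E.
  have [k [ki kj]] := filter_ex (filterI (HC i).2 (HC j).2).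
  apply: le_trans (symdiff_triangle (F k) _ _) _; rewrite EFinD;
    apply: leeD => //.
  by rewrite symdiffC.
pose E0 := \bigcap_k \bigcup_(j in [set j | (k <= j)%N]) C j.
have mE0 : lebesgue_measurable E0.
  apply: (@bigcapT_measurable _ T) => k; apply: (@bigcup_measurable _ T) => j _.
  exact: (HC j).1.
(* Restores the inclusions without moving away from any [F k], since [A] is in [F k] and [F k] in
   [B]. *)
pose E := (E0 `|` A) `&` B.
have mE : lebesgue_measurable E.
  by apply: (@measurableI _ T) => //; exact: (@measurableU _ T).
have EF e N : 0 < e -> exists2 k, (N <= k)%N & (mu (symdiff E (F k)) <= e%:E)%E.
  move=> e0.
  (* 5 = 4 + 1: from the limit to [C m] by [symdiff_limsup_le], then from [C m] to [F k]. *)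
  have [m Hm] : exists m, 5 * 2^-1 ^+ m <= e.
    exists (Num.truncn (5 / e)).+1; rewrite exprVn ler_pdivrMr ?exprn_gt0//
      mulrC -ler_pdivrMr//.
    by apply/ltW/(lt_trans (truncnS_gt _)); rewrite -natrX ltr_nat ltn_expl.
  have UN : U [set k | (N <= k)%N] by apply: UF; exists N.
  have [k [kN km]] := filter_ex (filterI UN (HC m).2).
  exists k => //; apply: (@le_trans _ _ (mu (symdiff E0 (F k)))).
    have [_ AF FB _] := HF k.
    apply: (@le_lebesgue_outer R n) => x [[[[E0x|/AF//] Bx] Fx]|[Fx Ex]];
      first by left.
    by right; split => // E0x; apply: Ex; split; [left|exact: FB].
  apply: (le_trans (symdiff_triangle (C m) _ _)).
  apply: (@le_trans _ _ ((4 * 2^-1 ^+ m)%:E + (2^-1 ^+ m)%:E)%E).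
    by apply: leeD; [exact: symdiff_limsup_le|rewrite symdiffC].
  by rewrite -EFinD lee_fin; lra.
exists E => //; split => //.
- by move=> x Ax; split; [right|exact: AB].
- by move=> x [].
- apply: perimeter_lsc => // e e0; have [k _ Hk] := EF e 0%N e0.
  by exists (F k); have [? _ _ ?] := HF k.
Qed.

(** The direct method, with an abstract [J] so that it yields both a maximal and a minimal
    volume. *)
Lemma constrained_maximizer D (w : R) A B (L : R) (J : set 'rV[R]_n ->
  R) (M : R) :
  0 < w -> widths (fun=> w) D -> 0 <= L ->
  lebesgue_measurable A -> lebesgue_measurable B -> A `<=` B -> B `<=` box D ->
  constrained A B L !=set0 ->
  (forall E, constrained A B L E -> J E <= M) ->
  (forall E F, constrained A B L E -> constrained A B L F ->
    J F <= J E + volume (symdiff E F)) ->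
  exists2 E, constrained A B L E & forall F, constrained A B L F -> J F <= J E.
Proof.
move=> w0 wD L0 mA mB AB BD [X0 HX0] JM Jlip.
pose S := [set J E | E in constrained A B L].
have hsS : has_sup S.
  by split; [exists (J X0); exists X0|exists M => _ [E HE <-]; exact: JM].
have Sk k : exists E, constrained A B L E /\ sup S - k.+1%:R^-1 < J E.
  have k0 : 0 < k.+1%:R^-1 :> R by rewrite invr_gt0.
  by have [_ [E HE <-] ?] := sup_adherent k0 hsS; exists E.
have [F HF] := choice Sk.
have [E HE EF] := constrained_compact w0 wD L0 mA mB AB BD (fun k => (HF k).1).
exists E => // X HX; apply: (@le_trans _ _ (sup S)).
  by apply: sup_upper_bound => //; exists X.
apply/ler_addgt0Pr => e e0.
have e20 : 0 < e / 2 by rewrite divr_gt0.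
(* This lower bound on [k] makes [k.+1%:R^-1], the defect of [F k], at most [e / 2]. *)
have [k Nk Hk] := EF (e / 2) (Num.truncn (e / 2)^-1) e20.
have [_ _ EB _] := HE; have [_ _ FB _] := (HF k).1.
have SD : symdiff E (F k) `<=` box D by move=> x [[/EB/BD]|[/FB/BD]].
move: Hk; rewrite -(volumeE SD) lee_fin => Hk.
have ke : k.+1%:R^-1 <= e / 2.
  rewrite -[leRHS]invrK lef_pV2 ?posrE ?invr_gt0//; apply: ltW.
  by apply: (lt_le_trans (truncnS_gt _)); rewrite ler_nat ltnS.
have := Jlip _ _ HE (HF k).1; have := (HF k).2.
by move: ke; move: k.+1%:R^-1 => t; lra.
Qed.

Lemma volume_symdiff_lip D E F : E `<=` box D -> F `<=` box D ->
  lebesgue_measurable E -> lebesgue_measurable F ->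
  volume F <= volume E + volume (symdiff E F).
Proof.
move=> ED FD mE mF.
have SD : symdiff E F `<=` box D by move=> x [[/ED]|[/FD]].
apply: le_trans (volumeU_le ED SD); apply: (@le_volume _ _ D).
  by move=> x [/ED|/SD].
by move=> x Fx; have [Ex|Ex] := pselect (E x); [left|right; right].
Qed.

Lemma bigcup_null (I : choiceType) (S : set I) (A : I ->
  set 'rV[R]_n) : countable S ->
  (forall k, S k -> mu (A k) = 0%E) -> mu (\bigcup_(k in S) A k) = 0%E.
Proof.
move=> cS A0; apply/le_anti; rewrite measure_ge0 andbT.
apply: le_trans (lebesgue_outer_bigcup_esum _ cS) _.
by rewrite esum1.
Qed.

(** [O] is a countable union of arbitrarily fine cells; if [A] were null in each of them it would be
    null in [O]. *)
Lemma small_cell A O (d : R) : open O -> 0 < d -> mu (A `&` O) <> 0%E ->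
  exists p w, [/\ 0 < w, w <= d, widths (fun=> w) p, box p `<=` O & mu (A `&`
    box p) <> 0%E].
Proof.
move=> oO d0 AO; apply: contrapT => H; apply: AO.
have w0 j : 0 < 2 * j.+1%:R :> R by rewrite mulr_gt0.
(* Starting from grid [m0 j] makes every side at most [d]; skipping the coarser grids loses nothing,
   as their cells in [O] are covered by finer ones. *)
pose m0 j := (Num.truncn (2 * j.+1%:R / d)).+1.
have -> : A `&` O = \bigcup_j \bigcup_m (A `&` cells [set p | box p `<=` O]
  (grid (m + m0 j) (cube j.+1%:R))).
  apply/seteqP; split => x.
    move=> [Ax]; rewrite {1}(open_bigcup_cells oO) => -[j _ [m _ xm]].
    exists j => //; exists m => //; split => //; move: xm.
    exact: (cells_grid (fun=> w0 j) (widths_cube _) (leq_addr _ _)).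
  by move=> [j _ [m _ [Ax [p [_ /= pO] px]]]]; split => //; exact: pO.
apply: bigcup_null => [|j _]; first exact: countableP.
apply: bigcup_null => [|m _]; first exact: countableP.
rewrite /cells setI_bigcupr; apply: bigcup_null.
  by apply: finite_set_countable; apply: finite_setIl; exact: finite_seq.
move=> p [/= ps pO]; apply: contrapT => Ap; apply: H.
have tg := @tiling_grid R n (cube j.+1%:R) _ (m + m0 j) (fun=> w0 j)
  (widths_cube j.+1%:R).
exists p, (2 * j.+1%:R / 2 ^+ (m + m0 j)); split => //.
- rewrite ler_pdivrMr ?exprn_gt0// [leRHS]mulrC -ler_pdivrMr//.
  apply: ltW; apply: (lt_trans (truncnS_gt _)); rewrite -natrX ltr_nat.
  by apply: (leq_trans (ltn_expl (m0 j) (leqnn 2))); rewrite leq_exp2l// leq_addl.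
- exact: (tiling_widths tg ps).
Qed.

End compactness.

(** * Existence and non-existence *)

Section existence.
Context {R : realType} {n : nat}.
Implicit Types (p D : 'rV[R]_n * 'rV[R]_n) (A B E F G U : set 'rV[R]_n).
Local Notation mu := (@lebesgue_n R n).
Local Notation T := (lebesgueType R n).

Lemma bounded_closure_cube G : bounded_set G ->
  exists2 r : R, 0 < r & closure G `<=` box (cube r).
Proof.
move=> [M [_ HM]]; pose r := Num.max M 0 + 1.
have Mr : M < r by rewrite ltr_pwDr// le_max lexx.
have r0 : 0 < r by rewrite ltr_wpDl// le_max lexx orbT.
exists (r + 1); first by rewrite addr_gt0.
apply: subset_trans (@closed_cube_sub_box_cube _ _ r).
apply: closure_sub_closed_cube => x Gx i; rewrite /= in_itv /= -ler_norml.
exact: le_trans (normr_coord_le x i) (HM r Mr x Gx).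
Qed.

(** Since [2 <= n], [w ^+ n.-1 <= w] for [w <= 1], so small cubes fit into any slack in the
    perimeter. *)
Lemma perimeter_cube_gap (L : R) E : (2 <= n)%N -> (perimeter E < L%:E)%E ->
  exists2 d : R, 0 < d & forall w : R, 0 < w -> w <= d ->
    (perimeter E + (n%:R * (4 * w ^+ n.-1))%:E <= L%:E)%E.
Proof.
move=> n2 EL.
have Efin : perimeter E \is a fin_num.
  rewrite ge0_fin_numE; last exact: perimeter_ge0.
  by apply: (lt_trans EL); exact: ltry.
move: EL; rewrite -(fineK Efin); set l := fine _; rewrite lte_fin => lL.
exists (Num.min 1 ((L - l) / (n%:R * 4))).
  by rewrite lt_min ltr01 divr_gt0 ?subr_gt0// mulr_gt0// ltr0n ltnW.
move=> w w0; rewrite le_min => /andP[w1 wd].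
rewrite -EFinD lee_fin -lerBrDl mulrA.
apply: (@le_trans _ _ (n%:R * 4 * w)).
  apply: ler_wpM2l; first by rewrite mulr_ge0.
  rewrite -[leRHS]expr1; apply: ler_wiXn2l; [exact: ltW|exact: w1|].
  by rewrite -ltnS prednK// ltnW.
by rewrite mulrC -ler_pdivlMr// mulr_gt0// ltr0n ltnW.
Qed.

Lemma perimeter_setU_box E p (w : R) : 0 < w -> widths (fun=> w) p ->
  lebesgue_measurable E ->
  (perimeter (E `|` box p) <= perimeter E + (n%:R * (4 * w ^+ n.-1))%:E)%E.
Proof.
move=> w0 wp mE.
have mC : lebesgue_measurable (~` E) by exact: (measurableC (mE : measurable (E
  : set T))).
rewrite -(perimeter_setC mE).
have -> : perimeter (E `|` box p) = perimeter (~` E `\` box p).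
  rewrite -perimeter_setC; first by rewrite setCU setDE.
  by apply: (@measurableU _ T) => //; exact: measurable_box.
exact: perimeter_setD_box.
Qed.

Lemma volume_gt0 D A : A `<=` box D -> mu A <> 0%E -> 0 < volume A.
Proof.
move=> AD A0; rewrite lt_def volume_ge0 andbT; apply/eqP => V0; apply: A0.
by rewrite -(volumeE AD) V0.
Qed.

(** The last clause speaks of open [O] inside [B], since the added cell must lie in [B] and [B] will
    be the closure of G. *)
Lemma max_volume_perimeter D (w : R) B (L : R) : (2 <= n)%N ->
  0 < w -> widths (fun=> w) D -> lebesgue_measurable B -> B `<=` box D ->
  0 <= L ->
  exists2 E, constrained set0 B L E & (forall F, constrained set0 B L F ->
    volume F <= volume E) /\
   (forall O, open O -> O `<=` B -> (perimeter E < L%:E)%E -> mu (O `\` E) = 0%E).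
Proof.
move=> n2 w0 wD mB BD L0.
have m0 : lebesgue_measurable (set0 : set 'rV[R]_n) by exact: (@measurable0 _ T).
have X0 : constrained set0 B L !=set0.
  by exists set0; split => //; rewrite perimeter_set0 lee_fin.
have [|E F [mE _ EB _] [mF _ FB _]|E HE maxE] :=
  @constrained_maximizer _ _ D w set0 B L volume (volume (box D)) w0 wD L0 m0
    mB (@sub0set _ B) BD X0.
- by move=> E [_ _ EB _]; apply: (@le_volume _ _ D) => //;
  exact: subset_trans EB BD.
- by apply: (@volume_symdiff_lip _ _ D) => //;
  [exact: subset_trans EB BD|exact: subset_trans FB BD].
exists E => //; split => // O oO OB EL; apply: contrapT => OE.
have [mE _ EB _] := HE.
have [d d0 Hd] := perimeter_cube_gap n2 EL.
have : mu (~` E `&` O) <> 0%E by rewrite setIC -setDE.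
move=> /(small_cell oO d0) [p [v [v0 vd pv pO Ep]]].
have pB : box p `<=` B by exact: subset_trans pO OB.
have HF : constrained set0 B L (E `|` box p).
  split => //.
  - by apply: (@measurableU _ T) => //; exact: measurable_box.
  - by move=> x [/EB|/pB].
  - exact: le_trans (perimeter_setU_box v0 pv mE) (Hd _ v0 vd).
have := maxE _ HF.
have mU : lebesgue_measurable (E `|` box p) by have [] := HF.
have UD : E `|` box p `<=` box D by move=> x [/EB/BD|/pB/BD].
rewrite (volume_setIDC UD mU mE) setUK setDUl setDv set0U setDE setIC => H.
have : 0 < volume (~` E `&` box p) by apply: (@volume_gt0 D) => // x [_ /pB/BD].
by lra.
Qed.

Lemma open_boundary_null G : open G -> mu (boundary G) = 0%E ->
  mu (closure G `\` G) = 0%E.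
Proof.
by move=> oG; have GE : interior G = G by [rewrite -interior_id];
  rewrite /boundary GE.
Qed.

Lemma exists_solution_P (G : set 'rV[R]_n) (L : R) : (2 <= n)%N -> open G ->
  bounded_set G ->
  mu (boundary G) = 0%E -> 0 <= L -> (L%:E < perimeter G)%E ->
  exists E, solution_P G L E.
Proof.
move=> n2 oG bG G0 L0 LG.
have [r r0 GD] := bounded_closure_cube bG.
have w0 : 0 < 2 * r by rewrite mulr_gt0.
have mcG : lebesgue_measurable (closure G) by apply: measurable_closed;
  exact: closed_closure.
have mG := measurable_open oG.
have [E [mE _ EG EL] [maxE HE]] := max_volume_perimeter n2 w0 (widths_cube r)
  mcG GD L0.
have GcG : G `<=` closure G by exact: subset_closure.
have perE : perimeter E = L%:E.
  apply/le_anti; rewrite EL /= leNgt; apply/negP => ltEL.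
  have GE0 := HE G oG GcG ltEL.
  suff EG0 : perimeter E = perimeter G by move: LG;
    rewrite -EG0 => /(lt_trans ltEL); rewrite ltxx.
  apply: perimeter_eq0 => //; apply/le_anti; rewrite measure_ge0 andbT.
  apply: le_trans (outer_measureU2 (lebesgue_outer_measure R n) _ _) _.
  (* The part of [E] outside [G] lies in the boundary. *)
  rewrite [X in (_ + X)%E]GE0 adde0 -(open_boundary_null oG G0).
  by apply: (@le_lebesgue_outer R n) => x [/EG].
exists E; split; first by split.
move=> F [mF FG perF]; rewrite -(volumeE (subset_trans EG GD)) -(volumeE
  (subset_trans FG GD)) lee_fin.
by apply: maxE; split => //; rewrite perF.
Qed.

(* U is the union of the lower halves of the m-fold refinement of D in direction
   i: removing it costs volume at most |D|, whereas the halving estimate at scale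
   w / 2 ^ m forces the perimeter to be at least 2 ^ m |D| / w. *)
Lemma comb_perimeter_gt G D (w L : R) (i : 'I_n) : open G -> 0 < w ->
  widths (fun=> w) D ->
  box D `<=` G -> mu (box D) <> 0%E ->
  exists U, [/\ open U, U `<=` box D & (L%:E < perimeter (G `\` U))%E].
Proof.
move=> oG w0 wD DG D0.
have VD := volume_gt0 (@subset_refl _ _) D0.
(* Chosen to contradict the halving estimate, which under [perimeter <= L] gives
   [volume (box D) / 2 <= w / 2 ^ m / 2 * L]. *)
have [m Hm] : exists m, w / 2 ^+ m * Num.max L 0 < volume (box D).
  exists (Num.truncn (w * Num.max L 0 / volume (box D))).+1.
  rewrite mulrAC ltr_pdivrMr ?exprn_gt0// [ltRHS]mulrC -ltr_pdivrMr//.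
  by apply: (lt_trans (truncnS_gt _)); rewrite -natrX ltr_nat ltn_expl.
pose s := refine (nseq m i) [:: D].
have Ds : tiling D (fun j => w / 2 ^+ count_mem j (nseq m i)) s.
  exact: (tiling_refine (nseq m i) (tiling1 (fun=> w0) wD)).
have wi : w / 2 ^+ count_mem i (nseq m i) = w / 2 ^+ m by rewrite count_nseq /=
  eqxx mul1n.
pose U := \bigcup_(p in [set` s]) open_box (lower_half i p).
have oU : open U by apply: bigcup_open => p _; exact: open_open_box.
have lowD p : p \in s -> box (lower_half i p) `<=` box p.
  by move=> ps; rewrite (box_lower_half i (tiling_w0 Ds) (tiling_widths Ds ps))
    => x [].
have upD p : p \in s -> box (upper_half i p) `<=` box p.
  by move=> ps; rewrite (box_upper_half i (tiling_w0 Ds) (tiling_widths Ds ps))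
    => x [].
have UD : U `<=` box D.
  move=> x [p /= ps /open_box_sub/(lowD p ps)]; exact: (tiling_sub Ds ps).
have mGU : lebesgue_measurable (G `\` U).
  by apply: (@measurableD _ T); exact: measurable_open.
exists U; split => //; rewrite ltNge; apply/negP => perL.
have := half_diff_le_perimeter i Ds mGU; rewrite wi.
(* In each box the lower half has been removed up to its faces and the upper half is intact, so the
   difference is half the box. *)
have -> : \sum_(p <- s) `|half_diff (G `\` U) i p| = volume (box D) / 2.
  have := volume_tiling Ds (measurable_box D); rewrite setIid => <-.
  rewrite mulr_suml big_seq [RHS]big_seq; apply: eq_bigr => p ps.
  have wp := tiling_widths Ds ps.
  have pD := tiling_sub Ds ps.
  have lu : volume (box (lower_half i p)) = volume (box (upper_half i p)).
    congr fine; exact: (eq_widths_measure (widths_lower_half i wp)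
      (widths_upper_half i wp)).
  rewrite (setIidr pD).
  have -> : volume (box p) = volume (box (lower_half i p)) + volume (box
    (upper_half i p)).
    rewrite (box_lower_half i (tiling_w0 Ds) wp) (box_upper_half i (tiling_w0
      Ds) wp).
    rewrite -[X in _ = _ + volume X]setDE -(@volume_setIDC _ _ p)//;
      first exact: measurable_box.
    exact: measurable_halfspace.
  rewrite /half_diff.
  have -> : volume ((G `\` U) `&` box (lower_half i p)) = 0.
    rewrite /volume (_ : mu _ = 0%E)//; apply/le_anti; rewrite measure_ge0 andbT.
    rewrite -(negligible_faces (lower_half i p)); apply: (@le_lebesgue_outer R n).
    by move=> x [[_ Ux] px]; split => // px'; apply: Ux; exists p.
  have -> : (G `\` U) `&` box (upper_half i p) = box (upper_half i p).
    apply: setIidr => x xu; split; first exact/DG/pD/(upD p ps).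
    move=> [q /= qs /open_box_sub xq].
    have pq := tiling_inj Ds ps qs (upD p ps _ xu) (lowD q qs _ xq).
    move: xu xq; rewrite -pq (box_upper_half i (tiling_w0 Ds) wp)
      (box_lower_half i (tiling_w0 Ds) wp).
    by move=> [_ xm] [].
  by rewrite lu sub0r normrN ger0_norm ?volume_ge0//; lra.
move=> H.
have : ((w / 2 ^+ m / 2)%:E * perimeter (G `\` U) <= (w / 2 ^+ m / 2)%:E *
  L%:E)%E.
  by apply: lee_wpmul2l => //; rewrite lee_fin !divr_ge0 ?exprn_ge0// ltW.
move=> /(le_trans H); rewrite -EFinM lee_fin.
have : w / 2 ^+ m * L <= w / 2 ^+ m * Num.max L 0.
  by apply: ler_wpM2l; [rewrite divr_ge0 ?exprn_ge0// ltW|rewrite le_max lexx].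
by move: (w / 2 ^+ m) Hm => a; nra.
Qed.

(** The mirror image of [max_volume_perimeter], with [J = - volume]. The set [O] avoids [A] so that
    removing a cell in it preserves the inclusion of [A]. *)
Lemma min_volume_perimeter D (w : R) A B (L : R) : (2 <= n)%N ->
  0 < w -> widths (fun=> w) D -> lebesgue_measurable A -> lebesgue_measurable B ->
  A `<=` B -> B `<=` box D -> 0 <= L -> constrained A B L !=set0 ->
  exists2 E, constrained A B L E &
   (forall O, open O -> O `<=` B `\` A -> (perimeter E < L%:E)%E ->
     mu (E `&` O) = 0%E).
Proof.
move=> n2 w0 wD mA mB AB BD L0 X0.
have [|E F [mE _ EB _] [mF _ FB _]|E HE maxE] :=
  @constrained_maximizer _ _ D w A B L (fun E => - volume E) 0 w0 wD L0 mA mB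
    AB BD X0.
- by move=> E _; rewrite oppr_le0 volume_ge0.
- have := @volume_symdiff_lip _ _ D F E (subset_trans FB BD) (subset_trans EB
  BD) mF mE.
  by rewrite symdiffC; lra.
exists E => // O oO OB EL; apply: contrapT => OE.
have [mE AE EB _] := HE.
have [d d0 Hd] := perimeter_cube_gap n2 EL.
have [p [v [v0 vd pv pO Ep]]] := small_cell oO d0 OE.
have pB : box p `<=` B `\` A by exact: subset_trans pO OB.
have HF : constrained A B L (E `\` box p).
  split => //.
  - by apply: (@measurableD _ T) => //; exact: measurable_box.
  - by move=> x Ax; split; [exact: AE|move=> /pB[]].
  - by move=> x [/EB].
  - exact: le_trans (perimeter_setD_box v0 pv mE) (Hd _ v0 vd).
have := maxE _ HF.
rewrite (volume_setIDC (subset_trans EB BD) mE (measurable_box p)).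
have : 0 < volume (E `&` box p) by apply: (@volume_gt0 D) => // x [/EB/BD].
by lra.
Qed.

Lemma nexists_solution_P (G : set 'rV[R]_n) (L : R) : (2 <= n)%N -> open G ->
  bounded_set G ->
  mu (boundary G) = 0%E -> (perimeter G < L%:E)%E ->
  ~ exists E, solution_P G L E.
Proof.
move=> n2 oG bG G0 GL [E [[mE EG perE] maxE]].
have [r r0 GD] := bounded_closure_cube bG.
have w0 : 0 < 2 * r by rewrite mulr_gt0.
have L0 : 0 <= L by rewrite -lee_fin; apply: le_trans (ltW GL);
  exact: perimeter_ge0.
have mcG : lebesgue_measurable (closure G) by apply: measurable_closed;
  exact: closed_closure.
have mG := measurable_open oG.
have GcG : G `<=` closure G by exact: subset_closure.
have GD' : G `<=` box (cube r) by exact: subset_trans GcG GD.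
have ED : E `<=` box (cube r) by exact: subset_trans EG GD.
have EG0 : mu (E `\` G) = 0%E.
  apply/le_anti; rewrite measure_ge0 andbT -(open_boundary_null oG G0).
  by apply: (@le_lebesgue_outer R n) => x [/EG].
(* Otherwise [E] and [G] agree up to a null set, and the perimeter of [G] would be [L]. *)
have GE0 : mu (~` E `&` G) <> 0%E.
  rewrite setIC -setDE => GE0; move: GL; rewrite -(perimeter_eq0 (E := E) (F :=
    G)) ?perE ?ltxx//.
  apply/le_anti; rewrite measure_ge0 andbT.
  apply: le_trans (outer_measureU2 (lebesgue_outer_measure R n) _ _) _.
  by rewrite [X in (X + _)%E]EG0 [X in (_ + X)%E]GE0 adde0.
have VGE : 0 < volume (~` E `&` G) by apply: (@volume_gt0 (cube r)) => // x [_
  /GD'].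
have volE : volume E = volume G - volume (~` E `&` G).
  rewrite (volume_setIDC ED mE mG) (volume_setIDC GD' mG mE).
  have -> : volume (E `\` G) = 0 by rewrite /volume EG0.
  by rewrite setDE [~` E `&` G]setIC [G `&` E]setIC; lra.
(* A cell of side [w <= 1] has volume at most [w ^+ n <= w], hence at most half of the volume of G
   missed by [E]. *)
have d0 : 0 < Num.min 1 (volume (~` E `&` G) / 2) by rewrite lt_min ltr01
  divr_gt0.
(* A cell in which [E] misses positive measure has positive measure itself, as the comb construction
   requires. *)
have [D [w [w0' wd wD DG D0]]] := small_cell oG d0 GE0.
have n0 : (0 < n)%N by rewrite ltnW.
have mD0 : mu (box D) <> 0%E.
  move=> H; apply: D0; apply/le_anti; rewrite measure_ge0 andbT -H.
  by apply: (@le_lebesgue_outer R n) => x [].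
have [U [oU UD perU]] := comb_perimeter_gt L (Ordinal n0) oG w0' wD DG mD0.
have mU := measurable_open oU.
have UG : U `<=` G by exact: subset_trans UD DG.
have mGU : lebesgue_measurable (G `\` U) by exact: (@measurableD _ T).
(* [G] itself competes, because its perimeter is below [L]. *)
have X0 : constrained (G `\` U) G L !=set0.
  by exists G; split => //; exact: ltW.
have [F [mF GUF FG FL] HF] := min_volume_perimeter n2 w0 (widths_cube r) mGU mG
  (@subDsetl _ G U) GD' L0 X0.
have perF : perimeter F = L%:E.
  apply/le_anti; rewrite FL /= leNgt; apply/negP => ltFL.
  have UGU : U `<=` G `\` (G `\` U) by move=> x Ux; split;
    [exact: UG|move=> [_ /(_ Ux)]].
  have FU0 := HF U oU UGU ltFL.
  suff FGU : perimeter F = perimeter (G `\` U) by move: perU;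
    rewrite -FGU => /(lt_trans ltFL); rewrite ltxx.
  apply: perimeter_eq0 => //; apply/le_anti; rewrite measure_ge0 andbT -FU0.
  apply: (@le_lebesgue_outer R n) => x [[Fx GUx]|[GUx Fx]];
    last by have := Fx (GUF x GUx).
  by split => //; apply: contrapT => Ux; apply: GUx; split => //; exact: FG.
have FD : F `<=` box (cube r) by exact: subset_trans FG GD'.
have := maxE F; rewrite -(volumeE ED) -(volumeE FD) lee_fin.
move=> /(_ _) H.
have {H} : volume F <= volume E by apply: H; split => //;
  exact: subset_trans FG GcG.
have : volume (G `\` U) <= volume F by apply: (le_volume FD).
(* With [v] the volume missed by [E]: [volume F >= volume G - v / 2 > volume G - v = volume E],
   against the maximality of [E]. *)
have := volume_setIDC GD' mG mU; rewrite (setIidr UG).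
have : volume U <= volume (~` E `&` G) / 2.
  apply: (@le_trans _ _ (box_volume D)).
    rewrite -lee_fin (volumeE UD).
    by apply: le_trans (lebesgue_outer_box D); exact: le_lebesgue_outer.
  move: wd; rewrite le_min => /andP[w1 w2]; apply: le_trans w2.
  rewrite /box_volume; under eq_bigr do rewrite wD (@max_r _ _ 0) ?(ltW w0')//.
  rewrite prodr_const card_ord -[leRHS]expr1; apply: ler_wiXn2l => //; exact: ltW.
by rewrite volE; lra.
Qed.

End existence.

Theorem theorem2p2 (R : realType) (n : nat) (G : set 'rV[R]_n) :
  (2 <= n)%N ->
  open G ->
  bounded_set G ->
  lebesgue_n n (boundary G) = 0%E ->
  (forall L : R, (0 <= L)%R -> (L%:E < perimeter G)%E ->
     exists E : set 'rV[R]_n, solution_P G L E) /\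
  (forall L : R, (perimeter G < L%:E)%E ->
     ~ exists E : set 'rV[R]_n, solution_P G L E).
Proof.
move=> n2 oG bG G0; split => L.
  exact: exists_solution_P.
exact: nexists_solution_P.
Qed.
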